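(* For any $\mu_1, \mu_2 \in \mathcal{L}$, \[ W(\mu_1) \circlearrowleft W(\mu_2) = W(\mu_1 \rhd \mu_2), \qquad W(\mu_1) \times_B W(\mu_2) = W(\mu_1 \uplus \mu_2), \qquad W(\mu_1) \boxtimes W(\mu_2) = W(\mu_1 \boxplus \mu_2), \] and \[ \mathrm{Sub}^{\times}(W(\mu_2), W(\mu_1)) = W(\mathrm{Sub}(\mu_2, \mu_1)). \] Conversely, for any $\nu_1, \nu_2 \in \mathcal{ID}^{\times_B}_\ast$, \[ W^{-1}(\nu_1 \circlearrowleft \nu_2) = W^{-1}(\nu_1) \rhd W^{-1}(\nu_2) \mod \delta_{2 \pi}, \] \[ W^{-1}(\nu_1 \times_B \nu_2) = W^{-1}(\nu_1) \uplus W^{-1}(\nu_2) \mod \delta_{2 \pi}, \] \[ W^{-1}(\nu_1 \boxtimes \nu_2) = W^{-1}(\nu_1) \boxplus W^{-1}(\nu_2) \mod \delta_{2 \pi}. \] Thus $(\mathcal{L} \mod \delta_{2\pi})$ and $\mathcal{ID}^{\times_B}_*$ are isomorphic as semigroups with respect to the additive, respectively, multiplicative, Boolean, free, and monotone convolutions.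
   Context: For a probability measure $\mu$ on $\mathbb{R}$, $G_\mu(z)=\int \frac{1}{z-x}\,d\mu(x)$, $F_\mu = 1/G_\mu : \mathbb{C}^+\to\mathbb{C}^+$, and $\phi_\mu(z) = F_\mu^{-1}(z) - z$ (on a Stolz angle). Additive convolutions: $\phi_{\mu\boxplus\nu}=\phi_\mu+\phi_\nu$, $F_{\mu\uplus\nu}(z)-z = (F_\mu(z)-z)+(F_\nu(z)-z)$, $F_{\mu\rhd\nu}=F_\mu\circ F_\nu$. The additive subordination distribution $\mathrm{Sub}(\mu,\nu)$ is the probability measure on $\mathbb{R}$ whose $F$-transform is the analytic continuation of $F_\nu^{-1}\circ F_{\mu\boxplus\nu}$. The class $\mathcal{L}$ consists of probability measures $\mu$ on $\mathbb{R}$ with $F_\mu(z+2\pi)=F_\mu(z)+2\pi$ for all $z\in\mathbb{C}^+$. For measures in $\mathcal{L}$, $\delta_{2\pi n}\uplus\mu=\delta_{2\pi n}\rhd\mu=\mu\rhd\delta_{2\pi n}=\delta_{2\pi n}\boxplus\mu=\delta_{2\pi n}\ast\mu$, and ''$\mod \delta_{2\pi}$'' means equality up to such shifts by integer multiples of $2\pi$. For a probability measure $\nu$ on the unit circle $\mathbb{T}$, $\psi_\nu(z)=\int_{\mathbb{T}}\frac{z\zeta}{1-z\zeta}\,d\nu(\zeta)$, $\eta_\nu=\psi_\nu/(1+\psi_\nu)$, and when $\eta_\nu'(0)\neq 0$, $\Sigma_\nu(z)=\eta_\nu^{-1}(z)/z$ near $0$. Multiplicative convolutions: $\Sigma_{\mu\boxtimes\nu}=\Sigma_\mu\Sigma_\nu$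 (free), $\eta_{\mu\times_B\nu}(z)/z = (\eta_\mu(z)/z)(\eta_\nu(z)/z)$ (Boolean, denoted here $\times_B$), $\eta_{\mu\circlearrowleft\nu}=\eta_\mu\circ\eta_\nu$ (monotone). The multiplicative subordination distribution $\mathrm{Sub}^{\times}(\mu,\nu)$ is the measure on $\mathbb{T}$ whose $\eta$-transform is the analytic continuation of $\eta_\nu^{-1}\circ\eta_{\mu\boxtimes\nu}$. $\mathcal{ID}^{\times_B}_\ast$ is the set of probability measures on $\mathbb{T}$ infinitely divisible with respect to $\times_B$, excluding Lebesgue (Haar) measure; equivalently those $\nu$ with $\eta_\nu:\mathbb{D}\to\mathbb{D}$ analytic, $\eta_\nu'(0)\neq0$ and $\eta_\nu(z)=0\iff z=0$. The wrapping map $W$ sends a probability measure $\mu$ on $\mathbb{R}$ to the measure on $\mathbb{T}$ given by $d(W(\mu))(e^{-ix})=\sum_{n\in\mathbb{Z}} d\mu(x+2\pi n)$, i.e. $\int_{\mathbb{R}} f(e^{-ix})\,d\mu(x)=\int_{\mathbb{T}} f\,d W(\mu)$. It maps $\mathcal{L}$ onto $\mathcal{ID}^{\times_B}_\ast$, with $\exp(iF_\mu(z))=\eta_{W(\mu)}(e^{iz})$, and the preimage of each measure is a class modulo $\delta_{2\pi}$. *)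

(* Defs.v *)
From mathcomp Require Import all_boot all_algebra.
From mathcomp Require Import complex.
From mathcomp Require Import all_classical all_reals all_analysis.
Set Implicit Arguments. Unset Strict Implicit. Unset Printing Implicit Defensive.
Import GRing.Theory Num.Theory.
Local Open Scope classical_set_scope.
Local Open Scope ring_scope.
Local Open Scope complex_scope.

Section Defs.
Variable R : realType.

Definition cabs (z : R[i]) : R := Num.sqrt (complex.Re z ^+ 2 + complex.Im z ^+ 2).

Definition cauchyG (mu : probability R R) (z : R[i]) : R[i] :=
  Complex (Rintegral mu setT (fun x : R => complex.Re ((z - x%:C)^-1)))
          (Rintegral mu setT (fun x : R => complex.Im ((z - x%:C)^-1))).

Definition Ftr (mu : probability R R) (z : R[i]) : R[i] := (cauchyG mu z)^-1.

Definition stolz (a b : R) (z : R[i]) : Prop :=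
  b < complex.Im z /\ `|complex.Re z| < a * complex.Im z.

(** g is the (branch of the) inverse F^{-1} on Gamma_{a,b} used to define
    phi_mu(z) = F^{-1}(z) - z: a right inverse of F valued in C^+ with
    F^{-1}(z) - z = o(|z|) as z -> infinity in the Stolz angle. *)
Definition stolz_inverse (Fm : R[i] -> R[i]) (a b : R) (g : R[i] -> R[i]) : Prop :=
  (forall z, stolz a b z -> 0 < complex.Im (g z) /\ Fm (g z) = z) /\
  (forall eps : R, 0 < eps -> exists M : R, forall z, stolz a b z ->
      M < cabs z -> cabs (g z - z) < eps * cabs z).

Definition free_add (rho mu nu : probability R R) : Prop :=
  exists a b : R, 0 < a /\ 0 < b /\
  exists gr gm gn : R[i] -> R[i],
    stolz_inverse (Ftr rho) a b gr /\ stolz_inverse (Ftr mu) a b gm /\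
    stolz_inverse (Ftr nu) a b gn /\
    forall z, stolz a b z -> gr z - z = (gm z - z) + (gn z - z).

Definition boolean_add (rho mu nu : probability R R) : Prop :=
  forall z : R[i], 0 < complex.Im z ->
    Ftr rho z - z = (Ftr mu z - z) + (Ftr nu z - z).

Definition monotone_add (rho mu nu : probability R R) : Prop :=
  forall z : R[i], 0 < complex.Im z -> Ftr rho z = Ftr mu (Ftr nu z).

(** tau = Sub(mu, nu): F_tau is the analytic continuation of
    F_nu^{-1} o F_{mu [+] nu}, i.e. F_tau agrees with it on a Stolz angle. *)
Definition sub_add (tau mu nu : probability R R) : Prop :=
  exists sigma : probability R R, free_add sigma mu nu /\
  exists a b : R, 0 < a /\ 0 < b /\
  exists g : R[i] -> R[i], stolz_inverse (Ftr nu) a b g /\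
  exists a' b' : R, 0 < a' /\ 0 < b' /\
    forall z, stolz a' b' z ->
      stolz a b (Ftr sigma z) /\ Ftr tau z = g (Ftr sigma z).

Definition classL (mu : probability R R) : Prop :=
  forall z : R[i], 0 < complex.Im z ->
    Ftr mu (z + (2 * pi)%:C) = Ftr mu z + (2 * pi)%:C.

Definition shifted (rho mu : probability R R) (n : int) : Prop :=
  forall A : set R, measurable A ->
    rho A = mu ((fun x : R => x + 2 * pi * n%:~R) @^-1` A).

(** Measures on the unit circle T.  A probability measure on T is
    represented by its pull-back to the angle interval [0, 2 pi) under the
    Borel isomorphism theta |-> e^{i theta}: a probability measure on R
    giving full mass to [0, 2 pi).                                         *)

Definition angle_dom : set R := `[0, 2 * pi[%classic.

Definition circ (nu : probability R R) : Prop :=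
  nu angle_dom = 1%E.

Definition zeta (theta : R) : R[i] := Complex (cos theta) (sin theta).

Definition psi (nu : probability R R) (z : R[i]) : R[i] :=
  Complex (Rintegral nu setT (fun t : R => complex.Re (z * zeta t / (1 - z * zeta t))))
          (Rintegral nu setT (fun t : R => complex.Im (z * zeta t / (1 - z * zeta t)))).

Definition eta (nu : probability R R) (z : R[i]) : R[i] :=
  psi nu z / (1 + psi nu z).

(** g is the inverse eta^{-1} near 0 (used for Sigma_nu(z) = eta^{-1}(z)/z):
    a right inverse of eta on the disc |z| < r, valued in D, with g -> 0 at 0. *)
Definition disc_inverse (E : R[i] -> R[i]) (r : R) (g : R[i] -> R[i]) : Prop :=
  (forall z, cabs z < r -> cabs (g z) < 1 /\ E (g z) = z) /\
  (forall eps : R, 0 < eps -> exists delta : R, 0 < delta /\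
      forall z, cabs z < r -> cabs z < delta -> cabs (g z) < eps).

Definition free_mult (rho mu nu : probability R R) : Prop :=
  exists r : R, 0 < r /\
  exists gr gm gn : R[i] -> R[i],
    disc_inverse (eta rho) r gr /\ disc_inverse (eta mu) r gm /\
    disc_inverse (eta nu) r gn /\
    forall z, 0 < cabs z -> cabs z < r -> gr z / z = (gm z / z) * (gn z / z).

Definition boolean_mult (rho mu nu : probability R R) : Prop :=
  forall z : R[i], 0 < cabs z -> cabs z < 1 ->
    eta rho z / z = (eta mu z / z) * (eta nu z / z).

Definition monotone_mult (rho mu nu : probability R R) : Prop :=
  forall z : R[i], cabs z < 1 -> eta rho z = eta mu (eta nu z).

(** tau = Sub^x(mu, nu): eta_tau is the analytic continuation of
    eta_nu^{-1} o eta_{mu [x] nu}, i.e. agrees with it near 0. *)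
Definition sub_mult (tau mu nu : probability R R) : Prop :=
  exists sigma : probability R R, circ sigma /\ free_mult sigma mu nu /\
  exists r : R, 0 < r /\
  exists g : R[i] -> R[i], disc_inverse (eta nu) r g /\
  exists r' : R, 0 < r' /\
    forall z, cabs z < r' ->
      cabs (eta sigma z) < r /\ eta tau z = g (eta sigma z).

Definition is_haar (nu : probability R R) : Prop :=
  forall A : set R, measurable A ->
    nu A = (lebesgue_measure (A `&` angle_dom) * ((2 * pi)^-1)%:E)%E.

(** ID^{x_B}_* : x_B-infinitely divisible circle measures, Haar excluded.
    The n-fold Boolean power nu_n^{x_B n} has eta/z = (eta_{nu_n}/z)^n. *)
Definition IDB_star (nu : probability R R) : Prop :=
  circ nu /\
  (forall n : nat, (0 < n)%N -> exists nun : probability R R, circ nun /\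
     forall z : R[i], 0 < cabs z -> cabs z < 1 ->
       eta nu z / z = (eta nun z / z) ^+ n) /\
  ~ is_haar nu.

(** The wrapping map.  The angle in [0, 2 pi) of e^{-ix}. *)
Definition wrap_angle (x : R) : R :=
  - x - 2 * pi * (Num.floor (- x / (2 * pi)))%:~R.

(** nu = W(mu): int_R f(e^{-ix}) dmu(x) = int_T f dnu, i.e. nu is the
    push-forward of mu under x |-> e^{-ix} (in the angle picture). *)
Definition is_wrap (nu mu : probability R R) : Prop :=
  forall A : set R, measurable A -> nu A = mu (wrap_angle @^-1` A).

End Defs.

(* Main.v *)
Require Import Defs.
From mathcomp Require Import all_boot all_order all_algebra.
From mathcomp Require Import complex.
From mathcomp Require Import all_classical all_reals all_analysis.
From mathcomp Require Import measurable_realfun.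
From mathcomp Require Import ring lra.
Set Implicit Arguments. Unset Strict Implicit. Unset Printing Implicit Defensive.
Import Order.TTheory GRing.Theory Num.Theory.
Import numFieldNormedType.Exports.
Local Open Scope classical_set_scope.
Local Open Scope ring_scope.

(** The identity [exp (i F_mu z) = eta_(W mu) (exp (i z))] turns each additive
    relation into the multiplicative one.  To prove it, expand
    [e^{iu} / (1 - e^{iu})] by Mittag-Leffler as a sum of [1 / (u + 2 pi n)]: under
    the integral this sums [G_mu (z + 2 pi n) = 1 / (F_mu z + 2 pi n)], by
    periodicity of [F_mu - id], and the same expansion resums the result.  In the
    free case the inverses of [F] commute with the period high up in a Stolz angle,
    where [F] is injective, so the relation first gives the periodicity of
    [F_rho - id] there and then, by the identity theorem, everywhere; the inverses
    of [eta] near [0] are the exponentials of those of [F].  For the converse, the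
    multiplicative relation determines [psi] of the convolution, hence the measure,
    by inversion of [psi] on the circle; two measures of the class with the same
    wrapping have [F]-transforms differing pointwise, thus globally, by a constant
    multiple of [2 pi]. *)

(** The series of $1/(u+2\pi n)$ converges only conditionally, so it is never summed by itself. What
    is summed is the gap between its terms at [u] and at [u + d], which is $O(n^{-2})$; comparison
    with increments of $\arctan$ over steps of $2\pi$, which telescope, gives bounds uniform in the
    real part, as dominated convergence in the variable of integration demands. The shift [d] is
    finally sent up the imaginary axis, where $e^{iu}/(1-e^{iu})$ vanishes. Analyticity enters
    through power series with geometric remainders; since the equations between values of $F$ become
    polynomial in $G=1/F$ after clearing denominators, it is $G$ that is expanded. The inverses in
    the free convolutions are given by existence, with only an asymptotic condition: injectivity of
    $F$ near infinity and of $\eta$ near $0$ is what pins them down. *)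

Local Notation Re := (@complex.Re _).
Local Notation Im := (@complex.Im _).

(** * The modulus and the exponential *)

Section Cabs.
Local Open Scope complex_scope.
Variable R : realType.
Implicit Types z w : R[i].

Lemma cabsE z : cabs z = ComplexField.Normc.normc z.
Proof. by case: z. Qed.

Lemma cabs_norm z : (cabs z)%:C = `|z|.
Proof. by case: z. Qed.

Lemma cabs_ge0 z : 0 <= cabs z.
Proof. exact: sqrtr_ge0. Qed.

Lemma cabs0 : cabs (0 : R[i]) = 0.
Proof. by rewrite cabsE ComplexField.Normc.normc0. Qed.

Lemma cabs1 : cabs (1 : R[i]) = 1.
Proof. by rewrite cabsE ComplexField.Normc.normc1. Qed.

Lemma cabsM z w : cabs (z * w) = cabs z * cabs w.
Proof. by rewrite !cabsE ComplexField.Normc.normcM. Qed.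

Lemma cabsV z : cabs z^-1 = (cabs z)^-1.
Proof. by rewrite !cabsE ComplexField.Normc.normcV. Qed.

Lemma cabs_div z w : cabs (z / w) = cabs z / cabs w.
Proof. by rewrite cabsM cabsV. Qed.

Lemma cabsN z : cabs (- z) = cabs z.
Proof. by case: z => a b; rewrite /cabs /= !sqrrN. Qed.

Lemma cabs_eq0 z : (cabs z == 0) = (z == 0).
Proof.
apply/eqP/eqP => [|->]; last exact: cabs0.
by rewrite cabsE => /ComplexField.Normc.eq0_normc.
Qed.

Lemma cabs_gt0 z : (0 < cabs z) = (z != 0).
Proof. by rewrite lt_def cabs_eq0 cabs_ge0 andbT. Qed.

Lemma cabsX z n : cabs (z ^+ n) = cabs z ^+ n.
Proof. by elim: n => [|n IH]; rewrite ?expr0 ?cabs1// !exprS cabsM IH. Qed.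

Lemma cabsD z w : cabs (z + w) <= cabs z + cabs w.
Proof. by rewrite -lecR rmorphD /= !cabs_norm ler_normD. Qed.

Lemma cabsB z w : cabs (z - w) <= cabs z + cabs w.
Proof. by rewrite -(cabsN w) cabsD. Qed.

Lemma cabsBC z w : cabs (z - w) = cabs (w - z).
Proof. by rewrite -cabsN opprB. Qed.

Lemma cabs_lowerB z w : cabs z - cabs w <= cabs (z - w).
Proof. by rewrite lerBlDr -{1}(subrK w z) cabsD. Qed.

Lemma cabs_sum n (f : nat -> R[i]) :
  cabs (\sum_(i < n) f i) <= \sum_(i < n) cabs (f i).
Proof.
elim: n => [|n IH]; first by rewrite !big_ord0 cabs0.
by rewrite !big_ord_recr /=; apply: le_trans (cabsD _ _) _; rewrite lerD2r.
Qed.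

Lemma sqr_cabs z : cabs z ^+ 2 = Re z ^+ 2 + Im z ^+ 2.
Proof. by rewrite sqr_sqrtr // addr_ge0 // sqr_ge0. Qed.

Lemma cabs_le_sqr z (k : R) : 0 <= k -> (cabs z <= k) = (Re z ^+ 2 + Im z ^+ 2 <= k ^+ 2).
Proof. by move=> k0; rewrite -sqr_cabs ler_sqr // nnegrE cabs_ge0. Qed.

Lemma le_cabs_sqr z (k : R) : 0 <= k -> (k <= cabs z) = (k ^+ 2 <= Re z ^+ 2 + Im z ^+ 2).
Proof. by move=> k0; rewrite -sqr_cabs ler_sqr // nnegrE cabs_ge0. Qed.

Lemma normRe_cabs z : `|Re z| <= cabs z.
Proof. by rewrite le_cabs_sqr // real_normK ?num_real // lerDl sqr_ge0. Qed.

Lemma normIm_cabs z : `|Im z| <= cabs z.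
Proof. by rewrite le_cabs_sqr // real_normK ?num_real // lerDr sqr_ge0. Qed.

Lemma Im_cabs z : Im z <= cabs z.
Proof. exact: le_trans (ler_norm _) (normIm_cabs z). Qed.

Lemma cabs_ReIm z : cabs z <= `|Re z| + `|Im z|.
Proof.
rewrite cabs_le_sqr ?addr_ge0 // sqrrD !real_normK ?num_real //.
by rewrite addrAC lerDl mulrn_wge0 ?mulr_ge0.
Qed.

Lemma cabsR (x : R) : cabs x%:C = `|x|.
Proof. by rewrite /cabs /= expr0n /= addr0 sqrtr_sqr. Qed.

Lemma cabsI : cabs ('i : R[i]) = 1.
Proof. by rewrite /cabs /= expr0n /= add0r expr1n sqrtr1. Qed.

Lemma Im_gt0_neq0 z : 0 < Im z -> z != 0.
Proof. by apply: contraTneq => ->; rewrite ltxx. Qed.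

Lemma cReD z w : Re (z + w) = Re z + Re w. Proof. by case: z w => [a b] [c d]. Qed.
Lemma cImD z w : Im (z + w) = Im z + Im w. Proof. by case: z w => [a b] [c d]. Qed.
Lemma cReN z : Re (- z) = - Re z. Proof. by case: z. Qed.
Lemma cImN z : Im (- z) = - Im z. Proof. by case: z. Qed.
Lemma cReB z w : Re (z - w) = Re z - Re w. Proof. by rewrite cReD cReN. Qed.
Lemma cImB z w : Im (z - w) = Im z - Im w. Proof. by rewrite cImD cImN. Qed.
Lemma cReM z w : Re (z * w) = Re z * Re w - Im z * Im w.
Proof. by case: z w => [a b] [c d]. Qed.
Lemma cImM z w : Im (z * w) = Re z * Im w + Im z * Re w.
Proof. by case: z w => [a b] [c d]. Qed.
Lemma cReV z : Re z^-1 = Re z / (Re z ^+ 2 + Im z ^+ 2). Proof. by case: z. Qed.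
Lemma cImV z : Im z^-1 = - (Im z / (Re z ^+ 2 + Im z ^+ 2)). Proof. by case: z. Qed.

Lemma complex_eqP z w : Re z = Re w -> Im z = Im w -> z = w.
Proof. by case: z w => [a b] [c d] /= -> ->. Qed.

End Cabs.

(** * The map $e^{iu}$ and its fibres *)

Section Cei.
Local Open Scope complex_scope.
Variable R : realType.
Implicit Types u v : R[i].

(** The function $e^{iu}$; it carries the upper half-plane onto the punctured unit disc. *)
Definition cei u : R[i] :=
  Complex (expR (- Im u) * cos (Re u)) (expR (- Im u) * sin (Re u)).

Lemma cei0 : cei 0 = 1.
Proof. by apply: complex_eqP; rewrite /= oppr0 expR0 ?cos0 ?sin0 mul1r. Qed.

Lemma ceiD u v : cei (u + v) = cei u * cei v.
Proof.
apply: complex_eqP; rewrite ?cReM ?cImM /= cReD cImD opprD expRD ?cosD ?sinD; ring.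
Qed.

Lemma cabs_cei u : cabs (cei u) = expR (- Im u).
Proof.
rewrite /cabs /= !exprMn -mulrDr cos2Dsin2 mulr1 sqrtr_sqr ger0_norm //.
Qed.

Lemma cei_neq0 u : cei u != 0.
Proof. by rewrite -cabs_gt0 cabs_cei expR_gt0. Qed.

Lemma ceiN u : cei (- u) = (cei u)^-1.
Proof.
by apply: (mulfI (cei_neq0 u)); rewrite -ceiD subrr cei0 mulfV // cei_neq0.
Qed.

Lemma ceiB u v : cei (u - v) = cei u / cei v.
Proof. by rewrite ceiD ceiN. Qed.

Lemma cei2pi : cei (2 * pi)%:C = 1.
Proof.
by apply: complex_eqP => /=; rewrite oppr0 expR0 mul1r mulr_natl ?cos2pi ?sin2pi.
Qed.

Lemma cei_2pin (n : nat) : cei (2 * pi * n%:R)%:C = 1.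
Proof.
elim: n => [|n IH]; first by rewrite mulr0 cei0.
have -> : 2 * pi * n.+1%:R = 2 * pi * n%:R + 2 * pi :> R.
  by rewrite -[n.+1]addn1 natrD mulrDr mulr1.
by rewrite rmorphD /= ceiD IH cei2pi mulr1.
Qed.

Lemma cei_2piz (n : int) : cei (2 * pi * n%:~R)%:C = 1.
Proof.
case: n => n; first exact: cei_2pin.
by rewrite NegzE mulrNz mulrN rmorphN /= ceiN cei_2pin invr1.
Qed.

Lemma ceiDz u (n : int) : cei (u + (2 * pi * n%:~R)%:C) = cei u.
Proof. by rewrite ceiD cei_2piz mulr1. Qed.

Lemma cabs_cei_lt1 u : 0 < Im u -> cabs (cei u) < 1.
Proof. by move=> u0; rewrite cabs_cei expR_lt1 oppr_lt0. Qed.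

Lemma cei_zeta (x : R) : cei x%:C = zeta x.
Proof. by rewrite /cei /zeta /= oppr0 expR0 !mul1r. Qed.

Lemma cabs_zeta (x : R) : cabs (zeta x) = 1.
Proof. by rewrite -cei_zeta cabs_cei oppr0 expR0. Qed.

Lemma subr1_cei_neq0 u : 0 < Im u -> 1 - cei u != 0.
Proof.
move=> u0; rewrite subr_eq0; apply: contraTneq (cabs_cei_lt1 u0) => <-.
by rewrite cabs1 ltxx.
Qed.

Definition frac2pi (x : R) : R := x - 2 * pi * (Num.floor (x / (2 * pi)))%:~R.

Lemma frac2pi_itv x : 0 <= frac2pi x < 2 * pi.
Proof.
have p0 : 0 < 2 * pi :> R by rewrite mulr_gt0 ?pi_gt0.
have h := floor_le (x / (2 * pi)); have h' := floorD1_gt (x / (2 * pi)).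
rewrite /frac2pi subr_ge0 ltrBlDl.
rewrite ler_pdivlMr // mulrC in h.
rewrite ltr_pdivrMr // intrD mulrDl mul1r mulrC in h'.
by rewrite h.
Qed.

(** Comparing moduli kills the imaginary part. The real part reduced to $f\in[0,2\pi)$ has $\cos
    f=1$, so $\sin(f/2)=0$ by the double angle formula, and $\sin>0$ on $(0,\pi)$ leaves only
    $f=0$. *)
Lemma cei_eq1 u : cei u = 1 -> exists n : int, u = (2 * pi * n%:~R)%:C.
Proof.
move=> h.
have Iu : Im u = 0.
  have := congr1 (@cabs R) h; rewrite cabs_cei cabs1.
  by rewrite -expR0 => /expR_inj /eqP; rewrite oppr_eq0 => /eqP.
exists (Num.floor (Re u / (2 * pi))).
set n := Num.floor _.
have uE : u = (Re u)%:C by apply: complex_eqP.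
have /andP[f0 f1] := frac2pi_itv (Re u).
have hf : cei (frac2pi (Re u))%:C = 1.
  rewrite /frac2pi rmorphB /= ceiB cei_2piz divr1 -uE h //.
rewrite cei_zeta in hf; have hc := congr1 Re hf; rewrite /= in hc.
have f2 : frac2pi (Re u) = 0.
  set f := frac2pi _ in hc f0 f1 *.
  have s0 : sin (f / 2) = 0.
    have : cos (f / 2 *+ 2) = 1 by rewrite -mulr_natr divfK // pnatr_eq0.
    rewrite cos_mulr2n cos2sin2 => e; apply/eqP; rewrite -sqrf_eq0; apply/eqP.
    by move: e; set q := sin _ ^+ 2; lra.
  apply/eqP; rewrite eq_le f0 andbT leNgt; apply/negP => fp.
  have : 0 < sin (f / 2).
    by apply: sin_gt0_pi; rewrite divr_gt0 //= ltr_pdivrMr // mulrC.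
  by rewrite s0 ltxx.
by rewrite uE; congr _%:C; apply/eqP; rewrite -subr_eq0; apply/eqP.
Qed.

Lemma cei_inj u v : cei u = cei v -> exists n : int, u = v + (2 * pi * n%:~R)%:C.
Proof.
move=> h; have [|n hn] := @cei_eq1 (u - v).
  by rewrite ceiB h divff // cei_neq0.
by exists n; rewrite -hn addrC subrK.
Qed.

Lemma zeta_surj (a b : R) : a ^+ 2 + b ^+ 2 = 1 -> exists t, zeta t = Complex a b.
Proof.
move=> h.
have a1 : -1 <= a <= 1.
  by rewrite -ler_norml -(@ler_sqr _ `|a|) ?nnegrE // expr1n real_normK ?num_real // -h lerDl sqr_ge0.
have sE : `|b| = sin (acos a).
  by rewrite sin_acos // -h addrC addKr sqrtr_sqr.
have cE : cos (acos a) = a by rewrite acosK // in_itv.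
have [b0|b0] := leP 0 b.
  by exists (acos a); rewrite /zeta cE -sE ger0_norm.
by exists (- acos a); rewrite /zeta cosN sinN cE -sE ltr0_norm // opprK.
Qed.

(** Polar coordinates. Fixing the real part in $[0,2\pi)$ selects one branch of the logarithm and
    keeps the preimage in a vertical strip. *)
Lemma cei_surj (w : R[i]) : w != 0 ->
  exists u, [/\ cei u = w, 0 <= Re u < 2 * pi & Im u = - ln (cabs w)].
Proof.
rewrite -cabs_gt0 => w0.
have [|t ht] := @zeta_surj (Re w / cabs w) (Im w / cabs w).
  by rewrite !expr_div_n -mulrDl -sqr_cabs divff // expf_neq0 // gt_eqF.
exists (Complex (frac2pi t) (- ln (cabs w))); split => //=; last exact: frac2pi_itv.
have -> : Complex (frac2pi t) (- ln (cabs w)) = t%:C + Complex 0 (- ln (cabs w))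
    - (2 * pi * (Num.floor (t / (2 * pi)))%:~R)%:C.
  by apply: complex_eqP; rewrite /= ?oppr0 ?addr0 ?add0r.
rewrite ceiB cei_2piz divr1 ceiD cei_zeta ht.
rewrite /cei /= opprK lnK ?posrE // cos0 sin0 mulr0 mulr1.
by apply: complex_eqP; rewrite /= mulr0 ?subr0 ?add0r -mulrA mulVf ?mulr1 // gt_eqF.
Qed.

End Cei.

(** * Complex integrals of bounded functions *)

Section Integral.
Local Open Scope complex_scope.
Variable R : realType.
Implicit Types (mu nu : probability R R) (f g : R -> R) (F G : R -> R[i]).

(** All kernels below are of this kind, which makes them integrable against any probability
    measure. *)
Definition bmeas f := measurable_fun setT f /\ exists K : R, forall x, `|f x| <= K.

Lemma mass1 mu : mu [set: R] = 1%E.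
Proof. exact: probability_setT. Qed.

Lemma bmeas_integrable mu f : bmeas f -> mu.-integrable setT (EFin \o f).
Proof.
move=> [mf [K hK]]; apply: measurable_bounded_integrable => //.
  suff h : (mu [set: R] < +oo)%E by exact: h.
  by rewrite mass1 ltry.
exists K; split; first exact: num_real.
by move=> M KM x _ /=; apply: le_trans (hK x) (ltW KM).
Qed.

Lemma Rint_cst mu (k : R) : Rintegral mu setT (fun=> k) = k.
Proof. by transitivity (k * fine (mu [set: R])); [exact: Rintegral_cst | rewrite mass1 mulr1]. Qed.

Lemma Rint_le mu f g : bmeas f -> bmeas g -> (forall x, f x <= g x) ->
  Rintegral mu setT f <= Rintegral mu setT g.
Proof. by move=> bf bg fg; apply: le_Rintegral => // *; exact: bmeas_integrable. Qed.

Lemma Rint_bound mu f (K : R) : bmeas f -> (forall x, `|f x| <= K) ->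
  `|Rintegral mu setT f| <= K.
Proof.
move=> bf hK; have [mf _] := bf.
have := le_normr_Rintegral measurableT (bmeas_integrable mu bf).
move/le_trans; apply.
rewrite -[leRHS](Rint_cst mu).
apply: Rint_le => //.
- by split; [exact: measurableT_comp | exists K => x; rewrite normr_id].
- by split => //; exists `|K|.
Qed.

Lemma Rint_eq mu f g : (forall x, f x = g x) ->
  Rintegral mu setT f = Rintegral mu setT g.
Proof. by move=> h; apply: eq_Rintegral => x _; exact: h. Qed.

Lemma Rint_dct mu (fn : nat -> R -> R) f (K : R) :
  (forall n, measurable_fun setT (fn n)) -> measurable_fun setT f ->
  (forall n x, `|fn n x| <= K) ->
  (forall x, fn ^~ x @ \oo --> f x) ->
  (fun n => Rintegral mu setT (fn n)) @ \oo --> Rintegral mu setT f.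
Proof.
move=> mfn mf hK cf.
have bf : bmeas f.
  split => //; exists K => x.
  have /cvg_lim <- // : (fun n => `|fn n x|) @ \oo --> `|f x| by apply: cvg_norm; exact: cf.
  apply: limr_le; last by apply: nearW => n; exact: hK.
  by apply/cvg_ex; exists `|f x|; apply: cvg_norm; exact: cf.
have ifin h : bmeas h -> ((\int[mu]_x (h x)%:E)%E = (Rintegral mu setT h)%:E)%E.
  by move=> bh; rewrite fineK // ; apply: integrable_fin_num => //; exact: bmeas_integrable.
have [|||||_ _ h] := @dominated_convergence _ _ _ mu setT measurableT
   (fun n x => (fn n x)%:E) (EFin \o f) (cst K%:E).
- by move=> n; apply/measurable_EFinP.
- by apply/measurable_EFinP.
- by apply: aeW => x _; apply: cvg_EFin; [exact: nearW | exact: cf].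
- by apply: bmeas_integrable; split => //; exists `|K|.
- by apply: aeW => x n _; rewrite /= lee_fin.
by rewrite ifin // in h; exact: (fine_cvg h).
Qed.

Definition cmeas F := measurable_fun setT (fun x => Re (F x)) /\
                      measurable_fun setT (fun x => Im (F x)).

Definition bcmeas F := cmeas F /\ exists K : R, forall x, cabs (F x) <= K.

(** Taken componentwise, so that [cauchyG] and [psi] are instances by conversion. *)
Definition cint mu F : R[i] :=
  Complex (Rintegral mu setT (fun x => Re (F x)))
          (Rintegral mu setT (fun x => Im (F x))).

Lemma bcmeas_Re F : bcmeas F -> bmeas (fun x => Re (F x)).
Proof.
move=> [[m1 m2] [K hK]]; split => //; exists K => x.
exact: le_trans (normRe_cabs _) (hK x).
Qed.

Lemma bcmeas_Im F : bcmeas F -> bmeas (fun x => Im (F x)).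
Proof.
move=> [[m1 m2] [K hK]]; split => //; exists K => x.
exact: le_trans (normIm_cabs _) (hK x).
Qed.

Lemma cmeas_cst (z : R[i]) : cmeas (fun=> z).
Proof. by []. Qed.

Lemma cmeasR f : measurable_fun setT f -> cmeas (fun x => (f x)%:C).
Proof. by []. Qed.

Lemma cmeasD F G : cmeas F -> cmeas G -> cmeas (fun x => F x + G x).
Proof.
move=> [f1 f2] [g1 g2]; split.
  by under eq_fun do rewrite cReD; exact: measurable_funD.
by under eq_fun do rewrite cImD; exact: measurable_funD.
Qed.

Lemma cmeasN F : cmeas F -> cmeas (fun x => - F x).
Proof.
move=> [f1 f2]; split.
  by under eq_fun do rewrite cReN; exact: measurable_funN.
by under eq_fun do rewrite cImN; exact: measurable_funN.
Qed.

Lemma cmeasB F G : cmeas F -> cmeas G -> cmeas (fun x => F x - G x).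
Proof. by move=> mF mG; apply: cmeasD => //; exact: cmeasN. Qed.

Lemma cmeasM F G : cmeas F -> cmeas G -> cmeas (fun x => F x * G x).
Proof.
move=> [f1 f2] [g1 g2]; split.
  by under eq_fun do rewrite cReM; apply: measurable_funB; exact: measurable_funM.
by under eq_fun do rewrite cImM; apply: measurable_funD; exact: measurable_funM.
Qed.

Lemma measurable_invf_ge0 f : measurable_fun setT f -> (forall x, 0 <= f x) ->
  measurable_fun setT (fun x => (f x)^-1).
Proof.
move=> mf f0; under eq_fun do rewrite -powR_inv1 //.
exact: (measurableT_comp (measurable_powR _)).
Qed.

Lemma cmeasV F : cmeas F -> cmeas (fun x => (F x)^-1).
Proof.
move=> [f1 f2].
have mn : measurable_fun setT (fun x => (Re (F x) ^+ 2 + Im (F x) ^+ 2)^-1).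
  apply: measurable_invf_ge0; last by move=> x; rewrite addr_ge0 // sqr_ge0.
  by apply: measurable_funD; exact: measurable_funX.
split.
  by under eq_fun do rewrite cReV; exact: measurable_funM.
by under eq_fun do rewrite cImV; apply: measurable_funN; exact: measurable_funM.
Qed.

Lemma bcmeas_cst (z : R[i]) : bcmeas (fun=> z).
Proof. by split; [exact: cmeas_cst | exists (cabs z)]. Qed.

Lemma bcmeasD F G : bcmeas F -> bcmeas G -> bcmeas (fun x => F x + G x).
Proof.
move=> [mF [K hK]] [mG [L hL]]; split; first exact: cmeasD.
by exists (K + L) => x; apply: le_trans (cabsD _ _) _; exact: lerD.
Qed.

Lemma bcmeasN F : bcmeas F -> bcmeas (fun x => - F x).
Proof.
move=> [mF [K hK]]; split; first exact: cmeasN.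
by exists K => x; rewrite cabsN.
Qed.

Lemma bcmeasB F G : bcmeas F -> bcmeas G -> bcmeas (fun x => F x - G x).
Proof. by move=> bF bG; apply: bcmeasD => //; exact: bcmeasN. Qed.

Lemma bcmeasM F G : bcmeas F -> bcmeas G -> bcmeas (fun x => F x * G x).
Proof.
move=> [mF [K hK]] [mG [L hL]]; split; first exact: cmeasM.
by exists (K * L) => x; rewrite cabsM ler_pM ?cabs_ge0.
Qed.

Lemma bcmeasZ (a : R[i]) F : bcmeas F -> bcmeas (fun x => a * F x).
Proof. by move=> bF; apply: bcmeasM => //; exact: bcmeas_cst. Qed.

Lemma bcmeasX F n : bcmeas F -> bcmeas (fun x => F x ^+ n).
Proof.
move=> bF; elim: n => [|n IH]; first exact: bcmeas_cst.
by under eq_fun do rewrite exprS; exact: bcmeasM.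
Qed.

Lemma bcmeas_sum n (F : nat -> R -> R[i]) : (forall i, bcmeas (F i)) ->
  bcmeas (fun x => \sum_(i < n) F i x).
Proof.
move=> bF; elim: n => [|n IH].
  by under eq_fun do rewrite big_ord0; exact: bcmeas_cst.
by under eq_fun do rewrite big_ord_recr /=; exact: bcmeasD.
Qed.

Lemma bcmeasV F (k : R) : 0 < k -> cmeas F -> (forall x, k <= cabs (F x)) ->
  bcmeas (fun x => (F x)^-1).
Proof.
move=> k0 mF hk; split; first exact: cmeasV.
exists k^-1 => x; rewrite cabsV lef_pV2 ?posrE //.
exact: lt_le_trans k0 (hk x).
Qed.

Lemma cint_eq mu F G : (forall x, F x = G x) -> cint mu F = cint mu G.
Proof. by move=> h; congr Complex; apply: Rint_eq => x; rewrite h. Qed.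

Lemma cint_cst mu z : cint mu (fun=> z) = z.
Proof. by apply: complex_eqP; rewrite /= Rint_cst. Qed.

Lemma cintD mu F G : bcmeas F -> bcmeas G ->
  cint mu (fun x => F x + G x) = cint mu F + cint mu G.
Proof.
move=> bF bG; apply: complex_eqP; rewrite ?cReD ?cImD /=.
  rewrite (Rint_eq _ (fun x => cReD (F x) (G x))) RintegralD //;
    by apply: bmeas_integrable; exact: bcmeas_Re.
rewrite (Rint_eq _ (fun x => cImD (F x) (G x))) RintegralD //;
  by apply: bmeas_integrable; exact: bcmeas_Im.
Qed.

Lemma Rint_Zl mu (k : R) f : bmeas f ->
  Rintegral mu setT (fun x => k * f x) = k * Rintegral mu setT f.
Proof. by move=> bf; apply: RintegralZl => //; exact: bmeas_integrable. Qed.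

Lemma bmeasZ (k : R) f : bmeas f -> bmeas (fun x => k * f x).
Proof.
move=> [mf [K hK]]; split; first exact: measurable_funM.
by exists (`|k| * K) => x; rewrite normrM ler_wpM2l.
Qed.

Lemma cintZ mu a F : bcmeas F -> cint mu (fun x => a * F x) = a * cint mu F.
Proof.
move=> bF; have bR := bcmeas_Re bF; have bI := bcmeas_Im bF.
apply: complex_eqP; rewrite ?cReM ?cImM /=.
  rewrite (Rint_eq _ (fun x => cReM a (F x))) RintegralB ?Rint_Zl //;
    by apply: bmeas_integrable; exact: bmeasZ.
rewrite (Rint_eq _ (fun x => cImM a (F x))) RintegralD ?Rint_Zl //;
  by apply: bmeas_integrable; exact: bmeasZ.
Qed.

Lemma cintN mu F : bcmeas F -> cint mu (fun x => - F x) = - cint mu F.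
Proof.
by move=> bF; rewrite -mulN1r -cintZ //; apply: cint_eq => x; rewrite mulN1r.
Qed.

Lemma cintB mu F G : bcmeas F -> bcmeas G ->
  cint mu (fun x => F x - G x) = cint mu F - cint mu G.
Proof. by move=> bF bG; rewrite cintD ?cintN //; exact: bcmeasN. Qed.

Lemma cint_sum mu n (F : nat -> R -> R[i]) : (forall i, bcmeas (F i)) ->
  cint mu (fun x => \sum_(i < n) F i x) = \sum_(i < n) cint mu (F i).
Proof.
move=> bF; elim: n => [|n IH].
  rewrite big_ord0 -[RHS](cint_cst mu); apply: cint_eq => x.
  by rewrite big_ord0.
rewrite big_ord_recr /= -IH -cintD //; last exact: bcmeas_sum.
by apply: cint_eq => x; rewrite big_ord_recr.
Qed.

(** The factor 2 pays for bounding the real and imaginary parts separately; no later estimate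
    depends on a sharp constant. *)
Lemma cint_bound mu F (g : R -> R) : bcmeas F -> bmeas g ->
  (forall x, cabs (F x) <= g x) -> cabs (cint mu F) <= 2 * Rintegral mu setT g.
Proof.
move=> bF bg h.
have step f : bmeas f -> (forall x, `|f x| <= g x) ->
    `|Rintegral mu setT f| <= Rintegral mu setT g.
  move=> bf hf; have := le_normr_Rintegral measurableT (bmeas_integrable mu bf).
  move/le_trans; apply; apply: Rint_le => //.
  case: bf => mf [K hK]; split; first exact: measurableT_comp.
  by exists K => x; rewrite normr_id.
apply: le_trans (cabs_ReIm _) _; rewrite mulr_natl mulr2n lerD //=.
  apply: step; first exact: bcmeas_Re.
  by move=> x; apply: le_trans (normRe_cabs _) (h x).
apply: step; first exact: bcmeas_Im.
by move=> x; apply: le_trans (normIm_cabs _) (h x).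
Qed.

Lemma cint_boundK mu F (K : R) : cmeas F ->
  (forall x, cabs (F x) <= K) -> cabs (cint mu F) <= 2 * K.
Proof.
move=> mF h; rewrite -[X in _ <= 2 * X](Rint_cst mu); apply: cint_bound => //.
  by split => //; exists K.
by split => //; exists `|K|.
Qed.

Lemma cvgn_epsP (u : nat -> R) (l : R) :
  (forall e, 0 < e -> exists N, forall n, (N <= n)%N -> `|u n - l| <= e) <->
  u @ \oo --> l.
Proof.
split=> [h | /cvgrPdist_le h e /h [N _ hN]].
  apply/cvgrPdist_le => e /h [N hN]; exists N => // n /= Nn.
  by rewrite distrC hN.
by exists N => n Nn; rewrite distrC hN.
Qed.

Lemma cint_dct mu (Fn : nat -> R -> R[i]) F (K : R) :
  (forall n, cmeas (Fn n)) -> cmeas F -> (forall n x, cabs (Fn n x) <= K) ->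
  (forall x e, 0 < e -> exists N, forall n, (N <= n)%N -> cabs (Fn n x - F x) <= e) ->
  forall e, 0 < e -> exists N, forall n, (N <= n)%N ->
    cabs (cint mu (Fn n) - cint mu F) <= e.
Proof.
move=> mFn mF hK hc.
have /cvgn_epsP cR : (fun n => Re (cint mu (Fn n))) @ \oo --> Re (cint mu F).
  apply: (@Rint_dct mu (fun n x => Re (Fn n x)) (fun x => Re (F x)) K).
  - by move=> n; exact: (mFn n).1.
  - exact: mF.1.
  - by move=> n x; apply: le_trans (normRe_cabs _) (hK n x).
  move=> x; apply/cvgn_epsP => e /(hc x) [N hN]; exists N => n /hN; apply: le_trans.
  by rewrite -cReB normRe_cabs.
have /cvgn_epsP cI : (fun n => Im (cint mu (Fn n))) @ \oo --> Im (cint mu F).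
  apply: (@Rint_dct mu (fun n x => Im (Fn n x)) (fun x => Im (F x)) K).
  - by move=> n; exact: (mFn n).2.
  - exact: mF.2.
  - by move=> n x; apply: le_trans (normIm_cabs _) (hK n x).
  move=> x; apply/cvgn_epsP => e /(hc x) [N hN]; exists N => n /hN; apply: le_trans.
  by rewrite -cImB normIm_cabs.
move=> e e0; have e2 : 0 < e / 2 by rewrite divr_gt0.
have [N1 h1] := cR _ e2; have [N2 h2] := cI _ e2.
exists (maxn N1 N2) => n; rewrite geq_max => /andP[/h1 {}h1 /h2 {}h2].
apply: le_trans (cabs_ReIm _) _.
by rewrite [leRHS]splitr cReB cImB lerD.
Qed.

End Integral.

(** * The Mittag-Leffler expansion *)

Section RealEstimates.
Local Open Scope complex_scope.
Variable R : realType.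
Implicit Types x y : R.

Lemma MVT_everywhere (f df : R -> R) (a b : R) : a < b ->
  (forall x, is_derive x 1 f (df x)) ->
  exists c, a < c < b /\ f b - f a = df c * (b - a).
Proof.
move=> ab hd; have [|c] := @MVT R f df a b ab.
  apply: continuous_subspaceT => x.
  apply/differentiable_continuous/derivable1_diffP.
  by have [] := hd x.
by rewrite in_itv /= => h e; exists c.
Qed.

Lemma normr_sin_le x : `|sin x| <= `|x|.
Proof.
wlog x0 : x / 0 < x.
  move=> h; have [x0|x0|<-] := ltgtP 0 x; first exact: h.
    by have := h (- x); rewrite oppr_gt0 sinN !normrN => /(_ x0).
  by rewrite sin0.
have [c [_]] := MVT_everywhere x0 (@is_derive_sin R); rewrite sin0 !subr0 => ->; rewrite normrM ler_piMl // cos_max //.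
Qed.

Lemma onemcosE x : 1 - cos x = 2 * sin (x / 2) ^+ 2.
Proof.
have {1}-> : x = (x / 2) *+ 2 by rewrite -mulr_natr divfK // pnatr_eq0.
by rewrite cos_mulr2n cos2sin2; ring.
Qed.

Lemma onemcos_le_sqr x : 0 <= 1 - cos x <= x ^+ 2 / 2.
Proof.
rewrite onemcosE mulr_ge0 ?sqr_ge0 //=.
have : sin (x / 2) ^+ 2 <= (x / 2) ^+ 2.
  by rewrite -[leLHS]real_normK ?num_real // -[leRHS]real_normK ?num_real // ler_sqr ?nnegrE // normr_sin_le.
rewrite expr_div_n; set a := sin _ ^+ 2; set b := x ^+ 2.
have -> : 2 ^+ 2 = 4 :> R by ring.
lra.
Qed.

Lemma onemcos_le x : 1 - cos x <= `|x|.
Proof.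
rewrite onemcosE.
have h : sin (x / 2) ^+ 2 <= `|x / 2|.
  rewrite -real_normK ?num_real // expr2.
  apply: le_trans (normr_sin_le _); rewrite ler_piMl // sin_max //.
by move: h; rewrite normrM (@ger0_norm _ 2^-1) ?invr_ge0 //; set a := sin _ ^+ 2; lra.
Qed.

Lemma sin_sub_id_le x : `|sin x - x| <= x ^+ 2.
Proof.
wlog x0 : x / 0 < x.
  move=> h; have [x0|x0|<-] := ltgtP 0 x; first exact: h.
    have := h (- x); rewrite oppr_gt0 => /(_ x0).
    by rewrite sinN -opprD normrN sqrrN.
  by rewrite sin0 subr0 normr0 expr0n.
have [c []] := MVT_everywhere x0 (@is_derive_sin R); rewrite sin0 !subr0 => /andP[c0 cx] ->.
have -> : cos c * x - x = - ((1 - cos c) * x) by ring.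
rewrite normrN normrM (gtr0_norm x0) expr2 ler_pM2r //.
have /andP[h _] := onemcos_le_sqr c.
rewrite ger0_norm //; apply: le_trans (onemcos_le c) _.
by rewrite gtr0_norm // ltW.
Qed.

(** On $[0,1]$ one has $\cos\ge 1/2$, hence $\sin y\ge y/2$; doubling the angle extends a linear
    lower bound to $[0,2]$, the range of the half angles met in [cei_lower]. *)
Lemma sin_ge_quarter x : 0 <= x <= 2 -> x / 4 <= sin x.
Proof.
have cosh y : 0 <= y <= 1 -> 1 / 2 <= cos y.
  move=> /andP[y0 y1]; have /andP[_ h] := onemcos_le_sqr y.
  have : y ^+ 2 <= 1 by rewrite expr_le1.
  by move: h; set z := y ^+ 2; lra.
have sinh y : 0 <= y <= 1 -> y / 2 <= sin y.
  move=> /andP[]; rewrite le_eqVlt => /predU1P[<- _|y0 y1]; first by rewrite sin0 mul0r.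
  have [c []] := MVT_everywhere y0 (@is_derive_sin R); rewrite sin0 !subr0 => /andP[c0 cy] ->.
  rewrite mulrC ler_pM2r //; have := cosh c.
  by rewrite (ltW c0) (ltW (lt_le_trans cy y1)) mul1r; apply.
move=> /andP[x0 x2].
have hx : 0 <= x / 2 <= 1 by lra.
have {2}-> : x = (x / 2) *+ 2 by rewrite -mulr_natr divfK // pnatr_eq0.
rewrite sin_mulr2n.
have h1 := cosh _ hx; have h2 := sinh _ hx.
rewrite -mulr_natr.
have h3 : 1 / 2 * (x / 2 / 2) <= cos (x / 2) * sin (x / 2).
  by apply: ler_pM => //; lra.
by move: h3; set q := cos _ * sin _; lra.
Qed.

(** Everything follows from $e^t\ge1+t$ at $t=\pm x$; the quadratic bound also uses
    $(1-x+x^2)(1+x)=1+x^3\ge1$. *)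
Lemma expRN_bounds x : 0 <= x ->
  [/\ x * expR (- x) <= 1 - expR (- x), 1 - expR (- x) <= x &
      0 <= expR (- x) - 1 + x <= x ^+ 2].
Proof.
move=> x0; have ex := expR_gt0 x; have eNx := expR_gt0 (- x).
have h1 := expR_ge1Dx x; have h2 := expR_ge1Dx (- x).
have e1 : expR x * expR (- x) = 1 by rewrite -expRD subrr expR0.
split.
- have : (1 + x) * expR (- x) <= expR x * expR (- x) by rewrite ler_pM2r.
  rewrite e1; lra.
- lra.
- apply/andP; split; first lra.
  have h3 : expR (- x) * (1 + x) <= 1 by rewrite -[leRHS]e1 [leRHS]mulrC ler_wpM2l ?(ltW eNx).
  have h4 : 1 <= (1 - x + x ^+ 2) * (1 + x).
    have -> : (1 - x + x ^+ 2) * (1 + x) = 1 + x ^+ 3 by ring.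
    by rewrite lerDl exprn_ge0.
  have : expR (- x) * (1 + x) <= (1 - x + x ^+ 2) * (1 + x) by exact: le_trans h3 h4.
  rewrite ler_pM2r; first lra.
  lra.
Qed.

(** The increment of $\arctan$ over a period is $2\pi/(1+c^2)$ with $c$ within $2\pi$ of $x$,
    comparable to $1/(x^2+y^2)$. Along a progression of step $2\pi$ the right-hand sides
    telescope. *)
Lemma atan_step (y : R) : 0 < y -> exists2 A, 0 < A & forall x,
  (x ^+ 2 + y ^+ 2)^-1 <= A * (atan (x + 2 * pi) - atan x).
Proof.
move=> y0; have p0 := pi_gt0 R.
have p2 : 0 < 2 * pi :> R by rewrite mulr_gt0.
have y2 : 0 < y ^+ 2 by rewrite exprn_gt0.
(* Chosen so that $B(x^2+y^2)\ge 2x^2+8\pi^2+1$, which dominates $1+c^2$. *)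
pose B := 2 + (1 + 8 * pi ^+ 2) / y ^+ 2.
have B0 : 0 < B by rewrite addr_gt0 // divr_gt0 // addr_gt0 // mulr_gt0 // exprn_gt0.
exists (B / (2 * pi)); first by rewrite divr_gt0.
move=> x.
have xx : x < x + 2 * pi by rewrite ltrDl.
have [c []] := MVT_everywhere xx (@is_derive1_atan R); move=> /andP[xc cx] ->.
rewrite addrC (addrC x) addrK mulrCA mulrC divfK ?gt_eqF // mulrC.
have c2 : 0 < 1 + c ^+ 2 by rewrite ltr_pwDl // sqr_ge0.
have xy : 0 < y ^+ 2 + x ^+ 2 by rewrite ltr_pwDl // sqr_ge0.
rewrite -[leLHS]mul1r mulrC ler_pdivrMr // mulrAC ler_pdivlMr // mul1r.
have -> : B * (y ^+ 2 + x ^+ 2) = 2 * y ^+ 2 + 2 * x ^+ 2 + (1 + 8 * pi ^+ 2) * (1 + x ^+ 2 / y ^+ 2).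
  by rewrite /B; field; rewrite gt_eqF.
have h1 : 1 + 8 * pi ^+ 2 <= (1 + 8 * pi ^+ 2) * (1 + x ^+ 2 / y ^+ 2).
  have e0 : 0 <= 1 + 8 * pi ^+ 2 :> R by rewrite addr_ge0 // mulr_ge0 // sqr_ge0.
  by rewrite ler_peMr // lerDl divr_ge0 ?sqr_ge0.
have h2 : c ^+ 2 <= 2 * x ^+ 2 + 8 * pi ^+ 2.
  have : 0 <= (c - x) * (x + 2 * pi - c) by rewrite mulr_ge0 // subr_ge0 ltW.
  have := sqr_ge0 (2 * x - c) ; have := sqr_ge0 (2 * pi - (c - x)).
  have := sqr_ge0 (x - 2 * pi).
  nra.
by move: h1 h2; set q := (1 + _) * _; have := sqr_ge0 y; lra.
Qed.

End RealEstimates.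

Section MittagLeffler.
Local Open Scope complex_scope.
Variable R : realType.
Implicit Types (u s d : R[i]) (r c Y : R).

Lemma cReZ r u : Re (r%:C * u) = r * Re u.
Proof. by rewrite cReM /= mul0r subr0. Qed.

Lemma cImZ r u : Im (r%:C * u) = r * Im u.
Proof. by rewrite cImM /= mul0r addr0. Qed.

(* [ev u + 1/2] is [(i/2) cot (u/2)]. *)
Definition ev u : R[i] := cei u / (1 - cei u).

(** With $s=a+ib$ and $\rho=e^{-b}$, $|1-e^{is}|^2=(1-\rho)^2+2\rho(1-\cos a)$: the first term
    controls $b$, the second $a$. The bound $|a|\le4<2\pi$ keeps [s] away from the zeros of
    $1-e^{is}$ other than $0$. *)
Lemma cei_lower Y s : 0 < Im s <= Y -> `|Re s| <= 4 ->
  expR (- Y) / 4 * cabs s <= cabs (1 - cei s).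
Proof.
move=> /andP[b0 bY] ha.
have eY := expR_gt0 (- Y).
rewrite le_cabs_sqr ?mulr_ge0 ?cabs_ge0 ?divr_ge0 ?(ltW eY) //.
rewrite exprMn sqr_cabs cReB cImB /=.
set rho := expR (- Im s); set a := Re s; set b := Im s.
have rY : expR (- Y) <= rho by rewrite ler_expR lerN2.
have -> : (1 - rho * cos a) ^+ 2 + (0 - rho * sin a) ^+ 2 =
   (1 - rho) ^+ 2 + 2 * rho * (1 - cos a).
  have := cos2Dsin2 a; set C := cos a; set S := sin a => h.
  have -> : (1 - rho * C) ^+ 2 + (0 - rho * S) ^+ 2 =
    1 - 2 * rho * C + rho ^+ 2 * (C ^+ 2 + S ^+ 2) by ring.
  by rewrite h; ring.
have r0 : 0 < rho := expR_gt0 _.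
have r1 : rho <= 1 by rewrite expR_le1 oppr_le0 ltW.
have h1 : b * expR (- Y) <= 1 - rho.
  have [h _ _] := expRN_bounds (ltW b0).
  by apply: le_trans h; rewrite ler_pM2l.
have h2 : (b * expR (- Y)) ^+ 2 <= (1 - rho) ^+ 2.
  by rewrite ler_sqr ?nnegrE ?subr_ge0 // mulr_ge0 ?ltW.
have h3 : (a / 8) ^+ 2 <= sin (a / 2) ^+ 2.
  have h : `|a / 2| / 4 <= `|sin (a / 2)|.
    have -> : `|sin (a / 2)| = `|sin `|a / 2| |.
      by case: (ger0P (a / 2)) => // _; rewrite sinN normrN.
    apply: le_trans (ler_norm _).
    apply: sin_ge_quarter; rewrite normr_ge0 /= normrM (@ger0_norm _ 2^-1) ?invr_ge0 //.
    by move: ha; rewrite -/a; lra.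
  rewrite -[leLHS]real_normK ?num_real // -[leRHS]real_normK ?num_real //.
  rewrite ler_sqr ?nnegrE //; apply: le_trans h.
  by rewrite !normrM !(@ger0_norm _ _^-1) ?invr_ge0 //; lra.
have h4 : expR (- Y) ^+ 2 * (a / 8) ^+ 2 * 4 <= 2 * rho * (1 - cos a).
  rewrite onemcosE.
  have : expR (- Y) ^+ 2 * (a / 8) ^+ 2 <= rho * sin (a / 2) ^+ 2.
    apply: ler_pM => //; rewrite ?sqr_ge0 //.
    apply: (le_trans _ rY); rewrite expr2 ler_piMl ?(ltW eY) //.
    exact: le_trans rY r1.
  set p := sin _ ^+ 2; set q := _ ^+ 2 * _; 
    have -> : 2 * rho * (2 * p) = 4 * (rho * p) by ring.
    lra.
rewrite expr_div_n mulrDr.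
have -> : 4 ^+ 2 = 16 :> R by ring.
move: h2 h4; rewrite exprMn expr_div_n.
have -> : 8 ^+ 2 = 64 :> R by ring.
have := sqr_ge0 (b * expR (- Y)); rewrite exprMn.
set E := _ ^+ 2; set A := a ^+ 2; set B := b ^+ 2; set X := (_ - _) ^+ 2; set Z := 2 * _ * _.
nra.
Qed.

Lemma cei_expand s : 0 < Im s ->
  cabs (cei s - 1 - 'i * s) <= 3 * cabs s ^+ 2.
Proof.
move=> b0; set a := Re s; set b := Im s.
have -> : cei s - 1 - 'i * s =
  Complex ((expR (- b) - 1 + b) - expR (- b) * (1 - cos a))
          (expR (- b) * (sin a - a) - a * (1 - expR (- b))).
  apply: complex_eqP; rewrite ?cReB ?cImB ?cReM ?cImM /= -/a -/b; ring.
apply: le_trans (cabs_ReIm _) _ => /=.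
have [h1 h2 /andP[h3 h4]] := expRN_bounds (ltW b0).
have e0 := expR_gt0 (- b).
have e1 : expR (- b) <= 1 by rewrite expR_le1 oppr_le0 ltW.
have /andP[c0 c1] := onemcos_le_sqr a.
have s1 := sin_sub_id_le a.
rewrite sqr_cabs -/a -/b.
have k1 : `|expR (- b) - 1 + b - expR (- b) * (1 - cos a)| <= b ^+ 2 + a ^+ 2 / 2.
  have : 0 <= expR (- b) * (1 - cos a) <= a ^+ 2 / 2.
    rewrite mulr_ge0 ?(ltW e0) //=; apply: le_trans c1; rewrite ler_piMl //.
  move=> /andP[]; have := sqr_ge0 b; have := sqr_ge0 a.
  by rewrite ler_norml; set q := expR _ * _; set A := a ^+ 2; set B := b ^+ 2; rewrite -/b -/B in h3 h4; lra.
have k2 : `|expR (- b) * (sin a - a) - a * (1 - expR (- b))| <= a ^+ 2 + `|a| * b.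
  apply: le_trans (ler_normB _ _) _; rewrite !normrM lerD //.
    by apply: le_trans s1; rewrite ler_piMl // ger0_norm ?(ltW e0).
  by rewrite ler_wpM2l // ger0_norm // subr_ge0.
have k3 : `|a| * b <= (a ^+ 2 + b ^+ 2) / 2.
  have := sqr_ge0 (`|a| - b); rewrite sqrrB real_normK ?num_real //.
  by rewrite -mulr_natl; set q := `|a| * b; lra.
move: k1 k2 k3; have := sqr_ge0 a; have := sqr_ge0 b; lra.
Qed.

(** Over the common denominator $s(1-e^{is})$ the first-order terms of the numerator cancel, leaving
    $O(|s|^2)$ by [cei_expand], while the denominator is at least a multiple of $|s|^2$ by
    [cei_lower]. *)
Lemma ev_sub_pole Y : exists2 C, 0 < C & forall s, 0 < Im s <= Y -> `|Re s| <= 4 ->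
  cabs (ev s - 'i / s) <= C.
Proof.
have eY := expR_gt0 (- Y).
pose C := (1 + 3 * (4 + `|Y|) + 3) / (expR (- Y) / 4).
exists C.
  by rewrite divr_gt0 ?divr_gt0 // !addr_gt0 // mulr_gt0 // ltr_pwDl.
move=> s hs hr; have low := cei_lower hs hr.
case/andP: hs => b0 bY.
have s0 : s != 0 := Im_gt0_neq0 b0.
have w1 := subr1_cei_neq0 b0.
have cs0 : 0 < cabs s by rewrite cabs_gt0.
have -> : ev s - 'i / s = (s * (cei s - 1) + 'i * (cei s - 1 - 'i * s)) / (s * (1 - cei s)).
  have i2 := sqr_i R.
  have -> : s * (cei s - 1) + 'i * (cei s - 1 - 'i * s) =
    s * (cei s - 1) + 'i * (cei s - 1) - 'i ^+ 2 * s by ring.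
  by rewrite i2 /ev; field; rewrite s0 w1.
rewrite cabs_div cabsM ler_pdivrMr; last by rewrite mulr_gt0 ?cabs_gt0.
have e2 := cei_expand b0.
have e1 : cabs (cei s - 1) <= (1 + 3 * (4 + `|Y|)) * cabs s.
  have -> : cei s - 1 = 'i * s + (cei s - 1 - 'i * s) by ring.
  apply: le_trans (cabsD _ _) _; rewrite cabsM cabsI mul1r mulrDl mul1r lerD2l.
  apply: le_trans e2 _; rewrite expr2 mulrA ler_wpM2r ?cabs_ge0 // ler_pM2l //.
  apply: le_trans (cabs_ReIm _) _; rewrite lerD // ger0_norm ?(ltW b0) //.
  by apply: le_trans bY (ler_norm _).
apply: (@le_trans _ _ ((1 + 3 * (4 + `|Y|) + 3) * cabs s ^+ 2)).
  apply: le_trans (cabsD _ _) _; rewrite !cabsM cabsI mul1r mulrDl lerD //.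
  by rewrite mulrC expr2 mulrA ler_wpM2r ?cabs_ge0.
have -> : (1 + 3 * (4 + `|Y|) + 3) * cabs s ^+ 2 =
  C * (cabs s * (expR (- Y) / 4 * cabs s)).
  by rewrite /C; field; rewrite gt_eqF.
rewrite ler_pM2l; last by rewrite divr_gt0 ?divr_gt0 // !addr_gt0 // mulr_gt0 // ltr_pwDl.
by rewrite ler_pM2l.
Qed.


Lemma ev_period u (n : int) : ev (u + (2 * pi * n%:~R)%:C) = ev u.
Proof. by rewrite /ev ceiDz. Qed.

(** With $w=e^{iu/2}$, the two points are those where the exponential equals $\pm w$, and
    $\frac1{1-w}+\frac1{1+w}=\frac2{1-w^2}$. *)
Lemma ev_half u : 0 < Im u ->
  ev u + 2^-1 = 2^-1 * ((ev (2^-1%:C * u) + 2^-1) + (ev (2^-1%:C * u + pi%:C) + 2^-1)).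
Proof.
move=> u0.
have h0 : 0 < Im (2^-1%:C * u) by rewrite cImZ mulr_gt0.
have -> : u = 2^-1%:C * u + 2^-1%:C * u.
  by apply: complex_eqP; rewrite ?cReD ?cImD ?cReZ ?cImZ; field.
have -> : 2^-1%:C * (2^-1%:C * u + 2^-1%:C * u) = 2^-1%:C * u.
  by apply: complex_eqP; rewrite ?cReZ ?cImZ ?cReD ?cImD ?cReZ ?cImZ; field.
set v := 2^-1%:C * u in h0 *.
have cpi : cei pi%:C = -1 :> R[i].
  by apply: complex_eqP; rewrite /= oppr0 expR0 mul1r ?cospi ?sinpi ?oppr0.
rewrite /ev !ceiD cpi.
have n1 : 1 - cei v != 0 by exact: subr1_cei_neq0.
have n2 : 1 + cei v != 0.
  rewrite addr_eq0; apply: contraTneq (cabs_cei_lt1 h0) => e.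
  by rewrite -cabsN -e cabs1 ltxx.
have n3 : 1 - cei v * cei v != 0.
  have -> : 1 - cei v * cei v = (1 - cei v) * (1 + cei v) by ring.
  by rewrite mulf_neq0.
rewrite mulrN1 opprK; field.
by rewrite n1 n2 n3.
Qed.

(* By angle halving, [ev u + 1/2] is the average of its values at the [2^m] points
   [(u + 2 pi k)/2^m]; letting [m] grow gives the Mittag-Leffler expansion. *)
Definition dpt m u c : R[i] := ((2 ^+ m)^-1)%:C * (u + c%:C).

Lemma Im_dpt m u c : Im (dpt m u c) = Im u / 2 ^+ m.
Proof. by rewrite cImZ cImD /= addr0 mulrC. Qed.

Lemma Re_dpt m u c : Re (dpt m u c) = (Re u + c) / 2 ^+ m.
Proof. by rewrite cReZ cReD mulrC. Qed.

Lemma exp2_gt0 m : 0 < 2 ^+ m :> R. Proof. exact: exprn_gt0. Qed.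

Lemma ev_dyadic m u : 0 < Im u ->
  ev u + 2^-1 = ((2 ^+ m)^-1)%:C *
    \sum_(k < 2 ^ m) (ev (dpt m u (2 * pi * k%:R)) + 2^-1).
Proof.
move=> u0; elim: m => [|m IH].
  rewrite expn0 big_ord1 expr0 invr1 mul1r; congr (ev _ + _).
  by apply: complex_eqP; rewrite ?Re_dpt ?Im_dpt expr0 divr1 ?mulr0 ?addr0.
rewrite {}IH expnS mul2n -addnn big_split_ord /= -big_split /=.
rewrite exprS invfM rmorphM /= -[in RHS]mulrA [in RHS]mulrCA; congr (_ * _).
rewrite mulr_sumr; apply: eq_bigr => k _.
have m0 := exp2_gt0 m.
rewrite ev_half; last by rewrite Im_dpt divr_gt0.
have -> : 2^-1 = 2^-1%:C :> R[i] by rewrite -(rmorph_nat (real_complex R) 2) fmorphV.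
congr (_ * ((ev _ + _) + (ev _ + _))).
  apply: complex_eqP; rewrite ?cReZ ?cImZ ?Re_dpt ?Im_dpt exprS; field; exact: lt0r_neq0.
(* At the finer level the translation by $\pi$ is a shift of the index by $2^m$. *)
apply: complex_eqP.
  rewrite [RHS]Re_dpt cReD cReZ Re_dpt /= exprS natrD natrX; field; exact: lt0r_neq0.
by rewrite [RHS]Im_dpt cImD cImZ Im_dpt /= exprS addr0; field; exact: lt0r_neq0.
Qed.

(** Pairing $k$ with $-(k+1)$ makes the index run over $-M\le n<M$, so that $M=2^m$ matches the
    $2^{m+1}$ dyadic points. *)
Definition twosided (f : R -> R[i]) M : R[i] :=
  \sum_(k < M) (f (2 * pi * k%:R) + f (- (2 * pi * k.+1%:R))).

Lemma ev_dyadic2 m u : 0 < Im u ->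
  ev u + 2^-1 = ((2 ^+ m.+1)^-1)%:C *
    twosided (fun c => ev (dpt m.+1 u c) + 2^-1) (2 ^ m).
Proof.
move=> u0; rewrite (ev_dyadic m.+1 u0); congr (_ * _).
rewrite expnS mul2n -addnn big_split_ord /= /twosided [in RHS]big_split /=; congr (_ + _).
(* The upper half of the indices, read backwards, moves down one period of [ev] to the negative
   integers. *)
rewrite (reindex_inj rev_ord_inj) /=; apply: eq_bigr => k _; congr (_ + _).
have -> : dpt m.+1 u (2 * pi * (2 ^ m + (2 ^ m - k.+1))%:R) =
   dpt m.+1 u (- (2 * pi * k.+1%:R)) + (2 * pi * 1%:~R)%:C.
  have m0 := exp2_gt0 m.
  apply: complex_eqP; rewrite ?cReD ?cImD ?Re_dpt ?Im_dpt /= ?addr0 //.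
  rewrite natrD natrB // natrX exprS; field; exact: lt0r_neq0.
by rewrite ev_period.
Qed.

(** Subtracting the term at [u + d] improves the decay in [c] from $1/|c|$ to $1/c^2$, making the
    sums absolutely convergent. *)
Definition pole_gap u d c : R[i] := (u + c%:C)^-1 - (u + d + c%:C)^-1.

(** The constant in $|u+c|\le(1+|d|/\mathrm{Im}\,d)\,|u+d+c|$, valid because
    $|u+d+c|\ge\mathrm{Im}\,d$ for [u] in the upper half-plane. *)
Definition gap_cst (d : R[i]) : R := 1 + cabs d / Im d.

Lemma gap_cst_gt0 d : 0 < Im d -> 0 < gap_cst d.
Proof. by move=> d0; rewrite ltr_pwDl // divr_ge0 ?cabs_ge0 // ltW. Qed.

Lemma shiftR_neq0 u c : 0 < Im u -> u + c%:C != 0.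
Proof. by move=> u0; apply: Im_gt0_neq0; rewrite cImD addr0. Qed.

Lemma pole_gap_le u d c : 0 < Im u -> 0 < Im d ->
  cabs (u + c%:C)^-1 * cabs (u + d + c%:C)^-1 <=
  gap_cst d * ((Re u + c) ^+ 2 + Im u ^+ 2)^-1.
Proof.
move=> u0 d0; rewrite !cabsV.
have n1 : 0 < cabs (u + c%:C) by rewrite cabs_gt0 shiftR_neq0.
have n2 : 0 < cabs (u + d + c%:C).
  by rewrite cabs_gt0 shiftR_neq0 // cImD addr_gt0.
have -> : (Re u + c) ^+ 2 + Im u ^+ 2 = cabs (u + c%:C) ^+ 2.
  by rewrite sqr_cabs cReD cImD /= addr0.
rewrite -invfM ler_pdivlMr ?exprn_gt0 // mulrC ler_pdivrMr ?mulr_gt0 //.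
rewrite expr2 mulrCA ler_pM2l // /gap_cst mulrDl mul1r.
have -> : u + c%:C = (u + d + c%:C) - d by ring.
apply: le_trans (cabsB _ _) _; rewrite lerD2l // mulrAC -mulrA ler_peMr ?cabs_ge0 //.
rewrite ler_pdivlMr // mul1r; apply: le_trans (Im_cabs _).
by rewrite !cImD /= addr0 lerDr ltW.
Qed.

Lemma pole_gapE u d c : 0 < Im u -> 0 < Im d ->
  pole_gap u d c = d * ((u + c%:C)^-1 * (u + d + c%:C)^-1).
Proof.
move=> u0 d0.
have n1 : u + c%:C != 0 by exact: shiftR_neq0.
have n2 : u + d + c%:C != 0 by rewrite shiftR_neq0 // cImD addr_gt0.
by rewrite /pole_gap; field; rewrite n1 n2.
Qed.

Lemma cabs_pole_gap u d c : 0 < Im u -> 0 < Im d ->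
  cabs (pole_gap u d c) <= cabs d * gap_cst d * ((Re u + c) ^+ 2 + Im u ^+ 2)^-1.
Proof.
move=> u0 d0; rewrite pole_gapE // !cabsM -mulrA ler_wpM2l ?cabs_ge0 //.
exact: pole_gap_le.
Qed.

Lemma twosidedB f g M : twosided (fun c => f c - g c) M = twosided f M - twosided g M.
Proof. by rewrite -sumrB; apply: eq_bigr => k _; ring. Qed.

Lemma twosidedZ a f M : twosided (fun c => a * f c) M = a * twosided f M.
Proof. by rewrite mulr_sumr; apply: eq_bigr => k _; ring. Qed.

Lemma twosided_le f (g : R -> R) K M : (K <= M)%N ->
  (forall c, `|c| <= 2 * pi * M%:R -> cabs (f c) <= g c) ->
  cabs (twosided f M - twosided f K) <=
  \sum_(K <= k < M) (g (2 * pi * k%:R) + g (- (2 * pi * k.+1%:R))).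
Proof.
move=> KM fg.
pose F k := f (2 * pi * k%:R) + f (- (2 * pi * k.+1%:R)).
have -> : twosided f M - twosided f K = \sum_(K <= k < M) F k.
  rewrite /twosided -!(big_mkord xpredT F) [X in X - _](big_cat_nat (n := K)) //=.
  by rewrite addrAC subrr add0r.
have p2 : 0 <= 2 * pi :> R by rewrite mulr_ge0 // pi_ge0.
elim: M KM fg => [|M IH] KM fg; first by rewrite !big_geq // cabs0.
move: KM; rewrite leq_eqVlt => /predU1P[->|KM]; first by rewrite !big_geq // cabs0.
rewrite !big_nat_recr //=; apply: le_trans (cabsD _ _) _; rewrite lerD ?IH //.
  move=> c hc; apply: fg; apply: le_trans hc _.
  by rewrite ler_wpM2l // ler_nat.
apply: le_trans (cabsD _ _) _; rewrite lerD // fg //.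
  by rewrite ger0_norm; [rewrite ler_wpM2l // ler_nat | exact: mulr_ge0].
by rewrite normrN ger0_norm // mulr_ge0.
Qed.

Lemma twosided_atan (x A : R) K M : (K <= M)%N ->
  \sum_(K <= k < M) (A * (atan (x + 2 * pi * k%:R + 2 * pi) - atan (x + 2 * pi * k%:R)) +
    A * (atan (x - (2 * pi * k.+1%:R) + 2 * pi) - atan (x - (2 * pi * k.+1%:R)))) =
  A * ((atan (x + 2 * pi * M%:R) - atan (x + 2 * pi * K%:R)) +
       (atan (x - 2 * pi * K%:R) - atan (x - 2 * pi * M%:R))).
Proof.
elim: M => [|M IH]; first by rewrite leqn0 => /eqP ->; rewrite big_geq // !subrr addr0 mulr0.
rewrite leq_eqVlt => /predU1P[->|KM]; first by rewrite big_geq // !subrr addr0 mulr0.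
rewrite big_nat_recr //= IH //.
have -> : x + 2 * pi * M%:R + 2 * pi = x + 2 * pi * M.+1%:R by rewrite -[M.+1]addn1 natrD; ring.
have -> : x - 2 * pi * M.+1%:R + 2 * pi = x - 2 * pi * M%:R by rewrite -[M.+1]addn1 natrD; ring.
by ring.
Qed.


Lemma archi_nat (x : R) : exists K : nat, x < K%:R.
Proof. by exists (Num.bound `|x|); apply: le_lt_trans (ler_norm _) _; exact: archi_boundP. Qed.

Lemma atan_tail (x e : R) : 0 < e -> exists K,
  (pi / 2 - atan (x + 2 * pi * K%:R)) + (atan (x - 2 * pi * K%:R) + pi / 2) <= e.
Proof.
move=> e0; have e2 : 0 < e / 2 by rewrite divr_gt0.
have [M [_ hM]] : \forall y \near +oo, `|pi / 2 - atan y| < e / 2.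
  by have /cvgrPdist_lt /(_ _ e2) := @cvgy_atan R.
have [K hK] := archi_nat (`|M| + `|x|).
have h : `|M| + `|x| < 2 * pi * K%:R.
  apply: lt_le_trans hK _; rewrite ler_peMl //.
  by have := pi_ge2 R; lra.
have h1 : M < x + 2 * pi * K%:R.
  by have := ler_norm M; have := ler_norm (- x); rewrite normrN; lra.
have h2 : M < 2 * pi * K%:R - x.
  by have := ler_norm M; have := ler_norm x; lra.
exists K; rewrite -[x - _]opprK opprB atanN.
move/hM : h1; move/hM : h2; rewrite /= !ltr_norml; lra.
Qed.

(** The telescoped increments of $\arctan$ add up to less than $\pi$ wherever they start, whence a
    bound depending on [u] only through its height. Dominated convergence needs this uniformity, the
    real part being governed by the variable of integration. *)
Lemma twosided_bound (y : R) d : 0 < y -> 0 < Im d -> exists K : R,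
  forall u, Im u = y -> forall M, cabs (twosided (pole_gap u d) M) <= K.
Proof.
move=> y0 d0; have [A A0 hA] := atan_step y0.
have D0 : 0 <= cabs d * gap_cst d by rewrite mulr_ge0 ?cabs_ge0 // ltW // gap_cst_gt0.
exists (cabs d * gap_cst d * A * (2 * pi)) => u uy M.
have -> : twosided (pole_gap u d) M = twosided (pole_gap u d) M - twosided (pole_gap u d) 0.
  by rewrite /twosided big_ord0 subr0.
apply: (le_trans (twosided_le (g := fun c => cabs d * gap_cst d * A * (atan (Re u + c + 2 * pi) - atan (Re u + c)))
   (leq0n M) _)).
  move=> c _; apply: le_trans (cabs_pole_gap _ _ _) _ => //; first by rewrite uy.
  by rewrite uy -[leRHS]mulrA ler_wpM2l.
have Q0 : 0 <= cabs d * gap_cst d * A by rewrite (mulr_ge0 D0) // ltW.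
rewrite twosided_atan // ler_wpM2l // mulr0 addr0 subr0.
have := atan_ltpi2 (Re u + 2 * pi * M%:R); have := atan_gtNpi2 (Re u - 2 * pi * M%:R).
have := pi_gt0 R; lra.
Qed.

(** A Tannery argument. By [ev_dyadic2] the difference is itself a sum over the dyadic points; its
    terms have a summable majorant independent of [m], so the tail beyond [K] is negligible, and
    each of the finitely many remaining terms tends to $0$, being a rescaled regular part of [ev] at
    its pole. *)
Lemma mittag_leffler u d : 0 < Im u -> 0 < Im d -> forall e, 0 < e -> exists m0, forall m,
  (m0 <= m)%N ->
  cabs ('i * twosided (pole_gap u d) (2 ^ m) - (ev u - ev (u + d))) <= e.
Proof.
move=> u0 d0 e e0.
set x := Re u; set y := Im u; pose Y := y + Im d; pose cY := expR (- Y) / 4.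
have cY0 : 0 < cY by rewrite divr_gt0 ?expR_gt0.
have [C C0 hC] := ev_sub_pole Y.
have [A A0 hA] := atan_step u0.
have k0 := gap_cst_gt0 d0.
have cd0 : 0 < cabs d by rewrite cabs_gt0 Im_gt0_neq0.
(* From [cei_expand], $|1-e^{id/N}|\le|d|/N+3|d|^2/N^2\le D/N$ for $N\ge1$. *)
pose D := (1 + 3 * cabs d) * cabs d.
have dD : cabs d <= D by rewrite ler_peMl ?cabs_ge0 // lerDl mulr_ge0 ?cabs_ge0.
have D0 : 0 < D := lt_le_trans cd0 dD.
pose B := D * gap_cst d * (1 + cY ^- 2) * A.
have E0 : 0 < D * gap_cst d * (1 + cY ^- 2).
  by rewrite (mulr_gt0 (mulr_gt0 D0 k0)) // addr_gt0 // invr_gt0 exprn_gt0.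
have B0 : 0 < B by rewrite mulr_gt0.
have p2 : 0 < 2 * pi :> R by rewrite mulr_gt0 // pi_gt0.
have [|K hK] := @atan_tail x (e / 2 / B); first by rewrite !divr_gt0.
(* The translations $2\pi n$ contribute at most $\pi$ to the real part of a dyadic point; the room
   $4-\pi$ absorbs the contributions of [u] and [d] once $N$ is large, so that [cei_lower] and
   [ev_sub_pole] apply. *)
have p4 : 0 < 4 - pi :> R by have := pihalf_lt2 R; lra.
have [n1 hn1] := archi_nat ((`|x| + `|Re d|) / (4 - pi)).
have [n2 hn2] := archi_nat (4 * C * K%:R / (e / 2)).
exists (maxn K (maxn n1 n2)) => m; rewrite !geq_max => /and3P[Km n1m n2m].
pose N : R := 2 ^+ m.+1; have N0 : 0 < N := exp2_gt0 _.
have mN : m%:R <= N.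
  by rewrite /N -natrX ler_nat ltnW // (ltn_trans (ltnSn m)) // ltn_expl.
have KM : (K <= 2 ^ m)%N by rewrite (leq_trans Km) // ltnW // ltn_expl.
have N1 : 1 <= N by rewrite /N exprn_ege1 // ler1n.
pose u' := u + d.
have u'0 : 0 < Im u' by rewrite cImD addr_gt0.
pose b c := N^-1%:C * (ev (dpt m.+1 u c) - ev (dpt m.+1 u' c)).
have bE : ev u - ev u' = twosided b (2 ^ m).
  have -> : ev u - ev u' = (ev u + 2^-1) - (ev u' + 2^-1) by ring.
  rewrite (ev_dyadic2 m u0) (ev_dyadic2 m u'0) -mulrBr -twosidedB -twosidedZ.
  by apply: eq_bigr => k _; rewrite /b /N; ring.
rewrite bE -twosidedZ -twosidedB; set f := (X in twosided X).
have reg c : `|c| <= 2 * pi * (2 ^ m)%:R ->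
   [/\ `|Re (dpt m.+1 u c)| <= 4, `|Re (dpt m.+1 u' c)| <= 4,
     0 < Im (dpt m.+1 u c) <= Y & 0 < Im (dpt m.+1 u' c) <= Y].
  move=> hc.
  have h v : `|v| <= `|x| + `|Re d| -> `|(v + c) / N| <= 4.
    move=> hv; rewrite normrM (@ger0_norm _ N^-1) ?invr_ge0 ?(ltW N0) // ler_pdivrMr //.
    have h1 : `|x| + `|Re d| <= (4 - pi) * N.
      have : n1%:R <= N by apply: le_trans mN; rewrite ler_nat.
      by move=> /(lt_le_trans hn1) /ltW; rewrite ler_pdivrMr // mulrC.
    apply: le_trans (ler_normD _ _) _.
    have h2 : 2 * pi * (2 ^ m)%:R = pi * N by rewrite /N exprS natrX; ring.
    by move: hc; rewrite h2; have := le_trans hv h1; lra.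
  have iN : N^-1 <= 1 by rewrite invf_le1.
  rewrite !Re_dpt !Im_dpt /u' cImD cReD -/x -/y -/N; split.
  - by apply: h; rewrite lerDl.
  - by apply: h; exact: ler_normD.
  - rewrite divr_gt0 //= /Y; apply: (@le_trans _ _ y); last by rewrite lerDl ltW.
    by rewrite ler_piMr // ltW.
  - by rewrite divr_gt0 ?addr_gt0 //= ler_piMr // addr_ge0 // ltW.
have nz c : u + c%:C != 0 by apply: Im_gt0_neq0; rewrite cImD addr0.
have nz' c : u' + c%:C != 0 by apply: Im_gt0_neq0; rewrite cImD addr0.
have NC0 : N%:C != 0 :> R[i] by rewrite -cabs_gt0 cabsR normr_gt0 gt_eqF.
have small c : `|c| <= 2 * pi * (2 ^ m)%:R -> cabs (f c) <= 2 * C / N.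
  move=> /reg [r1 r2 i1 i2].
  (* The factor $1/N$ turns the poles $i/s$ at the rescaled points into $i/(u+c)$ and $i/(u+d+c)$,
     which cancel the gap and leave the bounded regular parts. *)
  have -> : f c = N^-1%:C * ((ev (dpt m.+1 u' c) - 'i / dpt m.+1 u' c) -
                             (ev (dpt m.+1 u c) - 'i / dpt m.+1 u c)).
    rewrite /f /b /pole_gap /dpt -/N -/u' fmorphV; move: (ev _) (ev _) => E1 E2.
    by field; rewrite NC0 nz nz'.
  rewrite cabsM cabsR ger0_norm ?invr_ge0 ?(ltW N0) // mulrC ler_pM2r ?invr_gt0 //.
  by apply: le_trans (cabsB _ _) _; rewrite mulr_natl mulr2n lerD // hC.
have big c : `|c| <= 2 * pi * (2 ^ m)%:R ->
    cabs (f c) <= B * (atan (x + c + 2 * pi) - atan (x + c)).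
  move=> /reg [r1 r2 i1 i2].
  suff h : cabs (f c) <= D * gap_cst d * (1 + cY ^- 2) * ((x + c) ^+ 2 + y ^+ 2)^-1.
    apply: le_trans h _; rewrite /B -[leRHS]mulrA ler_pM2l //.
  set q := (_ + _)^-1.
  have -> : D * gap_cst d * (1 + cY ^- 2) * q = D * gap_cst d * q + D * cY ^- 2 * (gap_cst d * q) by ring.
  apply: le_trans (cabsB _ _) _; apply: lerD.
    rewrite cabsM cabsI mul1r; apply: le_trans (cabs_pole_gap _ u0 d0) _.
    rewrite ler_wpM2r ?invr_ge0 ?addr_ge0 ?sqr_ge0 //.
    by rewrite ler_pM2r.
  pose w := cei (dpt m.+1 u c); pose w' := cei (dpt m.+1 u' c).
  have l1 := cei_lower i1 r1; have l2 := cei_lower i2 r2.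
  rewrite -/cY -/w -/w' in l1 l2.
  have n1' : 1 - w != 0 by case/andP: i1 => + _; exact: subr1_cei_neq0.
  have n2' : 1 - w' != 0 by case/andP: i2 => + _; exact: subr1_cei_neq0.
  have -> : b c = N^-1%:C * ((w - w') / ((1 - w) * (1 - w'))).
    by rewrite /b /ev -/w -/w'; congr (_ * _); field; rewrite n1' n2'.
  have ww : cabs (w - w') <= D / N.
    have -> : w' = w * cei (N^-1%:C * d).
      by rewrite -ceiD /w'; congr cei; rewrite /dpt -/N /u'; ring.
    have -> : w - w * cei (N^-1%:C * d) = w * (1 - cei (N^-1%:C * d)) by ring.
    have n0 : 0 < Im (N^-1%:C * d) by rewrite cImZ mulr_gt0 ?invr_gt0.
    have h2 := cei_expand n0.
    have cdN : cabs (N^-1%:C * d) = cabs d / N.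
      by rewrite cabsM cabsR ger0_norm ?invr_ge0 ?(ltW N0) // mulrC.
    rewrite cabsM; apply: (@le_trans _ _ (cabs (1 - cei (N^-1%:C * d)))).
      rewrite ler_piMl ?cabs_ge0 // ltW //.
      by apply: cabs_cei_lt1; case/andP: i1.
    rewrite cabsBC; have -> : cei (N^-1%:C * d) - 1 = 'i * (N^-1%:C * d) + (cei (N^-1%:C * d) - 1 - 'i * (N^-1%:C * d)) by ring.
    apply: le_trans (cabsD _ _) _; rewrite cabsM cabsI mul1r.
    apply: le_trans (lerD (lexx _) h2) _; rewrite cdN.
    have -> : D / N = cabs d / N + 3 * cabs d * (cabs d / N) by rewrite /D; ring.
    rewrite lerD2l.
    rewrite expr2 mulrA ler_pM2r ?divr_gt0 // ler_pM2l //.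
    by rewrite ler_piMr ?cabs_ge0 // invf_le1.
  have pE : cabs (dpt m.+1 u c) = cabs (u + c%:C) / N.
    by rewrite cabsM cabsR ger0_norm ?invr_ge0 ?(ltW N0) // mulrC.
  have pE' : cabs (dpt m.+1 u' c) = cabs (u' + c%:C) / N.
    by rewrite cabsM cabsR ger0_norm ?invr_ge0 ?(ltW N0) // mulrC.
  have a1 : 0 < cabs (u + c%:C) by rewrite cabs_gt0.
  have a2 : 0 < cabs (u' + c%:C) by rewrite cabs_gt0.
  rewrite pE in l1; rewrite pE' in l2.
  rewrite cabsM cabsR ger0_norm ?invr_ge0 ?(ltW N0) // cabs_div cabsM.
  apply: (@le_trans _ _ (N^-1 * ((D / N) / ((cY * (cabs (u + c%:C) / N)) * (cY * (cabs (u' + c%:C) / N)))))).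
    rewrite ler_pM2l ?invr_gt0 //; apply: ler_pM => //; rewrite ?cabs_ge0 //.
      by rewrite invr_ge0 mulr_ge0 ?cabs_ge0.
    have d1 : 0 < cY * (cabs (u + c%:C) / N) by rewrite (mulr_gt0 cY0) // divr_gt0.
    have d2 : 0 < cY * (cabs (u' + c%:C) / N) by rewrite (mulr_gt0 cY0) // divr_gt0.
    rewrite lef_pV2 ?posrE ?(mulr_gt0 d1 d2) //; last first.
      by rewrite mulr_gt0 ?cabs_gt0.
    by apply: ler_pM => //; exact: ltW.
  have -> : N^-1 * ((D / N) / ((cY * (cabs (u + c%:C) / N)) * (cY * (cabs (u' + c%:C) / N)))) =
     D * cY ^- 2 * (cabs (u + c%:C)^-1 * cabs (u' + c%:C)^-1).
    by rewrite !cabsV; field; rewrite !gt_eqF.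
  by rewrite ler_wpM2l ?pole_gap_le // mulr_ge0 ?(ltW D0) // invr_ge0 exprn_ge0 // ltW.
rewrite -[twosided f _](subrK (twosided f K)); apply: le_trans (cabsD _ _) _.
rewrite [leRHS]splitr lerD //.
  apply: le_trans (twosided_le KM big) _; rewrite twosided_atan //.
  move: hK; rewrite ler_pdivlMr // mulrC; apply: le_trans; rewrite ler_pM2l //.
  have := atan_ltpi2 (x + 2 * pi * (2 ^ m)%:R); have := atan_gtNpi2 (x - 2 * pi * (2 ^ m)%:R).
  by rewrite natrX; lra.
have -> : twosided f K = twosided f K - twosided f 0 by rewrite /twosided big_ord0 subr0.
apply: le_trans (twosided_le (g := fun=> 2 * C / N) (leq0n K) _) _.
  move=> c hc; apply: small; apply: le_trans hc _.
  by rewrite ler_pM2l // ler_nat.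
rewrite sumr_const_nat subn0 -[leLHS]mulr_natr.
have h : 4 * C * K%:R / (e / 2) <= N.
  by apply: le_trans (ltW hn2) (le_trans _ mN); rewrite ler_nat.
rewrite ler_pdivrMr ?divr_gt0 // mulrC in h.
have -> : (2 * C / N + 2 * C / N) * K%:R = (4 * C * K%:R) / N by field; rewrite gt_eqF.
by rewrite ler_pdivrMr //; move: h; lra.
Qed.

End MittagLeffler.

(** * Cauchy transforms *)

Section Cauchy.
Local Open Scope complex_scope.
Variable R : realType.
Implicit Types (mu nu : probability R R) (z p q d : R[i]) (e Y : R).

Lemma cauchyGE mu z : cauchyG mu z = cint mu (fun x => (z - x%:C)^-1).
Proof. by []. Qed.

Lemma Im_le_dist z (x : R) : Im z <= cabs (z - x%:C).
Proof. by apply: le_trans (Im_cabs _); rewrite cImB /= subr0. Qed.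

Lemma dist_neq0 z (x : R) : 0 < Im z -> z - x%:C != 0.
Proof. by move=> z0; apply: Im_gt0_neq0; rewrite cImB subr0. Qed.

Lemma cmeas_id : cmeas (fun x : R => x%:C).
Proof. by apply: cmeasR; exact: measurable_id. Qed.

Lemma cauchy_bcmeas z : 0 < Im z -> bcmeas (fun x : R => (z - x%:C)^-1).
Proof.
move=> z0; apply: (bcmeasV z0); last by move=> x; exact: Im_le_dist.
by apply: cmeasB; [exact: cmeas_cst | exact: cmeas_id].
Qed.

(** If the integral vanished, so would those of $\min(nf,1)$, which converge boundedly to the
    constant 1. *)
Lemma Rint_gt0 mu (f : R -> R) : bmeas f -> (forall x, 0 < f x) ->
  0 < Rintegral mu setT f.
Proof.
move=> bf f0.
have i0 : 0 <= Rintegral mu setT f by apply: Rintegral_ge0 => x _; exact: ltW.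
rewrite lt_neqAle i0 andbT; apply/eqP => e0.
have mf : measurable_fun setT f := bf.1.
pose fn (n : nat) x := Num.min (n%:R * f x) 1.
have mfn n : measurable_fun setT (fn n).
  by apply: measurable_minr => //; exact: measurable_funM.
have b01 n x : 0 <= fn n x <= 1.
  rewrite /fn le_min ge_min lexx orbT andbT ler01 andbT.
  by rewrite mulr_ge0 // ltW.
have h1 : (fun n => Rintegral mu setT (fn n)) @ \oo --> Rintegral mu setT (fun=> 1 : R).
  apply: (@Rint_dct _ mu fn _ 1) => //.
    by move=> n x; have /andP[a b] := b01 n x; rewrite ger0_norm.
  move=> x; apply/cvgn_epsP => e ep.
  have [K hK] := archi_nat (f x)^-1.
  exists K => n Kn; rewrite /fn min_r ?subrr ?normr0 ?(ltW ep) //.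
  rewrite -ler_pdivrMr // div1r; apply: le_trans (ltW hK) _.
  by rewrite ler_nat.
rewrite Rint_cst in h1.
have h2 n : Rintegral mu setT (fn n) = 0.
  apply/eqP; rewrite eq_le; apply/andP; split.
    have -> : (0 : R) = Rintegral mu setT (fun x => n%:R * f x) by rewrite Rint_Zl // -e0 mulr0.
    apply: Rint_le; last by move=> x; rewrite /fn ge_min lexx.
      by split => //; exists 1 => x; have /andP[a b] := b01 n x; rewrite ger0_norm.
    exact: bmeasZ.
  by apply: Rintegral_ge0 => x _; have /andP[] := b01 n x.
move/cvgn_epsP : h1 => /(_ (1 / 2)) [|N /(_ N (leqnn _))]; first by rewrite divr_gt0.
rewrite h2 sub0r normrN normr1; lra.
Qed.

Lemma Im_cauchyG mu z : 0 < Im z -> Im (cauchyG mu z) < 0.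
Proof.
move=> z0; rewrite -oppr_gt0.
have bI := bcmeas_Im (cauchy_bcmeas z0).
have -> : - Im (cauchyG mu z) =
    Rintegral mu setT (fun x => -1 * Im ((z - x%:C)^-1)).
  by rewrite Rint_Zl // mulN1r.
apply: Rint_gt0; first exact: bmeasZ.
move=> x; rewrite mulN1r cImV opprK divr_gt0 //.
  by rewrite cImB subr0.
by rewrite -sqr_cabs exprn_gt0 // cabs_gt0 dist_neq0.
Qed.

Lemma cauchyG_neq0 mu z : 0 < Im z -> cauchyG mu z != 0.
Proof. by move/(Im_cauchyG mu); apply: contraTneq => ->; rewrite ltxx. Qed.

Lemma cauchyG_Ftr mu z : cauchyG mu z = (Ftr mu z)^-1.
Proof. by rewrite /Ftr invrK. Qed.

Lemma Im_Ftr mu z : 0 < Im z -> 0 < Im (Ftr mu z).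
Proof.
move=> z0; rewrite /Ftr cImV oppr_gt0 pmulr_llt0 ?Im_cauchyG //.
by rewrite invr_gt0 -sqr_cabs exprn_gt0 // cabs_gt0 cauchyG_neq0.
Qed.

Lemma classL_shiftn mu z (n : nat) : classL mu -> 0 < Im z ->
  Ftr mu (z + (2 * pi * n%:R)%:C) = Ftr mu z + (2 * pi * n%:R)%:C.
Proof.
move=> hL z0; elim: n => [|n IH]; first by rewrite mulr0 !addr0.
have -> : 2 * pi * n.+1%:R = 2 * pi * n%:R + 2 * pi :> R.
  by rewrite -[n.+1]addn1 natrD; ring.
by rewrite rmorphD /= !addrA hL ?IH // cImD addr0.
Qed.

Lemma classL_shift mu z (n : int) : classL mu -> 0 < Im z ->
  Ftr mu (z + (2 * pi * n%:~R)%:C) = Ftr mu z + (2 * pi * n%:~R)%:C.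
Proof.
move=> hL z0; case: n => n; first exact: classL_shiftn.
rewrite NegzE mulrNz mulrN rmorphN /=.
have -> : n.+1%:~R = n.+1%:R :> R by [].
set c := (2 * pi * n.+1%:R)%:C.
have z1 : 0 < Im (z - c) by rewrite cImB subr0.
by rewrite -[in RHS](subrK c z) classL_shiftn // addrK.
Qed.

Lemma cauchyG_shift mu z (n : int) : classL mu -> 0 < Im z ->
  cauchyG mu (z + (2 * pi * n%:~R)%:C) = (Ftr mu z + (2 * pi * n%:~R)%:C)^-1.
Proof. by move=> hL z0; rewrite cauchyG_Ftr classL_shift. Qed.

(* [|x / (p - x)|] is dominated by [tailf (Im p) x] in the sector [|Re p| <= Im p]. *)
Definition tailf (Y x : R) : R := Num.min 2 (`|x| / Y).

Lemma tailf_bmeas Y : 0 < Y -> bmeas (tailf Y).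
Proof.
move=> Y0; split.
  by apply: measurable_minr => //; apply: measurable_funM.
exists 2 => x; rewrite /tailf ger0_norm ?ge_min ?lexx //.
by rewrite le_min ler0n divr_ge0 // ltW.
Qed.

Lemma tail_small mu e : 0 < e -> exists2 Y0, 0 < Y0 & forall Y, Y0 <= Y ->
  Rintegral mu setT (tailf Y) <= e.
Proof.
move=> e0.
have h : (fun n : nat => Rintegral mu setT (tailf n.+1%:R)) @ \oo --> Rintegral mu setT (fun=> 0 : R).
  apply: (@Rint_dct _ mu (fun n => tailf n.+1%:R) _ 2) => //.
  - by move=> n; exact: (tailf_bmeas (ltr0Sn _ n)).1.
  - by move=> n x; rewrite /tailf ger0_norm ?ge_min ?lexx // le_min ler0n divr_ge0.
  move=> x; apply/cvgn_epsP => d d0.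
  have [K hK] := archi_nat (`|x| / d).
  exists K => n Kn; rewrite subr0 /tailf ger0_norm; last first.
    by rewrite le_min ler0n divr_ge0.
  rewrite ge_min; apply/orP; right.
  rewrite ler_pdivrMr // mulrC -ler_pdivrMr //; apply: le_trans (ltW hK) _.
  by rewrite ler_nat ltnW.
rewrite Rint_cst in h.
move/cvgn_epsP : h => /(_ e e0) [N /(_ N (leqnn _))].
rewrite subr0 => h; exists N.+1%:R => // Y NY.
apply: le_trans (le_trans (ler_norm _) h); apply: Rint_le; try by apply: tailf_bmeas => //; exact: lt_le_trans NY.
move=> x; rewrite /tailf le_min ge_min lexx /= ge_min; apply/orP; right.
by rewrite ler_wpM2l // lef_pV2 ?posrE // (lt_le_trans _ NY).
Qed.

Definition sector (Y : R) p := `|Re p| <= Im p /\ Y <= Im p.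

Lemma cabs_sector Y p : sector Y p -> cabs p <= 2 * Im p.
Proof.
move=> [h _]; apply: le_trans (cabs_ReIm _) _.
have i0 : 0 <= Im p by apply: le_trans h.
by rewrite (ger0_norm i0); lra.
Qed.

Lemma sector_tailf Y p x : 0 < Y -> sector Y p ->
  cabs (x%:C / (p - x%:C)) <= tailf Y x.
Proof.
move=> Y0 [h1 h2]; have p0 : 0 < Im p := lt_le_trans Y0 h2.
have n0 : 0 < cabs (p - x%:C) by rewrite cabs_gt0 dist_neq0.
rewrite cabs_div cabsR /tailf le_min; apply/andP; split.
  rewrite ler_pdivrMr //.
  have xE : x = Re p - Re (p - x%:C) by rewrite cReB /=; ring.
  rewrite [X in `|X| <= _]xE.
  apply: le_trans (ler_normB _ _) _.
  have := normRe_cabs (p - x%:C); have := Im_le_dist p x; lra.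
by rewrite ler_wpM2l // lef_pV2 ?posrE //; apply: le_trans (Im_le_dist p x).
Qed.

Lemma moment_bcmeas p : 0 < Im p -> bcmeas (fun x : R => x%:C / (p - x%:C)).
Proof.
move=> p0.
have -> : (fun x : R => x%:C / (p - x%:C)) = (fun x => p * (p - x%:C)^-1 - 1).
  by apply: funext => x; field; exact: dist_neq0.
apply: bcmeasB; last exact: bcmeas_cst.
by apply: bcmeasZ; exact: cauchy_bcmeas.
Qed.

Lemma sector_cauchyG mu Y p : 0 < Y -> sector Y p ->
  cabs (p * cauchyG mu p - 1) <= 2 * Rintegral mu setT (tailf Y).
Proof.
move=> Y0 sp; have p0 : 0 < Im p := lt_le_trans Y0 sp.2.
have -> : p * cauchyG mu p - 1 = cint mu (fun x => x%:C / (p - x%:C)).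
  rewrite -cintZ; last exact: cauchy_bcmeas.
  rewrite -[X in _ - X](cint_cst mu 1) -cintB; last exact: bcmeas_cst.
    by apply: cint_eq => x; field; exact: dist_neq0.
  by apply: bcmeasZ; exact: cauchy_bcmeas.
apply: cint_bound; [exact: moment_bcmeas | exact: tailf_bmeas |].
by move=> x; exact: sector_tailf.
Qed.

(** In the sector $pG(p)-1=\int\frac{x}{p-x}\,d\mu(x)$ is small, and dividing gives
    $F(p)=p+o(|p|)$. *)
Lemma Ftr_asymp mu e : 0 < e -> exists2 Y, 0 < Y & forall p, sector Y p ->
  cabs (Ftr mu p - p) <= e * cabs p.
Proof.
(* The first bound keeps $|pG(p)|\ge1/2$; the second leaves [e] after division by it. *)
move=> e0; pose d := Num.min (1 / 4) (e / 4).
have d0 : 0 < d by rewrite lt_min !divr_gt0.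
have [Y Y0 hY] := tail_small mu d0.
exists Y => // p sp; have p0 : 0 < Im p := lt_le_trans Y0 sp.2.
have h := le_trans (sector_cauchyG mu Y0 sp) (ler_wpM2l (ler0n _ 2) (hY _ (lexx _))).
have h1 : d <= 1 / 4 by rewrite ge_min lexx.
have h2 : d <= e / 4 by rewrite ge_min lexx orbT.
set g := p * cauchyG mu p in h.
have g1 : 1 / 2 <= cabs g.
  have -> : g = 1 - (1 - g) by ring.
  by have := cabs_lowerB 1 (1 - g); rewrite cabs1 (cabsBC 1 g); lra.
have pn := Im_gt0_neq0 p0; have Gn := cauchyG_neq0 mu p0.
have gn : g != 0 by rewrite mulf_neq0.
have -> : Ftr mu p - p = p * ((1 - g) / g).
  by rewrite /Ftr /g; field; rewrite pn Gn.
rewrite cabsM mulrC ler_wpM2r ?cabs_ge0 // cabs_div cabsBC ler_pdivrMr ?cabs_gt0 //.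
apply: le_trans h _; have : e / 2 <= e * cabs g by rewrite ler_pM2l //; lra.
lra.
Qed.

(** The resolvent identity gives $G(p)-G(q)=(q-p)\int\frac{d\mu(x)}{(p-x)(q-x)}$, and high in the
    sector $pq$ times this integral is within $1/2$ of $1$, so the integral does not vanish. *)
Lemma Ftr_sector_inj mu : exists2 Y, 0 < Y & forall p q, sector Y p -> sector Y q ->
  Ftr mu p = Ftr mu q -> p = q.
Proof.
have [|Y Y0 hY] := @tail_small mu (1 / 16); first by rewrite divr_gt0.
exists Y => // p q sp sq e.
have p0 : 0 < Im p := lt_le_trans Y0 sp.2.
have q0 : 0 < Im q := lt_le_trans Y0 sq.2.
have pn := Im_gt0_neq0 p0; have qn := Im_gt0_neq0 q0.
pose f x := (p - x%:C)^-1 * (q - x%:C)^-1.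
have bf : bcmeas f by apply: bcmeasM; exact: cauchy_bcmeas.
have eG : cauchyG mu p - cauchyG mu q = (q - p) * cint mu f.
  rewrite -cintZ // -cintB; try exact: cauchy_bcmeas.
  by apply: cint_eq => x; rewrite /f; field; rewrite !dist_neq0.
have : (q - p) * cint mu f = 0 by rewrite -eG !cauchyG_Ftr e subrr.
move/eqP; rewrite mulf_eq0 => /orP[|/eqP f0].
  by rewrite subr_eq0 => /eqP.
exfalso.
have : cabs (p * q * cint mu f - 1) <= 2 * (4 * Rintegral mu setT (tailf Y)).
  rewrite -cintZ // -[X in _ - X](cint_cst mu 1) -cintB; last exact: bcmeas_cst.
    rewrite -Rint_Zl; last exact: tailf_bmeas.
    apply: cint_bound.
    - by apply: bcmeasB; [exact: bcmeasZ | exact: bcmeas_cst].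
    - by apply: bmeasZ; exact: tailf_bmeas.
    move=> x.
    have -> : p * q * f x - 1 = x%:C / (p - x%:C) + x%:C / (q - x%:C) +
         (x%:C / (p - x%:C)) * (x%:C / (q - x%:C)).
      by rewrite /f; field; rewrite !dist_neq0.
    have h1 := sector_tailf x Y0 sp; have h2 := sector_tailf x Y0 sq.
    have t2 : tailf Y x <= 2 by rewrite /tailf ge_min lexx.
    apply: le_trans (cabsD _ _) _; apply: le_trans (lerD (cabsD _ _) (lexx _)) _.
    have : cabs (x%:C / (p - x%:C) * (x%:C / (q - x%:C))) <= 2 * tailf Y x.
      by rewrite cabsM; apply: ler_pM => //; rewrite ?cabs_ge0 //; exact: le_trans t2.
    lra.
  exact: bcmeasZ.
rewrite f0 mulr0 sub0r cabsN cabs1.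
by have := hY _ (lexx _); lra.
Qed.

Lemma Im_Ftr_unbounded mu z (B : R) : exists2 t, 0 < t & forall s, t <= s ->
  B <= Im (Ftr mu (z + Complex 0 s)).
Proof.
have [|Y Y0 hY] := @Ftr_asymp mu (1 / 4); first by rewrite divr_gt0.
exists (1 + `|Y| + `|Re z| + `|Im z| + 2 * `|B|).
  by rewrite -!addrA ltr_pwDl // !addr_ge0 // mulr_ge0.
move=> s hs; set p := z + _.
have Ip : Im p = Im z + s by rewrite cImD.
have Rp : Re p = Re z by rewrite cReD addr0.
have nY := ler_norm Y; have nB := ler_norm B; have n1 := normr_ge0 B.
have nz : - `|Im z| <= Im z by rewrite lerNl -normrN ler_norm.
have n2 := normr_ge0 Y; have n3 := normr_ge0 (Re z).
have sp : sector Y p by split; rewrite Ip ?Rp; lra.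
have h := hY _ sp; have h2 := cabs_sector sp.
have h3 := normIm_cabs (Ftr mu p - p).
have : Im p - Im (Ftr mu p) <= 1 / 2 * Im p.
  have -> : Im p - Im (Ftr mu p) = - Im (Ftr mu p - p) by rewrite cImB opprB.
  apply: le_trans (ler_norm _) _; rewrite normrN; lra.
by rewrite Ip; lra.
Qed.

(** * Summation of the Cauchy transform over the period *)

Lemma cmeas_cei z : cmeas (fun x : R => cei (z - x%:C)).
Proof.
have -> : (fun x : R => cei (z - x%:C)) = (fun x => cei z * zeta (- x)).
  by apply: funext => x; rewrite ceiD -cei_zeta rmorphN.
apply: cmeasM; first exact: cmeas_cst.
split => /=.
  apply: (measurableT_comp (f := @cos R)) => //.
  by apply: continuous_measurable_fun; exact: continuous_cos.
apply: (measurableT_comp (f := @sin R)) => //.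
by apply: continuous_measurable_fun; exact: continuous_sin.
Qed.

Lemma cabs_ev z : 0 < Im z -> cabs (ev z) <= (Im z)^-1.
Proof.
move=> z0; rewrite cabs_div.
have r1 := cabs_cei_lt1 z0.
have h1 : 1 - cabs (cei z) <= cabs (1 - cei z).
  by have := cabs_lowerB 1 (cei z); rewrite cabs1.
rewrite ler_pdivrMr ?cabs_gt0 ?subr1_cei_neq0 // mulrC ler_pdivlMr //.
apply: le_trans h1; rewrite cabs_cei mulrC.
by have [] := expRN_bounds (ltW z0).
Qed.

Lemma Im_subR z (x : R) : Im (z - x%:C) = Im z.
Proof. by rewrite cImB subr0. Qed.

Lemma ev_bcmeas z : 0 < Im z -> bcmeas (fun x : R => ev (z - x%:C)).
Proof.
move=> z0; split; last first.
  by exists (Im z)^-1 => x; apply: le_trans (cabs_ev _) _; rewrite Im_subR.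
apply: cmeasM; first exact: cmeas_cei.
apply: cmeasV; apply: cmeasB; [exact: cmeas_cst | exact: cmeas_cei].
Qed.

Lemma pole_gap_bcmeas z d c : 0 < Im z -> 0 < Im d ->
  bcmeas (fun x : R => pole_gap (z - x%:C) d c).
Proof.
move=> z0 d0.
have -> : (fun x : R => pole_gap (z - x%:C) d c) =
  (fun x => (z + c%:C - x%:C)^-1 - (z + d + c%:C - x%:C)^-1).
  by apply: funext => x; rewrite /pole_gap; congr (_^-1 - _^-1); ring.
by apply: bcmeasB; apply: cauchy_bcmeas; rewrite !cImD /= ?addr0 ?addr_gt0.
Qed.

(** Here membership in the class enters: $G(z+2\pi n)=1/(F(z)+2\pi n)$, so integrating a gap at [z]
    gives the gap at $F(z)$, the step [d] becoming $F(z+d)-F(z)$. *)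
Lemma cint_pole_gap mu z d (n : int) : classL mu -> 0 < Im z -> 0 < Im d ->
  cint mu (fun x : R => pole_gap (z - x%:C) d (2 * pi * n%:~R)) =
  pole_gap (Ftr mu z) (Ftr mu (z + d) - Ftr mu z) (2 * pi * n%:~R).
Proof.
move=> hL z0 d0.
have zd : 0 < Im (z + d) by rewrite cImD addr_gt0.
rewrite /pole_gap addrC (addrC (Ftr _ z) (_ - _)) subrK addrC -!cauchyG_shift // -cintB.
- by apply: cint_eq => x; congr (_^-1 - _^-1); ring.
- by apply: cauchy_bcmeas; rewrite cImD addr0.
- by apply: cauchy_bcmeas; rewrite cImD addr0.
Qed.

Lemma eq_of_cabs_le (a b : R[i]) :
  (forall e, 0 < e -> cabs (a - b) <= e) -> a = b.
Proof.
move=> h; apply/eqP; rewrite -subr_eq0 -cabs_eq0; apply/eqP/le_anti.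
rewrite cabs_ge0 andbT; apply/ler_addgt0Pr => e e0; rewrite add0r; exact: h.
Qed.

(** The expansion is applied twice: under the integral with step [d], and at $F(z)$ with step
    $F(z+d)-F(z)$. The inequality of imaginary parts places the latter step in the upper
    half-plane. *)
Lemma cint_ev_gap mu z d : classL mu -> 0 < Im z -> 0 < Im d ->
  Im (Ftr mu z) < Im (Ftr mu (z + d)) ->
  cint mu (fun x => ev (z - x%:C)) - cint mu (fun x => ev (z + d - x%:C)) =
  ev (Ftr mu z) - ev (Ftr mu (z + d)).
Proof.
move=> hL z0 d0 Fd.
have zd : 0 < Im (z + d) by rewrite cImD addr_gt0.
set D := Ftr mu (z + d) - Ftr mu z.
have D0 : 0 < Im D by rewrite cImB subr_gt0.
have [K hK] := twosided_bound z0 d0.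
pose Fn m (x : R) := 'i * twosided (pole_gap (z - x%:C) d) (2 ^ m).
have bFk k : bcmeas (fun x : R => pole_gap (z - x%:C) d (2 * pi * k%:R) +
     pole_gap (z - x%:C) d (- (2 * pi * k.+1%:R))).
  by apply: bcmeasD; exact: pole_gap_bcmeas.
have bT m : bcmeas (fun x : R => twosided (pole_gap (z - x%:C) d) m).
  exact: (@bcmeas_sum _ m (fun k x => pole_gap (z - x%:C) d (2 * pi * k%:R) +
     pole_gap (z - x%:C) d (- (2 * pi * k.+1%:R)))).
have bFn m : bcmeas (Fn m) by exact: bcmeasZ.
have cE m : cint mu (Fn m) = 'i * twosided (pole_gap (Ftr mu z) D) (2 ^ m).
  rewrite cintZ //; congr (_ * _).
  rewrite (cint_sum mu (2 ^ m) bFk); apply: eq_bigr => k _.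
  rewrite cintD; try exact: pole_gap_bcmeas.
  congr (_ + _); first exact: (cint_pole_gap k).
  have := @cint_pole_gap mu z d (Negz k) hL z0 d0.
  by rewrite NegzE mulrNz mulrN.
pose L (x : R) := ev (z - x%:C) - ev (z + d - x%:C).
have bL : bcmeas L by apply: bcmeasB; exact: ev_bcmeas.
rewrite -cintB; try exact: ev_bcmeas.
apply: eq_of_cabs_le => e e0; have e2 : 0 < e / 2 by rewrite divr_gt0.
have [||m1 h1] := @cint_dct _ mu Fn L K (fun m => (bFn m).1) bL.1 _ _ _ e2.
- by move=> m x; rewrite /Fn cabsM cabsI mul1r; apply: hK; rewrite Im_subR.
- move=> x e' e'0.
  have zx : 0 < Im (z - x%:C) by rewrite Im_subR.
  have [m0 hm] := mittag_leffler zx d0 e'0.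
  exists m0 => m /hm; rewrite /Fn /L.
  by have -> : z - x%:C + d = z + d - x%:C by ring.
have [m2 h2] := mittag_leffler (Im_Ftr mu z0) D0 e2.
have DE : Ftr mu z + D = Ftr mu (z + d) by rewrite addrC subrK.
have := h1 (maxn m1 m2) (leq_maxl _ _); have := h2 (maxn m1 m2) (leq_maxr _ _).
rewrite -cE DE => k2 k1.
set A := cint mu (Fn _) in k1 k2.
have -> : cint mu L - (ev (Ftr mu z) - ev (Ftr mu (z + d))) =
  (A - (ev (Ftr mu z) - ev (Ftr mu (z + d)))) - (A - cint mu L) by ring.
by apply: le_trans (cabsB _ _) _; lra.
Qed.

(** By the gap identity the difference of the two sides is the same at [z] and at [z + d]; both of
    its terms tend to $0$ as [d] goes up the imaginary axis, by [cabs_ev]. *)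
Lemma cint_ev mu z : classL mu -> 0 < Im z ->
  cint mu (fun x => ev (z - x%:C)) = ev (Ftr mu z).
Proof.
move=> hL z0; apply: eq_of_cabs_le => e e0.
(* The summand $1$ makes the imaginary part of $F$ rise strictly, and $2/e$ makes [ev] at $F(z+d)$
   at most $e/2$. The $4/e$ in [t] also pays for the factor $2$ of [cint_boundK]. *)
have [t1 t10 h1] := Im_Ftr_unbounded mu z (Im (Ftr mu z) + 1 + 2 / e).
pose t := t1 + 4 / e.
have e1 : 0 < 2 / e by rewrite divr_gt0.
have e4 : 0 < 4 / e by rewrite divr_gt0.
have t0 : 0 < t by rewrite addr_gt0.
pose d : R[i] := Complex 0 t.
have hd : Im (Ftr mu z) + 1 + 2 / e <= Im (Ftr mu (z + d)).
  by apply: h1; rewrite lerDl ltW.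
have F0 := Im_Ftr mu z0.
have gap := @cint_ev_gap mu z d hL z0 t0.
have -> : cint mu (fun x => ev (z - x%:C)) - ev (Ftr mu z) =
  cint mu (fun x => ev (z + d - x%:C)) - ev (Ftr mu (z + d)).
  have := gap; have lt : Im (Ftr mu z) < Im (Ftr mu (z + d)) by lra.
  move/(_ lt); set a := cint _ _; set b := cint _ _ => g.
  by rewrite -[a](subrK b) g; ring.
have zd : 0 < Im (z + d) by rewrite cImD addr_gt0.
apply: le_trans (cabsB _ _) _; rewrite [leRHS]splitr lerD //.
  apply: (@le_trans _ _ (2 * (e / 4))); last by lra.
  apply: cint_boundK; first exact: (ev_bcmeas zd).1.
  move=> x; apply: le_trans (cabs_ev _) _; rewrite Im_subR //.
  rewrite invf_ple ?posrE ?divr_gt0 // invf_div cImD /= /t; lra.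
have Fd : 0 < Im (Ftr mu (z + d)) by lra.
apply: le_trans (cabs_ev Fd) _.
by rewrite invf_ple ?posrE ?divr_gt0 // invf_div; lra.
Qed.

End Cauchy.

(** * Wrapping *)

Section Wrap.
Local Open Scope complex_scope.
Variable R : realType.
Implicit Types (mu nu : probability R R) (z w : R[i]) (f g : R -> R) (F : R -> R[i]).

Lemma Rint_pushforward mu nu (phi : R -> R) f : measurable_fun setT phi ->
  (forall A, measurable A -> nu A = mu (phi @^-1` A)) -> bmeas f ->
  Rintegral nu setT f = Rintegral mu setT (f \o phi).
Proof.
move=> mphi h bf; have [mf [K hK]] := bf.
have bfp : bmeas (f \o phi).
  by split; [exact: (measurableT_comp mf) | exists K => x; exact: hK].
rewrite /Rintegral; congr fine.
transitivity (\int[pushforward mu phi]_x (f x)%:E)%E.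
  by apply: eq_measure_integral => A mA _; exact: h.
rewrite integral_pushforward //.
  by apply/measurable_EFinP.
exact: bmeas_integrable bfp.
Qed.

Lemma cint_pushforward mu nu (phi : R -> R) F : measurable_fun setT phi ->
  (forall A, measurable A -> nu A = mu (phi @^-1` A)) -> bcmeas F ->
  cint nu F = cint mu (fun x => F (phi x)).
Proof.
move=> mphi h bF; congr Complex.
  by rewrite (Rint_pushforward mphi h (bcmeas_Re bF)).
by rewrite (Rint_pushforward mphi h (bcmeas_Im bF)).
Qed.

Lemma wrap_angle_frac (x : R) : wrap_angle x = frac2pi (- x).
Proof. by []. Qed.

Lemma measurable_wrap_angle : measurable_fun setT (@wrap_angle R).
Proof.
have mf : measurable_fun setT (fun x : R => (Num.floor x)%:~R : R).
  apply: nondecreasing_measurable => // x y xy.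
  by rewrite ler_int le_floor.
apply: measurable_funB; first exact: measurable_funN.
apply: measurable_funM => //.
apply: (measurableT_comp mf); apply: measurable_funM => //.
Qed.

Lemma wrap_angle_dom (x : R) : angle_dom (wrap_angle x).
Proof. by rewrite /angle_dom /= in_itv /=; exact: frac2pi_itv. Qed.

Lemma zeta_wrap_angle (x : R) : zeta (wrap_angle x) = cei (- x%:C).
Proof.
by rewrite -cei_zeta wrap_angle_frac /frac2pi rmorphB ceiB cei_2piz divr1 rmorphN.
Qed.

Lemma wrap_circ mu nu : is_wrap nu mu -> circ nu.
Proof.
move=> h; rewrite /circ h; last exact: measurable_itv.
rewrite (_ : _ @^-1` _ = setT) ?mass1 //.
by apply/seteqP; split => // x _; exact: wrap_angle_dom.
Qed.

Lemma exists_pushforward mu (phi : R -> R) : measurable_fun setT phi ->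
  exists nu, forall A, measurable A -> nu A = mu (phi @^-1` A).
Proof.
move=> mphi.
by exists (distribution mu (mfun_Sub (mem_set mphi))).
Qed.

Lemma exists_wrap mu : exists nu, is_wrap nu mu.
Proof. exact: exists_pushforward measurable_wrap_angle. Qed.

Definition disk_ker w (t : R) : R[i] := w * zeta t / (1 - w * zeta t).

Lemma psiE nu w : psi nu w = cint nu (disk_ker w).
Proof. by []. Qed.

Lemma cmeas_zeta : cmeas (@zeta R).
Proof.
split; apply: continuous_measurable_fun; [exact: continuous_cos|exact: continuous_sin].
Qed.

Lemma cabs_mul_zeta w (t : R) : cabs (w * zeta t) = cabs w.
Proof. by rewrite cabsM cabs_zeta mulr1. Qed.

Lemma disk_low w (t : R) : cabs w < 1 -> 1 - cabs w <= cabs (1 - w * zeta t).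
Proof.
by move=> w1; have := cabs_lowerB 1 (w * zeta t); rewrite cabs1 cabs_mul_zeta.
Qed.

Lemma disk_neq0 w (t : R) : cabs w < 1 -> 1 - w * zeta t != 0.
Proof.
by move=> w1; rewrite -cabs_gt0; apply: lt_le_trans (disk_low t w1); rewrite subr_gt0.
Qed.

Lemma bcmeas_zeta : bcmeas (@zeta R).
Proof. by split; [exact: cmeas_zeta | exists 1 => x; rewrite cabs_zeta]. Qed.

Lemma bcmeas_disk_inv w : cabs w < 1 -> bcmeas (fun t => (1 - w * zeta t)^-1).
Proof.
move=> w1; apply: (bcmeasV (k := 1 - cabs w)); first by rewrite subr_gt0.
  apply: cmeasB; first exact: cmeas_cst.
  by apply: cmeasM; [exact: cmeas_cst | exact: cmeas_zeta].
by move=> t; exact: disk_low.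
Qed.

Lemma bcmeas_disk_ker w : cabs w < 1 -> bcmeas (disk_ker w).
Proof.
move=> w1; apply: bcmeasM; last exact: bcmeas_disk_inv.
by apply: bcmeasZ; exact: bcmeas_zeta.
Qed.

Lemma psi0 nu : psi nu 0 = 0.
Proof.
rewrite psiE -[RHS](cint_cst nu); apply: cint_eq => t.
by rewrite /disk_ker mul0r mul0r.
Qed.

Lemma eta0 nu : eta nu 0 = 0.
Proof. by rewrite /eta psi0 mul0r. Qed.

Lemma psi_wrap mu nu z : classL mu -> is_wrap nu mu -> 0 < Im z ->
  psi nu (cei z) = ev (Ftr mu z).
Proof.
move=> hL hw z0; rewrite psiE -cint_ev //.
rewrite (cint_pushforward measurable_wrap_angle hw); last first.
  by apply: bcmeas_disk_ker; exact: cabs_cei_lt1.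
apply: cint_eq => x; rewrite /disk_ker zeta_wrap_angle -ceiD //.
Qed.

(** With $w=e^{iF(z)}$, [psi] takes the value $w/(1-w)$, and $\psi\mapsto\psi/(1+\psi)$ inverts
    $w\mapsto w/(1-w)$. *)
Lemma eta_wrap mu nu z : classL mu -> is_wrap nu mu -> 0 < Im z ->
  eta nu (cei z) = cei (Ftr mu z).
Proof.
move=> hL hw z0; rewrite /eta (psi_wrap hL hw z0) /ev.
have n := subr1_cei_neq0 (Im_Ftr mu z0); set w := cei _ in n *.
have -> : 1 + w / (1 - w) = (1 - w)^-1 by field.
by rewrite invrK divfK.
Qed.

(** The map $v\mapsto v/(1-v)$ sends the disc into the half-plane $\mathrm{Re}>-1/2$. Hence $1+\psi$
    never vanishes there and [eta] determines [psi]. *)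
Lemma Re_psi nu w : cabs w < 1 -> - (1 / 2) <= Re (psi nu w).
Proof.
move=> w1; rewrite -[leLHS](Rint_cst nu); apply: Rint_le.
- by split => //; exists `|- (1 / 2) : R|.
- exact: bcmeas_Re (bcmeas_disk_ker w1).
move=> t; set v := w * zeta t.
have v1 : cabs v < 1 by rewrite cabs_mul_zeta.
have nv : 1 - v != 0 by exact: disk_neq0.
have -> : v / (1 - v) = (1 - v)^-1 - 1 by field.
rewrite cReB cReV /= -sqr_cabs cReB /=.
have : 1 / 2 <= (1 - Re v) / cabs (1 - v) ^+ 2.
  rewrite ler_pdivlMr ?exprn_gt0 ?cabs_gt0 // sqr_cabs cReB cImB /=.
  have : Re v ^+ 2 + Im v ^+ 2 <= 1 by rewrite -sqr_cabs expr_le1 ?cabs_ge0 // ltW.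
  by rewrite sub0r sqrrN sqrrB; lra.
lra.
Qed.

Lemma psi1_neq0 nu w : cabs w < 1 -> 1 + psi nu w != 0.
Proof.
move=> w1; apply/eqP => h; have := Re_psi nu w1.
by have := congr1 Re h; rewrite cReD /=; lra.
Qed.

Lemma eta_inj_measure nu nu' w : cabs w < 1 -> eta nu w = eta nu' w ->
  psi nu w = psi nu' w.
Proof.
move=> w1; have n1 := psi1_neq0 nu w1; have n2 := psi1_neq0 nu' w1.
rewrite /eta => /eqP; rewrite eqr_div // => /eqP.
rewrite !mulrDr !mulr1 (mulrC (psi nu' w)) => /addIr //.
Qed.

End Wrap.

(** * Measures determined by integrals of sign functions *)

Section Uniqueness.
Local Open Scope complex_scope.
Variable R : realType.
Implicit Types (mu nu : probability R R) (z w : R[i]) (f g : R -> R) (a b c x y : R).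

Lemma measure_eq_cdf mu nu : (forall c : R, mu `]-oo, c[%classic = nu `]-oo, c[%classic) ->
  forall A : set R, measurable A -> mu A = nu A.
Proof.
move=> h A mA.
pose G := [set B : set R | exists c : R, B = `]-oo, c[%classic].
apply: (@measure_unique _ _ _ G (fun n => `]-oo, (n%:R : R)[%classic)) => //.
- exact: RGenInftyO.measurableE.
- move=> _ _ [c ->] [c' ->]; exists (Num.min c c').
  by apply/seteqP; split => x /=; rewrite !in_itv /= lt_min; [case=> -> ->|move/andP].
- by move=> n; exists n%:R.
- apply/seteqP; split => // x _; have [n hn] := archi_nat x.
  by exists n => //=; rewrite in_itv /=.
- by move=> B [c ->]; exact: h.
- by move=> n; apply: le_lt_trans (ltry 1); exact: probability_le1.
Qed.

Lemma cvgn_near_eq (u : nat -> R) (l : R) :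
  (exists N, forall n, (N <= n)%N -> u n = l) -> u @ \oo --> l.
Proof.
move=> [N hN]; apply/cvgn_epsP => e e0; exists N => n Nn.
by rewrite hN // subrr normr0 ltW.
Qed.

Lemma sgr_bmeas c : bmeas (fun t : R => Num.sg (t - c)).
Proof.
split; last by exists 1 => t; rewrite normr_sg; case: (_ == _).
apply: nondecreasing_measurable => // x y xy.
have [h1|h1|h1] := ltgtP (x - c) 0; have [h2|h2|h2] := ltgtP (y - c) 0;
  rewrite ?h1 ?h2 ?(ltr0_sg h1) ?(ltr0_sg h2) ?(gtr0_sg h1) ?(gtr0_sg h2) ?sgr0; lra.
Qed.

(** Approaching [c] strictly from the left avoids the value $0$ of the sign at an atom in [c]: the
    pointwise limit is $1-2\cdot1_{(-\infty,c)}$. *)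
Lemma sgr_cdf mu c : (fun n => Rintegral mu setT (fun t => Num.sg (t - (c - n.+1%:R^-1)))) @ \oo -->
  1 - 2 * fine (mu `]-oo, c[%classic).
Proof.
have mi : measurable_fun setT (\1_(`]-oo, c[%classic) : R -> R) by apply: measurable_indic.
have -> : 1 - 2 * fine (mu `]-oo, c[%classic) =
    Rintegral mu setT (fun t => 1 - 2 * \1_(`]-oo, c[%classic) t).
  have bi : bmeas (\1_(`]-oo, c[%classic) : R -> R).
    by split => //; exists 1 => t; rewrite indicE; case: (_ \in _); rewrite ?normr1 ?normr0.
  rewrite RintegralB //; last 2 first.
  - by apply: bmeas_integrable; split => //; exists `|1 : R|.
  - by apply: bmeas_integrable; exact: bmeasZ.
  rewrite Rint_Zl // Rint_cst; congr (_ - 2 * _).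
  rewrite /Rintegral integral_indic // setIT //.
apply: (@Rint_dct _ mu (fun n t => Num.sg (t - (c - n.+1%:R^-1))) _ 1).
- by move=> n; exact: (sgr_bmeas _).1.
- by apply: measurable_funB => //; exact: measurable_funM.
- by move=> n x; rewrite normr_sg; case: (_ == _).
move=> t; apply: cvgn_near_eq; rewrite indicE.
have [tc|ct] := ltP t c; last first.
  exists 0%N => n _; rewrite memNset /= ?in_itv /= ?mulr0 ?subr0; last first.
    by apply/negP; rewrite -leNgt.
  rewrite gtr0_sg //; have : 0 < n.+1%:R^-1 :> R by [].
  by set q := _^-1; lra.
have [K hK] := archi_nat (c - t)^-1.
exists K => n Kn; rewrite mem_set /= ?in_itv //= mulr1.
have t0 : 0 < c - t by rewrite subr_gt0.
have : n.+1%:R^-1 < c - t.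
  rewrite invf_plt ?posrE //; apply: lt_le_trans hK _; rewrite ler_nat; exact: leqW.
by set q := _^-1 => h; rewrite ltr0_sg; lra.
Qed.

Lemma measure_eq_sgr mu nu :
  (forall c : R, Rintegral mu setT (fun t => Num.sg (t - c)) =
                 Rintegral nu setT (fun t => Num.sg (t - c))) ->
  forall A : set R, measurable A -> mu A = nu A.
Proof.
move=> h; apply: measure_eq_cdf => c.
have h1 := @sgr_cdf mu c; have h2 := @sgr_cdf nu c.
have e : 1 - 2 * fine (mu `]-oo, c[%classic) = 1 - 2 * fine (nu `]-oo, c[%classic).
  have e : (fun n => Rintegral mu setT (fun t => Num.sg (t - (c - n.+1%:R^-1)))) =
           (fun n => Rintegral nu setT (fun t => Num.sg (t - (c - n.+1%:R^-1)))).
    by apply: funext => n; exact: h.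
  by rewrite e in h1; exact: (cvg_unique _ h1 h2).
have e' : fine (mu `]-oo, c[%classic) = fine (nu `]-oo, c[%classic) by lra.
have fin (m : probability R R) : m `]-oo, c[%classic \is a fin_num.
  rewrite ge0_fin_numE ?measure_ge0 //.
  by apply: le_lt_trans (ltry 1); apply: probability_le1; exact: measurable_itv.
by rewrite -[LHS]fineK ?fin // e' fineK ?fin.
Qed.

(** Cutting $[a,b]$ into $n+1$ equal steps bounds the variation by $C(b-a)^2/(n+1)$. *)
Lemma quadratic_const (D : R -> R) (C : R) :
  (forall s h, `|D (s + h) - D s| <= C * h ^+ 2) -> forall a b, D a = D b.
Proof.
move=> hD a b.
have C0 : 0 <= C.
  by have := hD 0 1; rewrite expr1n mulr1; apply: le_trans.
have step n : `|D b - D a| <= C * (b - a) ^+ 2 / n.+1%:R.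
  pose h := (b - a) / n.+1%:R.
  have hk k : `|D (a + k%:R * h) - D a| <= k%:R * (C * h ^+ 2).
    elim: k => [|k IH]; first by rewrite mul0r addr0 subrr normr0 mul0r.
    have -> : a + k.+1%:R * h = a + k%:R * h + h by rewrite -[k.+1]addn1 natrD; ring.
    have -> : D (a + k%:R * h + h) - D a =
      (D (a + k%:R * h + h) - D (a + k%:R * h)) + (D (a + k%:R * h) - D a) by ring.
    apply: le_trans (ler_normD _ _) _; apply: le_trans (lerD (hD _ _) IH) _.
    by rewrite -[k.+1]addn1 natrD; lra.
  have n0 : n.+1%:R != 0 :> R by [].
  have := hk n.+1; rewrite /h; have -> : a + n.+1%:R * ((b - a) / n.+1%:R) = b by field.
  move=> /le_trans; apply.
  by rewrite le_eqVlt; apply/orP; left; apply/eqP; field.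
apply/eqP; rewrite eq_sym -subr_eq0 -normr_eq0; apply/eqP/le_anti.
rewrite normr_ge0 andbT; apply/ler_addgt0Pr => e e0; rewrite add0r.
have [n hn] := archi_nat (C * (b - a) ^+ 2 / e).
apply: le_trans (step n) _; rewrite ler_pdivrMr //.
rewrite ltr_pdivrMr // in hn; apply: le_trans (ltW hn) _.
by rewrite mulrC ler_pM2l // ler_nat.
Qed.

(* If the derivatives in [s] of the kernel [k] have equal integrals for [mu] and
   [nu], the integrals of [k s] differ by a constant. *)
Lemma kernel_primitive mu nu (k l : R -> R -> R) (C : R) :
  (forall s, bmeas (k s)) -> (forall s, bmeas (l s)) ->
  (forall s h t, `|k (s + h) t - k s t - h * l s t| <= C * h ^+ 2) ->
  (forall s, Rintegral mu setT (l s) = Rintegral nu setT (l s)) ->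
  forall a b, Rintegral mu setT (k a) - Rintegral nu setT (k a) =
              Rintegral mu setT (k b) - Rintegral nu setT (k b).
Proof.
move=> bk bl hk hl.
apply: (@quadratic_const (fun s => Rintegral mu setT (k s) - Rintegral nu setT (k s)) (2 * C)).
move=> s h.
have bZ : bmeas (fun t => h * l s t) by exact: bmeasZ.
have bd (f g : R -> R) : bmeas f -> bmeas g -> bmeas (fun t => f t - g t).
  move=> [mf [K hK]] [mg [L hL]]; split; first exact: measurable_funB.
  by exists (K + L) => t; apply: le_trans (ler_normB _ _) _; rewrite lerD.
have bkd : bmeas (fun t => k (s + h) t - k s t) by exact: bd.
have e (m : probability R R) : `|Rintegral m setT (k (s + h)) - Rintegral m setT (k s) - h * Rintegral m setT (l s)| <= C * h ^+ 2.
  rewrite -Rint_Zl // -!RintegralB //; try exact: bmeas_integrable.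
  by apply: Rint_bound; [exact: bd | exact: hk].
have := e mu; have := e nu; rewrite hl.
by rewrite !ler_norml; lra.
Qed.

End Uniqueness.

(** * Inversion formulas *)

Section Inversion.
Local Open Scope complex_scope.
Variable R : realType.
Implicit Types (mu nu : probability R R) (z w : R[i]) (f g : R -> R) (a b c x y r : R).

Lemma cvgn_unique (u : nat -> R) (l l' : R) : u @ \oo --> l -> u @ \oo --> l' -> l = l'.
Proof. by move=> h h'; exact: (cvg_unique _ h h'). Qed.

Lemma cvgn_sub (u v : nat -> R) (a b : R) : u @ \oo --> a -> v @ \oo --> b ->
  (fun n => u n - v n) @ \oo --> a - b.
Proof. by move=> h h'; exact: cvgB. Qed.

Definition Sg mu c : R := Rintegral mu setT (fun t => Num.sg (t - c)).

Lemma Sg_lim mu (c : nat -> R) (l : R) :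
  (forall x, (fun n => Num.sg (x - c n)) @ \oo --> l) ->
  (fun n => Sg mu (c n)) @ \oo --> l.
Proof.
move=> h; rewrite -[X in _ --> X](Rint_cst mu).
apply: (@Rint_dct _ mu (fun n t => Num.sg (t - c n)) (fun=> l) 1) => //.
  by move=> n; exact: (sgr_bmeas _).1.
by move=> n x; rewrite normr_sg; case: (_ == _).
Qed.

(** The common difference is found at $c\to-\infty$, where both integrals tend to 1. *)
Lemma measure_eq_Sg mu nu :
  (forall a b, Sg mu a - Sg nu a = Sg mu b - Sg nu b) ->
  forall A : set R, measurable A -> mu A = nu A.
Proof.
move=> h; apply: measure_eq_sgr => c.
have hl m : (fun n : nat => Sg m (- n%:R)) @ \oo --> (1 : R).
  apply: Sg_lim => x; apply: cvgn_near_eq.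
  have [K hK] := archi_nat (- x).
  exists K => n Kn; rewrite gtr0_sg // opprK.
  have : K%:R <= n%:R :> R by rewrite ler_nat.
  lra.
have : (fun n : nat => Sg mu (- n%:R) - Sg nu (- n%:R)) @ \oo --> (1 - 1 : R).
  by apply: cvgB; exact: hl.
have -> : (fun n : nat => Sg mu (- n%:R) - Sg nu (- n%:R)) = (fun=> Sg mu c - Sg nu c).
  by apply: funext => n; exact: h.
move=> /cvgn_unique /(_ (cvg_cst _)); rewrite subrr => /esym/eqP.
by rewrite subr_eq0 => /eqP.
Qed.

Lemma taylor2 (f df : R -> R) (L : R) : (forall x, is_derive x 1 f (df x)) ->
  (forall x y, `|df x - df y| <= L * `|x - y|) ->
  forall x h, `|f (x + h) - f x - h * df x| <= L * h ^+ 2.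
Proof.
move=> hd hL.
have L0 : 0 <= L by have := hL 1 0; rewrite subr0 normr1 mulr1; apply: le_trans.
have key c x h : `|c - x| <= `|h| -> `|h * df c - h * df x| <= L * h ^+ 2.
  move=> cx; rewrite -mulrBr normrM -[h ^+ 2]real_normK ?num_real // expr2 mulrCA.
  by rewrite ler_wpM2l //; apply: le_trans (hL _ _) _; rewrite ler_wpM2l.
move=> x h; have [h0|h0|->] := ltgtP h 0.
- have [|c [/andP[c1 c2] e]] := @MVT_everywhere R f df (x + h) x _ hd; first lra.
  have -> : f (x + h) - f x - h * df x = h * df c - h * df x.
    have -> : f (x + h) = f x - df c * (x - (x + h)) by rewrite -e; ring.
    ring.
  by apply: key; rewrite (ltr0_norm h0) ler_norml; lra.
- have [|c [/andP[c1 c2] e]] := @MVT_everywhere R f df x (x + h) _ hd; first lra.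
  have -> : f (x + h) - f x - h * df x = h * df c - h * df x by rewrite e; ring.
  by apply: key; rewrite (gtr0_norm h0) ler_norml; lra.
- by rewrite addr0 subrr mul0r subr0 normr0 expr0n mulr0.
Qed.

Lemma atan_taylor2 x h : `|atan (x + h) - atan x - h * (1 + x ^+ 2)^-1| <= h ^+ 2.
Proof.
rewrite -[leRHS]mul1r; apply: (@taylor2 atan (fun x => (1 + x ^+ 2)^-1) 1).
move=> y z; rewrite mul1r.
have y0 : 0 < 1 + y ^+ 2 by rewrite ltr_pwDl ?sqr_ge0.
have z0 : 0 < 1 + z ^+ 2 by rewrite ltr_pwDl ?sqr_ge0.
have -> : (1 + y ^+ 2)^-1 - (1 + z ^+ 2)^-1 =
    (z - y) * ((z + y) / ((1 + y ^+ 2) * (1 + z ^+ 2))).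
  by field; rewrite !gt_eqF.
rewrite normrM distrC ler_piMr // normrM normfV (gtr0_norm (mulr_gt0 y0 z0)).
rewrite ler_pdivrMr ?mulr_gt0 // mul1r ler_norml.
have := sqr_ge0 (y * z); rewrite exprMn.
have := sqr_ge0 (y - 1 / 2); have := sqr_ge0 (y + 1 / 2).
have := sqr_ge0 (z - 1 / 2); have := sqr_ge0 (z + 1 / 2).
by move=> *; apply/andP; split; nra.
Qed.

Lemma atan_bound x : `|atan x| <= pi / 2.
Proof. by rewrite ler_norml !ltW ?atan_ltpi2 ?atan_gtNpi2. Qed.

Lemma atan_lim (y : R) : (fun n : nat => atan (y * n.+1%:R)) @ \oo --> pi / 2 * Num.sg y.
Proof.
wlog y0 : y / 0 < y.
  move=> h; have [y0|y0|<-] := ltgtP 0 y; first exact: h.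
    have -> : (fun n : nat => atan (y * n.+1%:R)) = (fun n => - atan (- y * n.+1%:R)).
      by apply: funext => n; rewrite mulNr atanN opprK.
    rewrite -[X in _ --> X]opprK -mulrN -sgrN; apply: cvgN.
    by apply: h; rewrite oppr_gt0.
  rewrite sgr0 mulr0; apply: cvgn_near_eq; exists 0%N => n _.
  by rewrite mul0r atan0.
rewrite gtr0_sg // mulr1; apply/cvgn_epsP => e e0.
have /cvgrPdist_le /(_ _ e0) [M [_ hM]] := @cvgy_atan R.
have [K hK] := archi_nat (M / y).
exists K => n Kn; rewrite distrC; apply: hM.
rewrite ltr_pdivrMr // in hK; apply: lt_trans hK _.
by rewrite mulrC ltr_pM2l // ltr_nat ltnS.
Qed.

(** Stieltjes inversion: $\mathrm{Im}\,G(s+i/N)$ integrates the $s$-derivative of $\arctan((t-s)N)$,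
    so for equal $G$ the integrals of these kernels differ by a constant in [s], and $N\to\infty$
    turns the kernels into $\frac\pi2\mathrm{sg}(t-s)$. *)
Lemma cauchyG_inj mu nu : (forall z, 0 < Im z -> cauchyG mu z = cauchyG nu z) ->
  forall A : set R, measurable A -> mu A = nu A.
Proof.
move=> hG; apply: measure_eq_Sg => a b.
pose k (n : nat) s t : R := atan ((t - s) * n.+1%:R).
pose l (n : nat) s t : R := - n.+1%:R * (1 + ((t - s) * n.+1%:R) ^+ 2)^-1.
have bk n s : bmeas (k n s).
  split; last by exists (pi / 2) => t; exact: atan_bound.
  apply: (measurableT_comp (f := @atan R)).
    by apply: continuous_measurable_fun => x; exact: continuous_atan.
  by apply: measurable_funM => //; exact: measurable_funB.
have zn n s : 0 < Im (Complex s (n.+1%:R^-1 : R)) by rewrite /= invr_gt0.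
have lE n s t : l n s t = Im ((Complex s (n.+1%:R^-1) - t%:C)^-1).
  rewrite cImV cReB cImB /= subr0 /l.
  have : 0 < n.+1%:R :> R by []; move: (n.+1%:R) => N N0.
  by field; rewrite (gt_eqF N0) gt_eqF // addrC ltr_pwDl // sqr_ge0.
have bl n s : bmeas (l n s).
  have -> : l n s = (fun t => Im ((Complex s (n.+1%:R^-1) - t%:C)^-1)).
    by apply: funext => t; exact: lE.
  exact: bcmeas_Im (cauchy_bcmeas (zn n s)).
have hk n : Rintegral mu setT (k n a) - Rintegral nu setT (k n a) =
            Rintegral mu setT (k n b) - Rintegral nu setT (k n b).
  apply: (@kernel_primitive _ mu nu (k n) (l n) (n.+1%:R ^+ 2)) => //.
    move=> s h t; rewrite /k /l.
    have -> : (t - (s + h)) * n.+1%:R = (t - s) * n.+1%:R + (- h * n.+1%:R) by ring.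
    have := atan_taylor2 ((t - s) * n.+1%:R) (- h * n.+1%:R).
    move: (n.+1%:R) => N hN; apply: le_trans (le_trans _ hN) _.
      by rewrite le_eqVlt; apply/orP; left; apply/eqP; congr `|_|; ring.
    by rewrite le_eqVlt; apply/orP; left; apply/eqP; ring.
  move=> s; have := congr1 Im (hG _ (zn n s)); rewrite /cauchyG /= => e.
  by rewrite (Rint_eq mu (lE n s)) (Rint_eq nu (lE n s)).
have lim (m : probability R R) s : (fun n => Rintegral m setT (k n s)) @ \oo --> pi / 2 * Sg m s.
  rewrite /Sg -Rint_Zl; last exact: sgr_bmeas.
  apply: (@Rint_dct _ m (fun n => k n s) _ (pi / 2)).
  - by move=> n; exact: (bk n s).1.
  - by apply: measurable_funM => //; exact: (sgr_bmeas _).1.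
  - by move=> n x; exact: atan_bound.
  - by move=> x; exact: atan_lim.
have h1 := cvgn_sub (lim mu a) (lim nu a); have h2 := cvgn_sub (lim mu b) (lim nu b).
have e : (fun n => Rintegral mu setT (k n a) - Rintegral nu setT (k n a)) =
   (fun n => Rintegral mu setT (k n b) - Rintegral nu setT (k n b)).
  by apply: funext => n; exact: hk.
rewrite e in h1; have := cvgn_unique h1 h2.
by rewrite -!mulrBr => /mulfI; apply; rewrite // gt_eqF // divr_gt0 ?pi_gt0.
Qed.

(** The two integrands differ by at most a multiple of the indicator of the complement, which is a
    null set. *)
Lemma Rint_circ nu f : circ nu -> bmeas f ->
  Rintegral nu setT (fun t => \1_(@angle_dom R) t * f t) = Rintegral nu setT f.
Proof.
move=> cn [mf [K hK]].
have mdom : measurable (@angle_dom R) by exact: measurable_itv.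
have mi : measurable_fun setT (\1_(@angle_dom R) : R -> R) by apply: measurable_indic.
have i01 t : 0 <= (\1_(@angle_dom R) t : R) <= 1.
  by rewrite indicE; case: (_ \in _); rewrite /= ?ler01 ?lexx.
have bi : bmeas (\1_(@angle_dom R) : R -> R).
  by split => //; exists 1 => t; have /andP[a b] := i01 t; rewrite ger0_norm.
have bf : bmeas f by split => //; exists K.
have bif : bmeas (fun t => \1_(@angle_dom R) t * f t).
  split; first exact: measurable_funM.
  exists K => t; rewrite normrM; apply: le_trans (hK t).
  by have /andP[a b] := i01 t; rewrite ler_piMl // ger0_norm.
have i1 : Rintegral nu setT (\1_(@angle_dom R)) = 1.
  by rewrite /Rintegral integral_indic // setIT; transitivity (fine (1%E : \bar R)) => //; congr fine; exact: cn.
have K0 : 0 <= K by apply: le_trans (hK 0).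
have bd : bmeas (fun t => K * (1 - \1_(@angle_dom R) t)).
  apply: bmeasZ; split; first exact: measurable_funB.
  by exists 1 => t; have /andP[a b] := i01 t; rewrite ger0_norm ?subr_ge0 // lerBlDr lerDl.
have d0 : Rintegral nu setT (fun t => K * (1 - \1_(@angle_dom R) t)) = 0.
  rewrite Rint_Zl.
    rewrite RintegralB //; last 2 first.
    - by apply: bmeas_integrable; split => //; exists `|1 : R|.
    - exact: bmeas_integrable.
    by rewrite Rint_cst i1 subrr mulr0.
  split; first exact: measurable_funB.
  by exists 1 => t; have /andP[a b] := i01 t; rewrite ger0_norm ?subr_ge0 // lerBlDr lerDl.
have bdf : bmeas (fun t => f t - \1_(@angle_dom R) t * f t).
  split; first by apply: measurable_funB => //; exact: bif.1.
  by case: bif => _ [L hL]; exists (K + L) => t; apply: le_trans (ler_normB _ _) _; rewrite lerD.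
have hle t : `|f t - \1_(@angle_dom R) t * f t| <= K * (1 - \1_(@angle_dom R) t).
  have /andP[a b] := i01 t.
  have -> : f t - \1_(@angle_dom R) t * f t = f t * (1 - \1_(@angle_dom R) t) by ring.
  by rewrite normrM (@ger0_norm _ (1 - _)) ?subr_ge0 // ler_wpM2r // subr_ge0.
apply/esym/eqP; rewrite -subr_eq0 -RintegralB //; try exact: bmeas_integrable.
rewrite -normr_le0; apply: le_trans (le_normr_Rintegral _ (bmeas_integrable nu bdf)) _ => //.
rewrite -d0; apply: Rint_le => //.
case: bdf => m [L hL]; split; first exact: measurableT_comp.
by exists L => t; rewrite normr_id.
Qed.

Lemma circ_Sg nu c : circ nu -> Sg nu c =
  Rintegral nu setT (fun t => \1_(@angle_dom R) t * Num.sg (t - c)).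
Proof. by move=> cn; rewrite Rint_circ //; exact: sgr_bmeas. Qed.

Lemma circ_Sg_neg nu c : circ nu -> c < 0 -> Sg nu c = 1.
Proof.
move=> cn c0; rewrite circ_Sg // -[RHS](Rint_cst nu) -[in RHS]Rint_circ //; last first.
  by split => //; exists 1 => _; rewrite normr1.
apply: Rint_eq => t; rewrite indicE; have [/set_mem|_] := boolP (t \in _); last by rewrite !mul0r.
rewrite /angle_dom /= in_itv /= => /andP[t0 _]; rewrite gtr0_sg //; lra.
Qed.

Lemma circ_Sg_big nu c : circ nu -> 2 * pi <= c -> Sg nu c = - 1.
Proof.
move=> cn c0; rewrite circ_Sg // -[RHS](Rint_cst nu) -[in RHS]Rint_circ //; last first.
  by split => //; exists 1 => _; rewrite normrN normr1.
apply: Rint_eq => t; rewrite indicE; have [/set_mem|_] := boolP (t \in _); last by rewrite !mul0r.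
rewrite /angle_dom /= in_itv /= => /andP[_ t0]; rewrite ltr0_sg //; lra.
Qed.

(* [- satan r x] is the argument of [1 - r e^{ix}]; as [r] tends to [1] it
   tends to the sawtooth wave [(x - pi)/2] on [(0, 2 pi)]. *)
Definition satan r x : R := atan (r * sin x / (1 - r * cos x)).

(** The derivative of [satan], written as the real part of the kernel of [psi]; this is how [psi]
    controls the integrals of [satan]. *)
Definition dsatan r x : R := Re (r%:C * zeta x / (1 - r%:C * zeta x)).

Lemma satan_den r x : 0 <= r < 1 -> 0 < 1 - r * cos x.
Proof.
move=> /andP[r0 r1]; rewrite subr_gt0; apply: le_lt_trans r1.
by rewrite ler_piMr // cos_le1.
Qed.

Lemma is_derive_satan r x : 0 <= r < 1 -> is_derive x 1 (satan r) (dsatan r x).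
Proof.
move=> r01; have d0 := satan_den x r01.
have n0 : 1 - r * cos x != 0 by rewrite gt_eqF.
have h1 : is_derive x 1 (fun x => 1 - r * cos x) (r * sin x).
  by apply: is_derive_eq; rewrite /GRing.scale /=; ring.
have h2 : is_derive x 1 (fun x => (1 - r * cos x)^-1) (- (1 - r * cos x) ^- 2 * (r * sin x)).
  by apply: is_derive_eq; rewrite /GRing.scale /=; ring.
have h3 : is_derive x 1 (fun x => r * sin x / (1 - r * cos x))
  ((r * cos x - r ^+ 2) / (1 - r * cos x) ^+ 2).
  apply: is_derive_eq; rewrite /GRing.scale /=.
  have := cos2Dsin2 x; set C := cos x in n0 *; set S := sin x => e.
  have -> : r * C - r ^+ 2 = r * C - r ^+ 2 * (C ^+ 2 + S ^+ 2) by rewrite e; ring.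
  by field.
apply: is_derive_eq; rewrite /GRing.scale /=.
have := cos2Dsin2 x; set C := cos x in n0 d0 *; set S := sin x => e.
have n1 : (1 - r * C) ^+ 2 + (r * S) ^+ 2 != 0.
  by rewrite gt_eqF // ltr_pwDl ?sqr_ge0 // exprn_gt0.
have -> : dsatan r x = (r * C * (1 - r * C) - r * S * (r * S)) / ((1 - r * C) ^+ 2 + (r * S) ^+ 2).
  rewrite /dsatan cReM cReV cImV !cReB !cImB !cReZ !cImZ /= -/C -/S sub0r sqrrN; field.
  exact: n1.
have -> : r * C - r ^+ 2 = r * C - r ^+ 2 * (C ^+ 2 + S ^+ 2) by rewrite e; ring.
by field; rewrite n0 n1.
Qed.

Lemma cabs_zetaB x y : cabs (zeta x - zeta y) <= 2 * `|x - y|.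
Proof.
have -> : zeta x - zeta y = zeta y * (zeta (x - y) - 1).
  rewrite -!cei_zeta rmorphB ceiB; field; exact: cei_neq0.
rewrite cabsM cabs_zeta mul1r; apply: le_trans (cabs_ReIm _) _.
rewrite cReB cImB /= subr0 mulr_natl mulr2n lerD ?normr_sin_le //.
by rewrite distrC ger0_norm ?onemcos_le //; have /andP[] := onemcos_le_sqr (x - y).
Qed.

Lemma dsatan_lip r x y : 0 <= r < 1 ->
  `|dsatan r x - dsatan r y| <= 2 / (1 - r) ^+ 2 * `|x - y|.
Proof.
move=> /andP[r0 r1]; rewrite -cReB; apply: le_trans (normRe_cabs _) _.
have cr : cabs (r%:C : R[i]) = r by rewrite cabsR ger0_norm.
have cr1 : cabs (r%:C : R[i]) < 1 by rewrite cr.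
have nx := disk_neq0 x cr1; have ny := disk_neq0 y cr1.
have lx := disk_low x cr1; have ly := disk_low y cr1.
rewrite cr in lx ly.
have -> : r%:C * zeta x / (1 - r%:C * zeta x) - r%:C * zeta y / (1 - r%:C * zeta y) =
  r%:C * (zeta x - zeta y) / ((1 - r%:C * zeta x) * (1 - r%:C * zeta y)).
  by field; rewrite nx ny.
have r10 : 0 < 1 - r by rewrite subr_gt0.
rewrite cabs_div !cabsM cr [leRHS]mulrAC; apply: ler_pM; rewrite ?mulr_ge0 ?cabs_ge0 ?invr_ge0 //.
- by rewrite mulr_ge0 ?cabs_ge0.
- by apply: le_trans (cabs_zetaB x y); rewrite ler_piMl ?cabs_ge0 // ltW.
rewrite lef_pV2 ?posrE ?exprn_gt0 // ?mulr_gt0 ?cabs_gt0 //.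
by rewrite expr2; apply: ler_pM => //; exact: ltW.
Qed.

Lemma satan_lim x : - (2 * pi) < x < 2 * pi ->
  (fun n : nat => satan (1 - n.+2%:R^-1) x) @ \oo --> (pi * Num.sg x - x) / 2.
Proof.
have satanN r y : satan r (- y) = - satan r y.
  by rewrite /satan sinN cosN mulrN mulNr atanN.
wlog x0 : x / 0 < x.
  move=> h /andP[a b]; have [x0|x0|<-] := ltgtP 0 x; first by apply: h => //; rewrite a.
    have -> : (fun n : nat => satan (1 - n.+2%:R^-1) x) = (fun n => - satan (1 - n.+2%:R^-1) (- x)).
      by apply: funext => n; rewrite satanN opprK.
    have -> : (pi * Num.sg x - x) / 2 = - ((pi * Num.sg (- x) - (- x)) / 2).
      by rewrite sgrN; ring.
    by apply: cvgN; apply: h; rewrite ?oppr_gt0 //; apply/andP; split; lra.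
  apply: cvgn_near_eq; exists 0%N => n _.
  by rewrite /satan sin0 mulr0 mul0r atan0 sgr0 mulr0 subr0 mul0r.
move=> /andP[_ x2]; rewrite gtr0_sg // mulr1.
(* One has $\sin x/(1-\cos x)=\cot(x/2)=\tan p$, with $p$ in the range where $\arctan$ inverts
   $\tan$. *)
pose p := (pi - x) / 2.
have p0 : - (pi / 2) < p < pi / 2 by rewrite /p; apply/andP; split; lra.
have cp : 0 < cos p by exact: cos_gt0_pihalf.
have xE : x = pi - p *+ 2 by rewrite /p -mulr_natr; field.
have sE : sin x = 2 * cos p * sin p.
  rewrite xE sinB sinpi cospi sin_mulr2n -mulr_natr; ring.
have cE : 1 - cos x = 2 * cos p ^+ 2.
  rewrite xE cosB sinpi cospi cos_mulr2n -mulr_natr; ring.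
have -> : (pi - x) / 2 = atan (sin x / (1 - cos x)).
  rewrite sE cE; have -> : 2 * cos p * sin p / (2 * cos p ^+ 2) = tan p.
    by rewrite /tan; field; rewrite gt_eqF.
  by rewrite tanK // in_itv.
have rl : (fun n : nat => 1 - n.+2%:R^-1 : R) @ \oo --> (1 - 0 : R).
  apply: cvgB; first exact: cvg_cst.
  apply/cvgn_epsP => e e0; have [K hK] := archi_nat e^-1.
  exists K => n Kn; rewrite subr0 ger0_norm // invf_ple ?posrE //.
  by apply: le_trans (ltW hK) _; rewrite ler_nat ltnW // ltnW.
rewrite subr0 in rl.
have nz : 1 - 1 * cos x != 0 by rewrite mul1r cE gt_eqF // mulr_gt0 // exprn_gt0.
apply: (@continuous_cvg _ _ _ \oo _ (fun n : nat => (1 - n.+2%:R^-1) * sin x / (1 - (1 - n.+2%:R^-1) * cos x)) atan).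
  exact: continuous_atan.
have -> : sin x / (1 - cos x) = 1 * sin x / (1 - 1 * cos x) by rewrite !mul1r.
apply: cvgM; first by apply: cvgM => //; exact: cvg_cst.
apply: cvgV => //; apply: cvgB; first exact: cvg_cst.
by apply: cvgM => //; exact: cvg_cst.
Qed.

Lemma satan_bmeas r c : 0 <= r < 1 -> bmeas (fun t => satan r (t - c)).
Proof.
move=> r01; have cs : continuous (satan r).
  move=> x; apply/differentiable_continuous/derivable1_diffP.
  by have [] := is_derive_satan x r01.
split; last by exists (pi / 2) => t; exact: atan_bound.
apply: (measurableT_comp (f := satan r)); first exact: continuous_measurable_fun.
exact: measurable_funB.
Qed.

(** Poisson inversion on the circle, parallel to [cauchyG_inj]. The limiting kernel is the sawtooth
    $(\pi\,\mathrm{sg}(t-c)-(t-c))/2$, whose linear part contributes a first moment independent of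
    [c] and a term in [c] common to both measures. Hence the difference of the sign integrals is
    constant on $[0,2\pi)$. *)
Lemma psi_inj nu nu' : circ nu -> circ nu' ->
  (forall w, cabs w < 1 -> psi nu w = psi nu' w) ->
  forall A : set R, measurable A -> nu A = nu' A.
Proof.
move=> cn cn' hpsi.
pose rn (n : nat) : R := 1 - n.+2%:R^-1.
have rn01 n : 0 <= rn n < 1.
  by rewrite /rn subr_ge0 invf_le1 // ler1n /= ltrBlDr ltrDl invr_gt0.
pose k n s t := satan (rn n) (t - s).
pose l n s t := -1 * dsatan (rn n) (t - s).
have crn n s : cabs ((rn n)%:C * zeta (- s)) < 1.
  by have /andP[a b] := rn01 n; rewrite cabs_mul_zeta cabsR ger0_norm.
have lE n s t : dsatan (rn n) (t - s) = Re (disk_ker ((rn n)%:C * zeta (- s)) t).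
  rewrite /dsatan /disk_ker.
  have -> : (rn n)%:C * zeta (- s) * zeta t = (rn n)%:C * zeta (t - s).
    by rewrite -mulrA -!cei_zeta -ceiD -rmorphD [- s + t]addrC.
  by [].
have bds n s : bmeas (fun t => dsatan (rn n) (t - s)).
  have -> : (fun t => dsatan (rn n) (t - s)) = (fun t => Re (disk_ker ((rn n)%:C * zeta (- s)) t)).
    by apply: funext => t; exact: lE.
  exact: bcmeas_Re (bcmeas_disk_ker (crn n s)).
have hk n a b : Rintegral nu setT (k n a) - Rintegral nu' setT (k n a) =
            Rintegral nu setT (k n b) - Rintegral nu' setT (k n b).
  apply: (@kernel_primitive _ nu nu' (k n) (l n) (2 / (1 - rn n) ^+ 2)).
  - by move=> s; exact: satan_bmeas.
  - by move=> s; exact: bmeasZ.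
  - move=> s h t; rewrite /k /l.
    have := @taylor2 (satan (rn n)) (dsatan (rn n)) _ (fun x => is_derive_satan x (rn01 n))
      (fun x y => dsatan_lip x y (rn01 n)) (t - s) (- h).
    rewrite sqrrN; have -> : t - s - h = t - (s + h) by ring.
    by have -> : - h * dsatan (rn n) (t - s) = h * (-1 * dsatan (rn n) (t - s)) by ring.
  move=> s; rewrite !Rint_Zl //; congr (_ * _).
  rewrite (Rint_eq nu (lE n s)) (Rint_eq nu' (lE n s)).
  by have := congr1 (@complex.Re R) (hpsi _ (crn n s)).
have mi : measurable_fun setT (\1_(@angle_dom R) : R -> R).
  by apply: measurable_indic; exact: measurable_itv.
have p2 : 0 < 2 * pi :> R by rewrite mulr_gt0 // pi_gt0.
pose T (m : probability R R) := Rintegral m setT (fun t => \1_(@angle_dom R) t * t).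
have bT : bmeas (fun t => \1_(@angle_dom R) t * t).
  split; first exact: measurable_funM.
  exists (2 * pi) => t; rewrite indicE; have [/set_mem|_] := boolP (t \in _); last first.
    by rewrite mul0r normr0 ltW.
  rewrite /angle_dom /= in_itv /= => /andP[t0 t1]; rewrite mul1r ger0_norm //; exact: ltW.
have lim (m : probability R R) c : circ m -> 0 <= c < 2 * pi ->
    (fun n => Rintegral m setT (k n c)) @ \oo --> pi / 2 * Sg m c - (T m - c) / 2.
  move=> cm /andP[c0 c1].
  have bS : bmeas (fun t => pi / 2 * Num.sg (t - c)) by apply: bmeasZ; exact: sgr_bmeas.
  have bS' : bmeas (fun t => pi / 2 * Num.sg (t - c) + c / 2).
    case: bS => mS [L hL]; split; first exact: measurable_funD.
    by exists (L + `|c / 2|) => t; apply: le_trans (ler_normD _ _) _; rewrite lerD.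
  have biS : bmeas (fun t => \1_(@angle_dom R) t * (pi / 2 * Num.sg (t - c) + c / 2)).
    case: bS' => mS [L hL]; split; first exact: measurable_funM.
    exists L => t; rewrite normrM; apply: le_trans (hL t).
    by rewrite ler_piMl // indicE; case: (_ \in _); rewrite ?normr1 ?normr0.
  have -> : pi / 2 * Sg m c - (T m - c) / 2 =
     Rintegral m setT (fun t => \1_(@angle_dom R) t * (pi / 2 * Num.sg (t - c) + c / 2) -
        2^-1 * (\1_(@angle_dom R) t * t)).
    rewrite RintegralB //; last 2 first.
    - exact: bmeas_integrable.
    - by apply: bmeas_integrable; exact: bmeasZ.
    rewrite Rint_circ // RintegralD //; last 2 first.
    - exact: bmeas_integrable.
    - by apply: bmeas_integrable; split => //; exists `|c / 2|.
    rewrite Rint_cst !Rint_Zl //; last exact: sgr_bmeas.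
    by rewrite -/(Sg m c) -/(T m); ring.
  under eq_fun => n do rewrite -(Rint_circ cm (satan_bmeas c (rn01 n))).
  apply: (@Rint_dct _ m (fun n t => \1_(@angle_dom R) t * satan (rn n) (t - c)) _ (pi / 2)).
  - by move=> n; apply: measurable_funM => //; exact: (satan_bmeas c (rn01 n)).1.
  - apply: measurable_funB; first exact: biS.1.
    by apply: measurable_funM => //; exact: bT.1.
  - move=> n t; rewrite normrM.
    have hb : `|satan (rn n) (t - c)| <= pi / 2 by exact: atan_bound.
    apply: le_trans hb.
    by rewrite ler_piMl // indicE; case: (_ \in _); rewrite ?normr1 ?normr0.
  move=> t; rewrite indicE; have [/set_mem|_] := boolP (t \in _); last first.
    apply: cvgn_near_eq; exists 0%N => n _; rewrite !mul0r; ring.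
  rewrite /angle_dom /= in_itv /= => /andP[t0 t1].
  have -> : true%:R * (pi / 2 * Num.sg (t - c) + c / 2) - 2^-1 * (true%:R * t) =
    true%:R * ((pi * Num.sg (t - c) - (t - c)) / 2) :> R by rewrite /=; ring.
  apply: cvgM; first exact: cvg_cst.
  by apply: satan_lim; apply/andP; split; lra.
have main a b : 0 <= a < 2 * pi -> 0 <= b < 2 * pi ->
    Sg nu a - Sg nu' a = Sg nu b - Sg nu' b.
  move=> ha hb.
  have h1 := cvgn_sub (lim nu a cn ha) (lim nu' a cn' ha).
  have h2 := cvgn_sub (lim nu b cn hb) (lim nu' b cn' hb).
  have e : (fun n => Rintegral nu setT (k n a) - Rintegral nu' setT (k n a)) =
   (fun n => Rintegral nu setT (k n b) - Rintegral nu' setT (k n b)).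
    by apply: funext => n; exact: hk.
  rewrite e in h1; have := cvgn_unique h1 h2 => h3.
  apply: (@mulfI _ (pi / 2)); first by rewrite gt_eqF // divr_gt0 ?pi_gt0.
  by move: h3; set A := Sg _ _; set B := Sg _ _; set C := Sg _ _; set D := Sg _ _; lra.
(* Outside $[0,2\pi)$ the sign integrals are $\pm1$ for every circle measure. As the base point
   tends to $2\pi$ from the left both tend to $-1$, so the constant difference inside is $0$. *)
have zero a : Sg nu a - Sg nu' a = 0.
  have [a0|a0] := ltP a 0; first by rewrite !circ_Sg_neg // subrr.
  have [a1|a1] := ltP a (2 * pi); last by rewrite !circ_Sg_big // subrr.
  have hl m : circ m -> (fun n : nat => Sg m (2 * pi * rn n)) @ \oo --> (-1 : R).
    move=> cm; under eq_fun do rewrite circ_Sg //.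
    have -> : -1 = Rintegral m setT (fun t => \1_(@angle_dom R) t * -1) :> R.
      rewrite Rint_circ ?Rint_cst //; split => //; exists 1 => _; rewrite normrN normr1 //.
    apply: (@Rint_dct _ m (fun n t => \1_(@angle_dom R) t * Num.sg (t - 2 * pi * rn n)) _ 1).
    - by move=> n; apply: measurable_funM => //; exact: (sgr_bmeas _).1.
    - exact: measurable_funM.
    - move=> n t; rewrite normrM normr_sg indicE.
      by case: (_ \in _); case: (_ == _); rewrite ?normr1 ?normr0 ?mulr1 ?mulr0.
    move=> t; rewrite indicE; have [/set_mem|_] := boolP (t \in _); last first.
      by apply: cvgn_near_eq; exists 0%N => n _; rewrite !mul0r.
    rewrite /angle_dom /= in_itv /= => /andP[t0 t1].
    have d0 : 0 < 1 - t / (2 * pi) by rewrite subr_gt0 ltr_pdivrMr // mul1r.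
    have [K hK] := archi_nat (1 - t / (2 * pi))^-1.
    apply: cvgn_near_eq; exists K => n Kn; rewrite !mul1r ltr0_sg //.
    have : n.+2%:R^-1 < 1 - t / (2 * pi).
      rewrite invf_plt ?posrE //; apply: lt_le_trans hK _; rewrite ler_nat.
      exact: leqW (leqW Kn).
    rewrite ltrBrDr addrC -ltrBrDr => h.
    by rewrite subr_lt0 mulrC -ltr_pdivrMr.
  have hc : (fun n : nat => Sg nu (2 * pi * rn n) - Sg nu' (2 * pi * rn n)) @ \oo --> (-1 - -1 : R).
    by apply: cvgB; exact: hl.
  have e : (fun n : nat => Sg nu (2 * pi * rn n) - Sg nu' (2 * pi * rn n)) = (fun=> Sg nu a - Sg nu' a).
    apply: funext => n; apply: main; last by rewrite a0.
    have /andP[r0 r1] := rn01 n.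
    by rewrite mulr_ge0 ?(ltW p2) //= -[ltRHS]mulr1 ltr_pM2l.
  rewrite e in hc; have := cvgn_unique hc (cvg_cst _) => <-.
  by rewrite subrr.
by apply: measure_eq_Sg => a b; rewrite !zero.
Qed.

End Inversion.

(** * Power series and the identity theorem *)

Section PowerSeries.
Local Open Scope complex_scope.
Variable R : realType.
Implicit Types (mu nu : probability R R) (z w : R[i]) (f g : R[i] -> R[i]) (r s K : R)
  (a b : nat -> R[i]).

Definition psum a N w : R[i] := \sum_(n < N) a n * w ^+ n.

(* The geometric remainder bound encodes both the Taylor expansion of [f] at [0]
   and its convergence in the disc of radius [r]. *)
Definition has_ps f r := exists a, forall s, 0 < s < r -> exists K, forall N w,
  cabs w <= s -> cabs (f w - psum a N w) <= K * (cabs w / s) ^+ N.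

Lemma psum0 a w : psum a 0 w = 0.
Proof. exact: big_ord0. Qed.

Lemma psum_recr a N w : psum a N.+1 w = psum a N w + a N * w ^+ N.
Proof. by rewrite /psum big_ord_recr. Qed.

Lemma ps_bound_ge0 f a s K : 0 < s ->
  (forall N w, cabs w <= s -> cabs (f w - psum a N w) <= K * (cabs w / s) ^+ N) -> 0 <= K.
Proof.
move=> s0 h; have := h 0%N 0; rewrite cabs0 => /(_ (ltW s0)).
by rewrite expr0 mulr1; apply: le_trans; exact: cabs_ge0.
Qed.

(** Two consecutive remainders at $w=s$ differ by $a_ns^n$. *)
Lemma ps_coef_bound f a s K : 0 < s ->
  (forall N w, cabs w <= s -> cabs (f w - psum a N w) <= K * (cabs w / s) ^+ N) ->
  forall n, cabs (a n) <= 2 * K * s ^- n.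
Proof.
move=> s0 h n; rewrite ler_pdivlMr ?exprn_gt0 //.
have cs : cabs (s%:C : R[i]) = s by rewrite cabsR gtr0_norm.
have := h n s%:C; have := h n.+1 s%:C.
rewrite cs divff ?gt_eqF // !expr1n !mulr1 => /(_ (lexx _)) h1 /(_ (lexx _)) h2.
have -> : cabs (a n) * s ^+ n = cabs (a n * s%:C ^+ n) by rewrite cabsM cabsX cs.
have -> : a n * s%:C ^+ n = (f s%:C - psum a n s%:C) - (f s%:C - psum a n.+1 s%:C).
  by rewrite psum_recr; ring.
by apply: le_trans (cabsB _ _) _; lra.
Qed.

Lemma expr_lt1_small r e : 0 <= r < 1 -> 0 < e -> exists N, r ^+ N <= e.
Proof.
move=> /andP[r0 r1] e0.
have [->|rn] := eqVneq r 0; first by exists 1%N; rewrite expr1 ltW.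
have {rn}r0 : 0 < r by rewrite lt_def rn.
have d0 : 0 < r^-1 - 1 by rewrite subr_gt0 invf_gt1.
have [N hN] := archi_nat (e^-1 / (r^-1 - 1)).
exists N; rewrite -[r]invrK exprVn invf_ple ?posrE ?exprn_gt0 ?invr_gt0 //.
rewrite ltr_pdivrMr // in hN; apply: le_trans (ltW hN) _.
have -> : r^-1 = 1 + (r^-1 - 1) by ring.
set d := r^-1 - 1 in d0 *; have -> : 1 + d - 1 = d by ring.
have : 1 + N%:R * d <= (1 + d) ^+ N.
  elim: N {hN} => [|N IH]; first by rewrite mul0r addr0 expr0.
  rewrite exprS; apply: le_trans (ler_wpM2l _ IH); last by lra.
  have : 0 <= N%:R * d * d by rewrite !mulr_ge0 // ltW.
  by rewrite -[N.+1]addn1 natrD; lra.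
lra.
Qed.

(** Dividing the remainder bound by $|p|^n$ along zeros $p\to0$ kills the coefficients one after
    another; then the remainder alone bounds [f], and it tends to $0$ at every point of the disc. *)
Lemma ps_zero f r : 0 < r -> has_ps f r ->
  (forall d, 0 < d -> exists p, 0 < cabs p < d /\ f p = 0) ->
  forall w, cabs w < r -> f w = 0.
Proof.
move=> r0 [a ha] hz.
have r2 : 0 < r / 2 < r by apply/andP; split; lra.
have [K hK] := ha _ r2; have K0 := ps_bound_ge0 (proj1 (andP r2)) hK.
have a0 n : a n = 0.
  elim/ltn_ind: n => n IH.
  apply/eqP; rewrite -cabs_eq0; apply/eqP/le_anti; rewrite cabs_ge0 andbT.
  apply/ler_addgt0Pr => e e0; rewrite add0r.
  have s0 : 0 < r / 2 by lra.
  have sn : 0 < (r / 2) ^+ n.+1 by rewrite exprn_gt0.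
  have K1 : 0 < K + 1 by lra.
  (* So close to $0$ that $K|p|/(r/2)^{n+1}\le e$, the bound that remains for $|a_n|$. *)
  have [|p [/andP[p0 pd] fp]] := hz (Num.min (r / 2) (e * (r / 2) ^+ n.+1 / (K + 1))).
    by rewrite lt_min s0 divr_gt0 // mulr_gt0.
  move: pd; rewrite lt_min => /andP[pr pe].
  have pe' : cabs p * (K + 1) < e * (r / 2) ^+ n.+1 by rewrite -ltr_pdivlMr.
  have := hK n.+1 p (ltW pr); rewrite fp sub0r cabsN psum_recr.
  have -> : psum a n p = 0.
    by rewrite /psum big1 // => i _; rewrite IH // mul0r.
  rewrite add0r cabsM cabsX expr_div_n => h.
  have pn : 0 < cabs p ^+ n by rewrite exprn_gt0.
  rewrite -(ler_pM2r pn) -(ler_pM2r sn); apply: le_trans (ler_wpM2r (ltW sn) h) _.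
  rewrite mulrA divfK ?gt_eqF // exprS.
  have -> : K * (cabs p * cabs p ^+ n) = K * cabs p * cabs p ^+ n by ring.
  have -> : e * cabs p ^+ n * (r / 2) ^+ n.+1 = e * (r / 2) ^+ n.+1 * cabs p ^+ n by ring.
  rewrite ler_pM2r //; apply: le_trans (ltW pe'); rewrite mulrDr mulr1 mulrC lerDl ltW //.
move=> w wr; apply/eqP; rewrite -cabs_eq0; apply/eqP/le_anti; rewrite cabs_ge0 andbT.
apply/ler_addgt0Pr => e e0; rewrite add0r.
pose s := (cabs w + r) / 2; have cw := cabs_ge0 w.
have sr : 0 < s < r by rewrite /s; apply/andP; split; lra.
have [L hL] := ha _ sr; have L0 := ps_bound_ge0 (proj1 (andP sr)) hL.
have s0 : 0 < s by case/andP: sr.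
have q1 : 0 <= cabs w / s < 1.
  by rewrite divr_ge0 ?(ltW s0) //= ltr_pdivrMr // mul1r /s; lra.
have L1 : 0 < L + 1 by lra.
have [|N hN] := expr_lt1_small q1 (e := e / (L + 1)); first by rewrite divr_gt0.
have ws : cabs w <= s by rewrite /s; lra.
have := hL N w ws; rewrite /psum big1 ?subr0; last by move=> i _; rewrite a0 mul0r.
move=> h; apply: le_trans h _; apply: le_trans (ler_wpM2l L0 hN) _.
by rewrite mulrCA ler_piMr ?(ltW e0) // ler_pdivrMr // mul1r; lra.
Qed.

Lemma has_psB f g r : has_ps f r -> has_ps g r -> has_ps (fun w => f w - g w) r.
Proof.
move=> [a ha] [b hb]; exists (fun n => a n - b n) => s sr.
have [K hK] := ha s sr; have [L hL] := hb s sr.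
exists (K + L) => N w ws.
have -> : f w - g w - psum (fun n => a n - b n) N w = (f w - psum a N w) - (g w - psum b N w).
  have -> : psum (fun n => a n - b n) N w = psum a N w - psum b N w.
    by rewrite /psum -sumrB; apply: eq_bigr => i _; rewrite mulrBl.
  ring.
by apply: le_trans (cabsB _ _) _; rewrite mulrDl lerD ?hK ?hL.
Qed.

Lemma has_psZ (k : R[i]) f r : has_ps f r -> has_ps (fun w => k * f w) r.
Proof.
move=> [a ha]; exists (fun n => k * a n) => s sr.
have [K hK] := ha s sr.
exists (cabs k * K) => N w ws.
have -> : k * f w - psum (fun n => k * a n) N w = k * (f w - psum a N w).
  rewrite mulrBr /psum mulr_sumr; congr (_ - _); apply: eq_bigr => i _.
  by rewrite mulrA.
by rewrite cabsM -mulrA ler_wpM2l ?cabs_ge0 ?hK.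
Qed.

Definition conv a b n : R[i] := \sum_(j < n.+1) b j * a (n - j)%N.

Lemma psum_conv a b N w :
  psum (conv a b) N w = \sum_(j < N) b j * w ^+ j * psum a (N - j) w.
Proof.
elim: N => [|N IH]; first by rewrite /psum !big_ord0.
rewrite psum_recr {}IH.
have -> : \sum_(j < N.+1) b j * w ^+ j * psum a (N.+1 - j) w =
    \sum_(j < N.+1) (b j * w ^+ j * psum a (N - j) w + b j * a (N - j)%N * w ^+ N).
  apply: eq_bigr => j _; have jN : (j <= N)%N := ltn_ord j.
  rewrite subSn // psum_recr mulrDr; congr (_ + _).
  have -> : w ^+ N = w ^+ j * w ^+ (N - j) by rewrite -exprD subnKC.
  ring.
rewrite big_split /= -mulr_suml -/(conv a b N); congr (_ + _).
by rewrite big_ord_recr /= subnn psum0 mulr0 addr0.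
Qed.

Lemma poly_geom_bound r : 0 < r < 1 -> exists B, forall N, (2 * N%:R + 1) * r ^+ N <= B.
Proof.
move=> /andP[r0 r1]; have d0 : 0 < r^-1 - 1 by rewrite subr_gt0 invf_gt1.
exists (2 / (r^-1 - 1) + 1) => N.
rewrite -[r in r ^+ N]invrK exprVn ler_pdivrMr ?exprn_gt0 ?invr_gt0 //.
have -> : r^-1 ^+ N = (1 + (r^-1 - 1)) ^+ N by congr (_ ^+ _); ring.
set d := r^-1 - 1 in d0 *.
have h : 1 + N%:R * d <= (1 + d) ^+ N.
  elim: N => [|N IH]; first by rewrite mul0r addr0 expr0.
  rewrite exprS; apply: le_trans (ler_wpM2l _ IH); last by lra.
  have : 0 <= N%:R * d * d by rewrite !mulr_ge0 // ltW.
  by rewrite -[N.+1]addn1 natrD; lra.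
have c0 : 0 <= 2 / d + 1 by rewrite addr_ge0 // divr_ge0 // ltW.
apply: le_trans (ler_wpM2l c0 h).
have -> : (2 / d + 1) * (1 + N%:R * d) = 2 / d + 2 * N%:R + 1 + N%:R * d by field; rewrite gt_eqF.
have : 0 <= 2 / d by rewrite divr_ge0 // ltW.
have : 0 <= N%:R * d by rewrite mulr_ge0 // ltW.
lra.
Qed.

(** With partial sums $f_n$, $g_n$, the remainder is $\sum_{j<N}b_jw^j(f-f_{N-j})+f(g-g_N)$, bounded
    by a multiple of $(2N+1)q^N$ for $q=|w|/s'$. Taking $s<s'<r$ lets $(s/s')^N$ absorb the linear
    factor, by [poly_geom_bound]. *)
Lemma has_psM f g r : has_ps f r -> has_ps g r -> has_ps (fun w => f w * g w) r.
Proof.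
move=> [a ha] [b hb]; exists (conv a b) => s /andP[s0 sr].
pose s' := (s + r) / 2.
have s'r : 0 < s' < r by rewrite /s'; apply/andP; split; lra.
have s'0 : 0 < s' by case/andP: s'r.
have ss' : s < s' by rewrite /s'; lra.
have [K hK] := ha s' s'r; have [L hL] := hb s' s'r.
have K0 := ps_bound_ge0 s'0 hK; have L0 := ps_bound_ge0 s'0 hL.
have bL := ps_coef_bound s'0 hL.
have [|B hB] := @poly_geom_bound (s / s').
  by rewrite divr_gt0 //= ltr_pdivrMr // mul1r.
exists (K * L * B) => N w ws; have ws' : cabs w <= s' by lra.
set q := cabs w / s'; have q0 : 0 <= q by rewrite divr_ge0 ?cabs_ge0 // ltW.
have -> : f w * g w - psum (conv a b) N w =
    \sum_(j < N) b j * w ^+ j * (f w - psum a (N - j) w) + f w * (g w - psum b N w).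
  have -> : \sum_(j < N) b j * w ^+ j * (f w - psum a (N - j) w) =
      f w * psum b N w - psum (conv a b) N w.
    rewrite psum_conv.
    have -> : f w * psum b N w = \sum_(j < N) f w * (b j * w ^+ j) by rewrite mulr_sumr.
    by rewrite -sumrB; apply: eq_bigr => j _; rewrite mulrBr mulrC.
  ring.
have h1 : cabs (\sum_(j < N) b j * w ^+ j * (f w - psum a (N - j) w)) <=
    2 * K * L * N%:R * q ^+ N.
  apply: le_trans (cabs_sum N (fun j => b j * w ^+ j * (f w - psum a (N - j) w))) _.
  apply: (@le_trans _ _ (\sum_(j < N) 2 * K * L * q ^+ N)).
    apply: ler_sum => j _; rewrite !cabsM cabsX.
    have -> : 2 * K * L * q ^+ N = (2 * L * q ^+ j) * (K * q ^+ (N - j)).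
      by rewrite -[in LHS](subnKC (ltnW (ltn_ord j))) exprD; ring.
    apply: ler_pM; rewrite ?mulr_ge0 ?exprn_ge0 ?cabs_ge0 //; last exact: hK.
    have := ler_wpM2r (exprn_ge0 j (cabs_ge0 w)) (bL j).
    move/le_trans; apply.
    by rewrite /q [(cabs w / s') ^+ j]expr_div_n [leRHS]mulrA [leRHS]mulrAC.
  by rewrite sumr_const card_ord -[leLHS]mulr_natr; have -> : 2 * K * L * q ^+ N * N%:R = 2 * K * L * N%:R * q ^+ N by ring.
have h2 : cabs (f w * (g w - psum b N w)) <= K * L * q ^+ N.
  rewrite cabsM -mulrA; apply: ler_pM; rewrite ?cabs_ge0 //; last exact: hL.
  by have := hK 0%N w ws'; rewrite expr0 mulr1 /psum big_ord0 subr0.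
apply: le_trans (cabsD _ _) _; apply: le_trans (lerD h1 h2) _.
have -> : 2 * K * L * N%:R * q ^+ N + K * L * q ^+ N =
    K * L * ((2 * N%:R + 1) * (s / s') ^+ N) * (cabs w / s) ^+ N.
  have -> : q = (s / s') * (cabs w / s) by rewrite /q; field; rewrite !gt_eqF.
  by rewrite exprMn; ring.
have csN : 0 <= (cabs w / s) ^+ N by rewrite exprn_ge0 // divr_ge0 ?cabs_ge0 // ltW.
by rewrite ler_wpM2r // ler_wpM2l ?hB // mulr_ge0.
Qed.

Lemma geom_inv (A w : R[i]) N : A != 0 -> A + w != 0 ->
  (A + w)^-1 = \sum_(n < N) (- 1) ^+ n * A^-1 ^+ n.+1 * w ^+ n +
               (- w) ^+ N * (A^-1 ^+ N * (A + w)^-1).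
Proof.
move=> A0 Aw; elim: N => [|N IH]; first by rewrite big_ord0 add0r !expr0 !mul1r.
rewrite big_ord_recr /= -addrA {1}IH; congr (_ + _).
rewrite !(exprNn w) !exprS.
by field; rewrite A0 Aw.
Qed.

(** The finite geometric sum for $1/((z-x)+w)$ is integrated with its remainder; the ratio is
    uniformly small because $|z-x|\ge\mathrm{Im}\,z$. *)
Lemma cauchyG_ps mu z : 0 < Im z -> has_ps (fun w => cauchyG mu (z + w)) (Im z).
Proof.
move=> z0; exists (fun n => (- 1) ^+ n * cint mu (fun x => (z - x%:C)^-1 ^+ n.+1)).
move=> s /andP[s0 sz]; have b1 : 0 < Im z - s by rewrite subr_gt0.
exists (2 * (Im z - s)^-1) => N w ws.
have Iw : Im z - s <= Im (z + w).
  by rewrite cImD lerD2l lerNl; apply: le_trans ws; apply: le_trans (normIm_cabs w); rewrite -normrN ler_norm.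
have zw0 : 0 < Im (z + w) by lra.
have bA n : bcmeas (fun x : R => (z - x%:C)^-1 ^+ n) by apply: bcmeasX; exact: cauchy_bcmeas.
have bW := cauchy_bcmeas zw0.
have bT n : bcmeas (fun x : R => (-1) ^+ n * (z - x%:C)^-1 ^+ n.+1 * w ^+ n).
  by apply: bcmeasM; [exact: bcmeasZ | exact: bcmeas_cst].
have bE : bcmeas (fun x : R => (- w) ^+ N * ((z - x%:C)^-1 ^+ N * (z + w - x%:C)^-1)).
  by apply: bcmeasZ; exact: bcmeasM.
have -> : cauchyG mu (z + w) - psum (fun n => (- 1) ^+ n * cint mu (fun x => (z - x%:C)^-1 ^+ n.+1)) N w =
   cint mu (fun x : R => (- w) ^+ N * ((z - x%:C)^-1 ^+ N * (z + w - x%:C)^-1)).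
  have -> : psum (fun n => (- 1) ^+ n * cint mu (fun x => (z - x%:C)^-1 ^+ n.+1)) N w =
     cint mu (fun x : R => \sum_(n < N) (-1) ^+ n * (z - x%:C)^-1 ^+ n.+1 * w ^+ n).
    rewrite (cint_sum mu N bT); apply: eq_bigr => n _.
    rewrite -cintZ // [RHS](cint_eq mu (G := fun x => w ^+ n * ((- 1) ^+ n * (z - x%:C)^-1 ^+ n.+1))).
      by rewrite [RHS]cintZ; [exact: mulrC | exact: bcmeasZ].
    by move=> x; rewrite mulrC.
  rewrite cauchyGE -cintB //; last exact: (@bcmeas_sum _ N (fun n (x : R) => (-1) ^+ n * (z - x%:C)^-1 ^+ n.+1 * w ^+ n)).
  apply: cint_eq => x.
  have -> : z + w - x%:C = (z - x%:C) + w by ring.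
  rewrite {1}(@geom_inv (z - x%:C) w N); first by rewrite addrAC subrr add0r.
    exact: dist_neq0.
  have -> : (z - x%:C) + w = z + w - x%:C by ring.
  exact: dist_neq0.
rewrite -mulrA; apply: cint_boundK; first exact: bE.1.
move=> x; rewrite !cabsM !cabsX cabsN cabsV cabsV.
have n1 : 0 < cabs (z - x%:C) by rewrite cabs_gt0 dist_neq0.
have n2 : 0 < cabs (z + w - x%:C) by rewrite cabs_gt0 dist_neq0.
rewrite mulrA -exprMn mulrC; apply: ler_pM; rewrite ?invr_ge0 ?exprn_ge0 ?mulr_ge0 ?invr_ge0 ?cabs_ge0 //.
  by rewrite lef_pV2 ?posrE //; apply: le_trans Iw _; exact: Im_le_dist.
rewrite lerXn2r ?nnegrE ?mulr_ge0 ?invr_ge0 ?cabs_ge0 ?(ltW s0) //.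
rewrite ler_wpM2l ?cabs_ge0 // lef_pV2 ?posrE //.
by apply: le_trans (ltW sz) _; exact: Im_le_dist.
Qed.

Lemma disk_geom (w : R[i]) N : 1 - w != 0 ->
  (1 - w)^-1 = \sum_(n < N) w ^+ n + w ^+ N * (1 - w)^-1.
Proof.
move=> w1; elim: N => [|N IH]; first by rewrite big_ord0 add0r expr0 mul1r.
by rewrite big_ord_recr /= -addrA {1}IH exprS; congr (_ + _); field.
Qed.

Lemma psi_ps nu : has_ps (fun w => cint nu (fun t => (1 - w * zeta t)^-1)) 1.
Proof.
exists (fun n => cint nu (fun t => zeta t ^+ n)) => s /andP[s0 s1].
have b1 : 0 < 1 - s by rewrite subr_gt0.
exists (2 * (1 - s)^-1) => N w ws.
have w1 : cabs w < 1 by lra.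
have bz n : bcmeas (fun t : R => (zeta t : R[i]) ^+ n) by apply: bcmeasX; exact: bcmeas_zeta.
have bW := bcmeas_disk_inv w1.
have bwz n : bcmeas (fun t : R => (w * zeta t) ^+ n).
  by apply: bcmeasX; apply: bcmeasZ; exact: bcmeas_zeta.
have -> : cint nu (fun t => (1 - w * zeta t)^-1) - psum (fun n => cint nu (fun t => zeta t ^+ n)) N w =
   cint nu (fun t => (w * zeta t) ^+ N * (1 - w * zeta t)^-1).
  have -> : psum (fun n => cint nu (fun t => zeta t ^+ n)) N w =
     cint nu (fun t => \sum_(n < N) (w * zeta t) ^+ n).
    rewrite (cint_sum nu N bwz); apply: eq_bigr => n _.
    by rewrite mulrC -cintZ //; apply: cint_eq => t; rewrite exprMn.
  rewrite -cintB //; last exact: (@bcmeas_sum _ N (fun n t => (w * zeta t) ^+ n)).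
  apply: cint_eq => t.
  by rewrite {1}(@disk_geom (w * zeta t) N) ?disk_neq0 // addrAC subrr add0r.
rewrite -mulrA; apply: cint_boundK; first exact: (bcmeasM (bwz N) bW).1.
move=> t; rewrite cabsM cabsX cabs_mul_zeta cabsV mulrC.
have n1 : 0 < cabs (1 - w * zeta t) by rewrite cabs_gt0 disk_neq0.
apply: ler_pM; rewrite ?invr_ge0 ?exprn_ge0 ?cabs_ge0 //.
  by rewrite lef_pV2 ?posrE //; apply: le_trans (disk_low t w1); lra.
rewrite lerXn2r ?nnegrE ?cabs_ge0 ?divr_ge0 ?cabs_ge0 ?(ltW s0) //.
by rewrite ler_peMr ?cabs_ge0 // invf_ge1 // ltW.
Qed.

Lemma psi_resolvent nu w : cabs w < 1 ->
  cint nu (fun t => (1 - w * zeta t)^-1) = 1 + psi nu w.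
Proof.
move=> w1; rewrite psiE -[X in X + _](cint_cst nu) -cintD; last 2 first.
- exact: bcmeas_cst.
- exact: bcmeas_disk_ker.
by apply: cint_eq => t; rewrite /disk_ker; field; exact: disk_neq0.
Qed.

Lemma psi_identity nu nu' :
  (forall d, 0 < d -> exists p, 0 < cabs p < d /\ psi nu p = psi nu' p) ->
  forall w, cabs w < 1 -> psi nu w = psi nu' w.
Proof.
move=> h w w1.
have := @ps_zero _ 1 ltr01 (has_psB (psi_ps nu) (psi_ps nu')) _ w w1.
rewrite !psi_resolvent //.
have e : 1 + psi nu w - (1 + psi nu' w) = psi nu w - psi nu' w by ring.
rewrite e => /(_ _)/eqP; rewrite subr_eq0 => H; apply/eqP; apply: H => d d0.
have [|p [/andP[p0 pd] hp]] := h (Num.min d 1); first by rewrite lt_min d0 ltr01.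
move: pd; rewrite lt_min => /andP[pd p1].
by exists p; rewrite p0 pd; split => //; rewrite !psi_resolvent // hp subrr.
Qed.

(** Multiplied out, $F(p+2\pi)=F(p)+2\pi$ reads $G(p)-G(p+2\pi)=2\pi G(p)G(p+2\pi)$, an identity
    between power series. It is tested near a point [c] high on the imaginary axis and spreads to
    the disc of radius $\mathrm{Im}\,c$ about it. *)
Lemma classL_of_sector mu (Y : R) :
  (forall p, `|Re p| <= 1 -> Y <= Im p ->
     Ftr mu (p + (2 * pi)%:C) = Ftr mu p + (2 * pi)%:C) -> classL mu.
Proof.
move=> h z z0.
(* Larger than $|z|^2/(2\,\mathrm{Im}\,z)$, so that $|z-iy|<y$, and above [Y]. *)
pose y : R := `|Y| + 1 + ((Re z) ^+ 2 + (Im z) ^+ 2) / (2 * Im z) + 1.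
have y1 : 1 <= y.
  rewrite /y lerDr !addr_ge0 // divr_ge0 ?addr_ge0 ?sqr_ge0 //; lra.
have y0 : 0 < y by lra.
pose c : R[i] := Complex 0 y.
pose f w := cauchyG mu (c + w) - cauchyG mu (c + (2 * pi)%:C + w) -
   (2 * pi)%:C * (cauchyG mu (c + w) * cauchyG mu (c + (2 * pi)%:C + w)).
have p1 : has_ps (fun w => cauchyG mu (c + w)) y by exact: (@cauchyG_ps mu c).
have p2 : has_ps (fun w => cauchyG mu (c + (2 * pi)%:C + w)) y.
  have := @cauchyG_ps mu (c + (2 * pi)%:C); rewrite cImD /= addr0; exact.
have pf : has_ps f y.
  by apply: has_psB; [exact: has_psB | apply: has_psZ; exact: has_psM].
have fE w : 0 < Im (c + w) -> f w = 0 <->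
    Ftr mu (c + w + (2 * pi)%:C) = Ftr mu (c + w) + (2 * pi)%:C.
  move=> w0; rewrite /f.
  have -> : c + (2 * pi)%:C + w = c + w + (2 * pi)%:C by ring.
  have w0' : 0 < Im (c + w + (2 * pi)%:C) by rewrite cImD addr0.
  have n1 := cauchyG_neq0 mu w0; have n2 := cauchyG_neq0 mu w0'.
  rewrite /Ftr; set A := cauchyG _ _ in n1 *; set B := cauchyG _ _ in n2 *.
  set P := (2 * pi)%:C; split => e.
    have e' : A = B + P * (A * B).
      by apply/eqP; rewrite -subr_eq0; apply/eqP; rewrite -e; ring.
    have -> : B^-1 = (B^-1 * A^-1) * A by field; rewrite n1.
    by rewrite {2}e'; field; rewrite n1 n2.
  have -> : A - B - P * (A * B) = A * B * (B^-1 - (A^-1 + P)).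
    by field; rewrite n1 n2.
  by rewrite e subrr mulr0.
have wy : cabs (z - c) < y.
  rewrite -ltr_sqr ?nnegrE ?cabs_ge0 ?(ltW y0) // sqr_cabs cReB cImB /= subr0.
  have : (Re z) ^+ 2 + (Im z) ^+ 2 < 2 * Im z * y.
    rewrite mulrC -ltr_pdivrMr ?mulr_gt0 // /y.
    set q := _ / _; have := normr_ge0 Y; lra.
  by rewrite sqrrB -mulr_natl; lra.
have := ps_zero y0 pf _ wy; rewrite (fE (z - c)); last by rewrite addrC subrK.
have -> : c + (z - c) = z by rewrite addrC subrK.
apply => d d0; pose e := Num.min (d / 2) (1 / 2).
have e0 : 0 < e by rewrite lt_min !divr_gt0.
exists e%:C; rewrite cabsR gtr0_norm // e0 /=; split.
  by rewrite /e gt_min; apply/orP; left; lra.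
apply/fE; first by rewrite cImD addr0.
apply: h; rewrite ?cReD ?cImD /= ?add0r ?addr0.
  by rewrite gtr0_norm // ge_min; apply/orP; right; lra.
have : 0 <= ((Re z) ^+ 2 + (Im z) ^+ 2) / (2 * Im z).
  by rewrite divr_ge0 ?addr_ge0 ?sqr_ge0 //; lra.
by have := ler_norm Y; rewrite /y; set q := _ / _; lra.
Qed.

End PowerSeries.

(** * Convolutions *)

Section Convolutions.
Local Open Scope complex_scope.
Variable R : realType.
Implicit Types (mu nu rho tau sigma : probability R R) (z w p q u v : R[i])
  (g : R[i] -> R[i]) (k Y e r a b : R).

Lemma two_pi_lt8 : 2 * pi < 8 :> R.
Proof. by have := pihalf_lt2 R; lra. Qed.

Lemma cei_lift : exists U : R[i] -> R[i], forall w, w != 0 ->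
  [/\ cei (U w) = w, 0 <= Re (U w) < 2 * pi & Im (U w) = - ln (cabs w)].
Proof.
have h w : exists u, w != 0 -> [/\ cei u = w, 0 <= Re u < 2 * pi & Im u = - ln (cabs w)].
  have [->|w0] := eqVneq w 0; first by exists 0.
  by have [u hu] := cei_surj w0; exists u.
by exists (fun w => sval (cid (h w))) => w w0; exact: (svalP (cid (h w)) w0).
Qed.

Lemma Im_lift_gt w u Y : w != 0 -> Im u = - ln (cabs w) -> cabs w < expR (- Y) -> Y < Im u.
Proof.
move=> w0 -> h; rewrite ltrNr -ltr_expR lnK //.
by rewrite posrE cabs_gt0.
Qed.

Lemma disk_point w : w != 0 -> cabs w < 1 -> exists2 u, 0 < Im u & cei u = w.
Proof.
move=> w0 w1; have [u [h1 _ h3]] := cei_surj w0; exists u => //.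
by apply: (Im_lift_gt w0 h3); rewrite oppr0 expR0.
Qed.

Lemma classL_monotone rho mu1 mu2 : classL mu1 -> classL mu2 ->
  monotone_add rho mu1 mu2 -> classL rho.
Proof.
move=> L1 L2 h z z0; have z0' : 0 < Im (z + (2 * pi)%:C) by rewrite cImD addr0.
by rewrite !h // L2 // L1 //; exact: Im_Ftr.
Qed.

Lemma classL_boolean rho mu1 mu2 : classL mu1 -> classL mu2 ->
  boolean_add rho mu1 mu2 -> classL rho.
Proof.
move=> L1 L2 h z z0; have z0' : 0 < Im (z + (2 * pi)%:C) by rewrite cImD addr0.
have e x : 0 < Im x -> Ftr rho x = Ftr mu1 x + Ftr mu2 x - x.
  by move=> x0; rewrite -[LHS](subrK x) h //; ring.
by rewrite !e // L1 // L2 //; ring.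
Qed.

Lemma wrap_monotone mu1 mu2 nu1 nu2 rho nu : classL mu1 -> classL mu2 ->
  is_wrap nu1 mu1 -> is_wrap nu2 mu2 ->
  monotone_add rho mu1 mu2 -> is_wrap nu rho -> monotone_mult nu nu1 nu2.
Proof.
move=> L1 L2 w1 w2 h wr w wlt.
have [->|w0] := eqVneq w 0; first by rewrite !eta0.
have [u u0 <-] := disk_point w0 wlt.
have Lr := classL_monotone L1 L2 h.
by rewrite (eta_wrap Lr wr) // (eta_wrap L2 w2) // (eta_wrap L1 w1) ?h //; exact: Im_Ftr.
Qed.

Lemma wrap_boolean mu1 mu2 nu1 nu2 rho nu : classL mu1 -> classL mu2 ->
  is_wrap nu1 mu1 -> is_wrap nu2 mu2 ->
  boolean_add rho mu1 mu2 -> is_wrap nu rho -> boolean_mult nu nu1 nu2.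
Proof.
move=> L1 L2 w1 w2 h wr w; rewrite cabs_gt0 => w0 wlt.
have [u u0 <-] := disk_point w0 wlt.
have Lr := classL_boolean L1 L2 h.
rewrite (eta_wrap Lr wr) // (eta_wrap L2 w2) // (eta_wrap L1 w1) //.
by rewrite -!ceiB -ceiD h.
Qed.

(** * Free convolution and subordination *)

Definition cone k Y z := `|Re z| <= k * Im z /\ Y <= Im z.

(** High in a strip of bounded width, $F(p)-p$ is a small fraction of $\mathrm{Im}\,p$, so $F(p)$
    enters the prescribed cone. The bound $8$ exceeds $2\pi$, which permits translation by a
    period. *)
Lemma Ftr_cone mu k Y : 0 < k <= 1 / 4 -> exists2 Y1, 0 < Y1 & forall p (c : R),
  `|Re p| <= 8 -> Y1 <= Im p -> `|c| <= 8 -> cone k Y (Ftr mu p + c%:C).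
Proof.
move=> /andP[k0 k1].
have [|Y2 Y20 hY] := @Ftr_asymp _ mu (k / 8); first by rewrite divr_gt0.
(* Above height $32/k$ the bounded terms, at most $16$ in all, amount to at most half of
   $k\,\mathrm{Im}\,p$. *)
have kV : 0 < 32 / k by rewrite divr_gt0.
exists (Y2 + 8 + 32 / k + 2 * `|Y|).
  by apply: ltr_wpDr; [rewrite mulr_ge0 | rewrite !addr_gt0].
move=> p c Rp Ip cB; have nY := normr_ge0 Y.
have sp : sector Y2 p by split; lra.
have h := hY p sp; have h2 := cabs_sector sp.
have d : cabs (Ftr mu p - p) <= k / 4 * Im p.
  apply: le_trans h _; have -> : k / 4 * Im p = k / 8 * (2 * Im p) by field.
  by rewrite ler_pM2l // divr_gt0.
have d1 := le_trans (normRe_cabs _) d; have d2 := le_trans (normIm_cabs _) d.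
rewrite cReB in d1; rewrite cImB in d2.
have kI : 32 <= k * Im p by rewrite mulrC -ler_pdivrMr //; lra.
have k4 : k / 4 * Im p <= 1 / 16 * Im p by rewrite ler_wpM2r //; lra.
have kk : k * (k / 4 * Im p) <= 1 / 4 * (k / 4 * Im p).
  by rewrite ler_wpM2r // mulr_ge0 ?divr_ge0 //; lra.
move: d2; rewrite ler_norml => /andP[d2 d3].
have I1 : k * Im p - k * (k / 4 * Im p) <= k * Im (Ftr mu p).
  by rewrite -mulrBr ler_pM2l //; lra.
have I2 : 15 / 16 * Im p <= Im (Ftr mu p) by lra.
have I3 : 2 * `|Y| <= Im p by lra.
have I4 : Y <= Im (Ftr mu p) by have := ler_norm Y; lra.
rewrite /cone cReD cImD [Im c%:C]/= [Re c%:C]/= addr0; split => //.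
have : `|Re (Ftr mu p)| <= `|Re p| + `|Re (Ftr mu p) - Re p|.
  by rewrite -[X in `|X| <= _](subrK (Re p)) addrC; exact: ler_normD.
by have := ler_normD (Re (Ftr mu p)) c; lra.
Qed.

Lemma cone_sector k Y z : 0 < k <= 1 / 4 -> 0 < Y -> cone k Y z -> sector Y z.
Proof.
move=> /andP[k0 k1] Y0 [h1 h2]; split => //; apply: le_trans h1 _.
by rewrite ler_piMl; lra.
Qed.

(* The given inverse of [F] is close to the identity high up in the Stolz angle,
   where [F] is injective; this makes it commute with the period. *)
Lemma stolz_inverse_cone mu a b g : 0 < a -> stolz_inverse (Ftr mu) a b g ->
  exists2 Y, 0 < Y & forall k, k < a -> 0 < k <= 1 / 4 -> forall z, cone k Y z ->
  [/\ stolz a b z, cabs (g z - z) <= Im z / 4, sector (Y / 2) (g z),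
     Ftr mu (g z) = z &
     (forall p, sector (Y / 2) p -> Ftr mu p = z -> p = g z) /\
     (classL mu -> forall n : int, cone k Y (z + (2 * pi * n%:~R)%:C) ->
        g (z + (2 * pi * n%:~R)%:C) = g z + (2 * pi * n%:~R)%:C)].
Proof.
move=> a0 [hg has].
(* In the cone $|z|\le2\,\mathrm{Im}\,z$, so the displacement is at most $\mathrm{Im}\,z/4$ and the
   image stays above height $3Y/4\ge Y/2$. *)
have [|M hM] := has (1 / 8); first by rewrite divr_gt0.
have [Yi Yi0 inj] := Ftr_sector_inj mu.
pose Y := 2 * (1 + `|b| + `|M| + Yi).
have nb := normr_ge0 b; have nM := normr_ge0 M.
have Y0 : 0 < Y by rewrite /Y; lra.
exists Y => // k ka k14.
have sinj p q : sector (Y / 2) p -> sector (Y / 2) q -> Ftr mu p = Ftr mu q -> p = q.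
  by move=> [p1 p2] [q1 q2]; apply: inj; split => //; rewrite /Y in p2 q2; lra.
have key z : cone k Y z -> [/\ stolz a b z, cabs (g z - z) <= Im z / 4,
     sector (Y / 2) (g z) & Ftr mu (g z) = z].
  move=> cz; case: (cz) => z1 z2; have sz := cone_sector k14 Y0 cz.
  have z0 : 0 < Im z by lra.
  have st : stolz a b z.
    split; first by have := ler_norm b; rewrite /Y in z2; lra.
    by apply: le_lt_trans z1 _; rewrite ltr_pM2r.
  have d : cabs (g z - z) <= Im z / 4.
    have := hM z st; have c2 := cabs_sector sz.
    have : M < cabs z by apply: lt_le_trans (Im_cabs z); have := ler_norm M; rewrite /Y in z2; lra.
    by move=> h /(_ h); lra.
  have d1 := le_trans (normRe_cabs _) d; have d2 := le_trans (normIm_cabs _) d.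
  rewrite cReB in d1; rewrite cImB in d2.
  move: d2; rewrite ler_norml => /andP[d2 d3].
  have k1 : k * Im z <= 1 / 4 * Im z by rewrite ler_pM2r //; case/andP: k14.
  split => //; last by have [] := hg z st.
  split; last by lra.
  have : `|Re (g z)| <= `|Re z| + `|Re (g z) - Re z|.
    by rewrite -[X in `|X| <= _](subrK (Re z)) addrC; exact: ler_normD.
  lra.
move=> z cz; have [st d sg Fg] := key z cz; split => //; split.
  by move=> p sp Fp; apply: sinj => //; rewrite Fg.
move=> hL n cz'; have [st' d' sg' Fg'] := key _ cz'.
set c := (2 * pi * n%:~R)%:C in cz' st' d' sg' Fg' *.
have g0 : 0 < Im (g z) by case: sg => _ h; lra.
apply: sinj => //; last by rewrite Fg' classL_shift // Fg.
case: cz' => z1 z2; case: sg => s1 s2.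
have d1 := le_trans (normRe_cabs _) d; have d2 := le_trans (normIm_cabs _) d.
rewrite cReB in d1; rewrite cImB ler_norml in d2; case/andP: d2 => d2 d3.
rewrite cImD /= addr0 in z1 z2.
have z0 : 0 < Im z by lra.
have k1 : k * Im z <= 1 / 4 * Im z by rewrite ler_pM2r //; case/andP: k14.
split; rewrite cImD /= addr0 //.
have : `|Re (g z + c)| <= `|Re (z + c)| + `|Re (g z) - Re z|.
  have -> : Re (g z + c) = Re (z + c) + (Re (g z) - Re z) by rewrite !cReD; ring.
  exact: ler_normD.
lra.
Qed.

(** Strictly below [a], as the Stolz angle is open, and at most $1/4$, as the cone estimates
    require. *)
Definition angle_of a : R := Num.min (a / 2) (1 / 4).

Lemma angle_of_lt a : 0 < a -> angle_of a < a.
Proof. by move=> a0; rewrite /angle_of gt_min; apply/orP; left; lra. Qed.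

Lemma angle_of_itv a : 0 < a -> 0 < angle_of a <= 1 / 4.
Proof.
by move=> a0; rewrite /angle_of lt_min ge_min lexx orbT andbT !divr_gt0.
Qed.

Lemma coneW k Y Y' z : Y <= Y' -> cone k Y' z -> cone k Y z.
Proof. by move=> h [h1 h2]; split => //; exact: le_trans h2. Qed.

Lemma classL_free rho mu1 mu2 : classL mu1 -> classL mu2 ->
  free_add rho mu1 mu2 -> classL rho.
Proof.
move=> L1 L2 [a [b [a0 [b0 [gr [g1 [g2 [hr [h1 [h2 hsum]]]]]]]]]].
have [Yr Yr0 Hr] := stolz_inverse_cone a0 hr.
have [Y1 Y10 H1] := stolz_inverse_cone a0 h1.
have [Y2 Y20 H2] := stolz_inverse_cone a0 h2.
have ka := angle_of_lt a0; have k14 := angle_of_itv a0; set k := angle_of a in ka k14.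
have [Y Y0 HY] := Ftr_cone rho (Yr + Y1 + Y2) k14.
apply: (@classL_of_sector _ rho (Y + Yr + 8)) => p Rp Ip.
set z := Ftr rho p.
have p8 := two_pi_lt8; have pi0 := pi_gt0 R.
have cz : cone k (Yr + Y1 + Y2) z.
  by rewrite -[z]addr0; apply: (HY p 0); rewrite ?normr0 //; lra.
have cz' : cone k (Yr + Y1 + Y2) (z + (2 * pi * 1%:~R)%:C).
  by rewrite mulr1; apply: HY; [lra | lra | rewrite ger0_norm; lra].
have W Y' : Y' <= Yr + Y1 + Y2 -> cone k Y' z /\ cone k Y' (z + (2 * pi * 1%:~R)%:C).
  by move=> h; split; exact: coneW h _.
have [|czr czr'] := W Yr; first lra.
have [|cz1 cz1'] := W Y1; first lra.
have [|cz2 cz2'] := W Y2; first lra.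
have [sz _ _ Fr [ur _]] := Hr k ka k14 z czr.
have [sz' _ _ Fr' _] := Hr k ka k14 _ czr'.
have [_ _ _ _ [_ /(_ L1 1%Z cz1') e1]] := H1 k ka k14 z cz1.
have [_ _ _ _ [_ /(_ L2 1%Z cz2') e2]] := H2 k ka k14 z cz2.
(* Injectivity high in the sector identifies the given inverse at $z=F_\rho(p)$ with [p], so that
   the equation for the inverses becomes one for $F_\rho$. *)
have pg : p = gr z by apply: ur => //; split; lra.
have e := hsum _ sz'; rewrite e1 e2 in e.
have gE : gr (z + (2 * pi * 1%:~R)%:C) = p + (2 * pi)%:C.
  have e0 := hsum _ sz; rewrite -pg in e0.
  rewrite -[LHS](subrK (z + (2 * pi * 1%:~R)%:C)) e mulr1.
  have -> : p = (p - z) + z by rewrite subrK.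
  rewrite e0; ring.
by rewrite -gE Fr' mulr1.
Qed.

(** The cut of [U] makes no difficulty: [disc_inverse] asks for a right inverse tending to $0$ at
    the origin. The value at $0$ matches $\eta(0)=0$. *)
Definition lifted_inverse (U g : R[i] -> R[i]) w : R[i] :=
  if w == 0 then 0 else cei (g (U w)).

Definition is_lift (U : R[i] -> R[i]) := forall w, w != 0 ->
  [/\ cei (U w) = w, 0 <= Re (U w) < 2 * pi & Im (U w) = - ln (cabs w)].

Lemma strip_cone k Y u : 0 < k -> 0 <= Re u < 2 * pi -> Y + 8 / k <= Im u -> 0 < Y ->
  cone k Y u.
Proof.
move=> k0 /andP[u1 u2] h Y0; have p8 := two_pi_lt8.
have k8 : 0 < 8 / k by rewrite divr_gt0.
split; last by lra.
rewrite ger0_norm // mulrC; apply: (@le_trans _ _ 8); first lra.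
by rewrite -ler_pdivrMr //; lra.
Qed.

(** Evaluating $\eta(e^{iu})=e^{iF(u)}$ at [g (U w)] gives back [w], and $|w|<e^{-Y'}$ means that
    [U w] lies above height [Y']. Every threshold above [Y] is allowed, so that several inverses can
    share one disc. *)
Lemma lifted_disc_inverse U mu nu a b g : is_lift U -> classL mu -> is_wrap nu mu ->
  0 < a -> stolz_inverse (Ftr mu) a b g ->
  exists Y, forall Y', Y <= Y' -> disc_inverse (eta nu) (expR (- Y')) (lifted_inverse U g).
Proof.
move=> hU L1 w1 a0 hg.
have [Y0 Y00 H] := stolz_inverse_cone a0 hg.
have ka := angle_of_lt a0; have k14 := angle_of_itv a0; set k := angle_of a in ka k14.
have k0 : 0 < k by case/andP: k14.
exists (Y0 + 8 / k) => Y' YY'.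
have key w : w != 0 -> cabs w < expR (- Y') ->
   [/\ Ftr mu (g (U w)) = U w, 0 < Im (g (U w)) & - ln (cabs w) * (3 / 4) <= Im (g (U w))].
  move=> w0 wr; have [c1 c2 c3] := hU w w0.
  have Iu := Im_lift_gt w0 c3 wr.
  have [|_ d [_ sg] Fg _] := H k ka k14 (U w).
    by apply: strip_cone => //; lra.
  split => //; first by lra.
  have d2 := le_trans (normIm_cabs _) d; rewrite cImB ler_norml in d2.
  by case/andP: d2; rewrite -c3; lra.
split.
  move=> w wr; rewrite /lifted_inverse; case: eqVneq => [->|w0].
    by rewrite cabs0 eta0.
  have [Fg g0 _] := key w w0 wr; split; first exact: cabs_cei_lt1.
  by rewrite (eta_wrap L1 w1) // Fg; have [] := hU w w0.
(* The imaginary part of [g (U w)] is at least $3/4$ of that of [U w], and $\frac34(2|\ln e|+1)>-\ln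
   e$. *)
move=> e e0; exists (expR (- (2 * `|ln e| + 1))); split; first exact: expR_gt0.
move=> w wr wd; have [->|w0] := eqVneq w 0; first by rewrite /lifted_inverse eqxx cabs0.
rewrite /lifted_inverse (negbTE w0); have [_ _ h] := key w w0 wr; rewrite cabs_cei -[ltRHS]lnK ?posrE // ltr_expR.
have := Im_lift_gt w0 (u := Complex 0 (- ln (cabs w))) erefl wd; rewrite /=.
have := normr_ge0 (ln e); have := ler_norm (- ln e); rewrite normrN; lra.
Qed.

Lemma wrap_free mu1 mu2 nu1 nu2 rho nu : classL mu1 -> classL mu2 ->
  is_wrap nu1 mu1 -> is_wrap nu2 mu2 ->
  free_add rho mu1 mu2 -> is_wrap nu rho -> free_mult nu nu1 nu2.
Proof.
move=> L1 L2 w1 w2 hf wr; have Lr := classL_free L1 L2 hf.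
have [a [b [a0 [b0 [gr [g1 [g2 [hr [h1 [h2 hsum]]]]]]]]]] := hf.
have [U hU] := cei_lift.
have [Yr Dr] := lifted_disc_inverse hU Lr wr a0 hr.
have [Y1 D1] := lifted_disc_inverse hU L1 w1 a0 h1.
have [Y2 D2] := lifted_disc_inverse hU L2 w2 a0 h2.
have [Y0 Y00 H] := stolz_inverse_cone a0 hr.
have ka := angle_of_lt a0; have k14 := angle_of_itv a0; set k := angle_of a in ka k14.
have k0 : 0 < k by case/andP: k14.
pose Y := `|Yr| + `|Y1| + `|Y2| + Y0 + 8 / k.
have := ler_norm Yr; have := ler_norm Y1; have := ler_norm Y2.
have := normr_ge0 Yr; have := normr_ge0 Y1; have := normr_ge0 Y2.
have k8 : 0 < 8 / k by rewrite divr_gt0.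
move=> n1 n2 n3 n4 n5 n6.
exists (expR (- Y)); split; first exact: expR_gt0.
exists (lifted_inverse U gr), (lifted_inverse U g1), (lifted_inverse U g2).
split; first by apply: Dr; rewrite /Y; lra.
split; first by apply: D1; rewrite /Y; lra.
split; first by apply: D2; rewrite /Y; lra.
move=> w; rewrite cabs_gt0 => w0 wY.
have [c1 c2 c3] := hU w w0; have Iu := Im_lift_gt w0 c3 wY.
have [|st _ _ _ _] := H k ka k14 (U w).
  by apply: strip_cone => //; rewrite /Y in Iu; lra.
rewrite /lifted_inverse (negbTE w0) -{2 4 6}c1 -!ceiB -ceiD hsum //.
Qed.

(** Membership of [tau] in the class is needed before $\eta$ of its wrapping can be computed; it
    holds because [g] and $F_\sigma$ commute with the period high up. It remains to compare
    $g(F_\sigma(u))$ with the lifted inverse at $e^{iF_\sigma(u)}$. *)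
Lemma wrap_sub mu1 mu2 nu1 nu2 tau nu : classL mu1 -> classL mu2 ->
  is_wrap nu1 mu1 -> is_wrap nu2 mu2 ->
  sub_add tau mu2 mu1 -> is_wrap nu tau -> sub_mult nu nu2 nu1.
Proof.
move=> L1 L2 w1 w2 [sigma [hf [a [b [a0 [b0 [g [hg [a' [b' [a'0 [b'0 hs]]]]]]]]]]]] wt.
have Ls := classL_free L2 L1 hf.
have [Yg Yg0 H] := stolz_inverse_cone a0 hg.
have ka := angle_of_lt a0; have k14 := angle_of_itv a0; set k := angle_of a in ka k14.
have k0 : 0 < k by case/andP: k14.
have [U hU] := cei_lift.
have [Yd D1] := lifted_disc_inverse hU L1 w1 a0 hg.
have k8 : 0 < 8 / k by rewrite divr_gt0.
pose Y := Yg + 8 / k + `|Yd|.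
have nYd := normr_ge0 Yd; have lYd := ler_norm Yd.
have [Ys Ys0 HY] := Ftr_cone sigma (Y + 1) k14.
have p8 := two_pi_lt8; have pi0 := pi_gt0 R.
(* Test points have real part at most $1$ in modulus and are moved by $2\pi<8$, hence the bound
   $9$. *)
have a9 : 0 < 9 / a' by rewrite divr_gt0.
pose Y' := Ys + b' + 9 / a'.
have st' p : `|Re p| <= 9 -> Y' < Im p -> stolz a' b' p.
  rewrite /Y' => h1 h2; split; first by lra.
  by apply: le_lt_trans h1 _; rewrite mulrC -ltr_pdivrMr //; lra.
have cq p c : `|Re p| <= 8 -> Y' < Im p -> `|c| <= 8 -> cone k (Y + 1) (Ftr sigma p + c%:C).
  by rewrite /Y' => h1 h2 h3; apply: HY => //; lra.
have cq0 p : `|Re p| <= 8 -> Y' < Im p -> cone k (Y + 1) (Ftr sigma p).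
  by move=> h1 h2; rewrite -[Ftr _ _]addr0; apply: (cq p 0) => //; rewrite normr0.
have YgY : Yg <= Y + 1 by rewrite /Y; lra.
have Lt : classL tau.
  apply: (@classL_of_sector _ tau (Y' + 1)) => p Rp Ip.
  have p0 : 0 < Im p by rewrite /Y' in Ip; lra.
  have [|_ ->] := hs (p + (2 * pi)%:C).
    apply: st'; rewrite ?cReD ?cImD /= ?addr0 //; last by lra.
    by apply: le_trans (ler_normD _ _) _; rewrite (@ger0_norm _ (2 * pi)); lra.
  have [|_ ->] := hs p; first by apply: st'; lra.
  rewrite Ls //.
  have cc : cone k Yg (Ftr sigma p) by apply: coneW YgY _; apply: cq0; lra.
  have [_ _ _ _ [_ /(_ L1 1%Z) e]] := H k ka k14 _ cc.
  rewrite mulr1 in e; apply: e; apply: coneW YgY _; apply: cq; try lra.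
  by rewrite ger0_norm; lra.
have [sigma' ws] := exists_wrap sigma.
exists sigma'; split; first exact: wrap_circ ws.
split; first exact: wrap_free L2 L1 w2 w1 hf ws.
exists (expR (- Y)); split; first exact: expR_gt0.
exists (lifted_inverse U g); split; first by apply: D1; rewrite /Y; lra.
exists (expR (- Y')); split; first exact: expR_gt0.
move=> w wY'; have [->|w0] := eqVneq w 0.
  by rewrite !eta0 /lifted_inverse eqxx cabs0 expR_gt0.
have [c1 c2 c3] := hU w w0; have Iu := Im_lift_gt w0 c3 wY'.
set u := U w in c1 c2 c3 Iu.
have u0 : 0 < Im u by rewrite /Y' in Iu; lra.
have Ru : `|Re u| <= 8 by case/andP: c2 => u1 u2; rewrite ger0_norm //; lra.
rewrite -c1 (eta_wrap Ls ws u0) (eta_wrap Lt wt u0).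
have [|_ ->] := hs u; first by apply: st' => //; lra.
set q := Ftr sigma u.
have cnq : cone k (Y + 1) q by exact: cq0.
have Iq : Y + 1 <= Im q by case: cnq.
have qr : cabs (cei q) < expR (- Y) by rewrite cabs_cei ltr_expR; lra.
split => //; rewrite /lifted_inverse (negbTE (cei_neq0 q)).
have [d1 d2 d3] := hU _ (cei_neq0 q); set v := U (cei q) in d1 d2 d3 *.
have Iv := Im_lift_gt (cei_neq0 q) d3 qr.
have cv : cone k Yg v by apply: strip_cone => //; rewrite /Y in Iv; lra.
(* The chosen logarithm of $e^{iq}$ is [q] up to a multiple of the period, and [g] commutes with
   this translation because both points lie in the cone. *)
have [n qn] := cei_inj (esym d1).
have [_ _ _ _ [_ /(_ L1 n) e]] := H k ka k14 _ cv.
rewrite qn e ?ceiDz // -qn; exact: coneW YgY cnq.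
Qed.

(* [F] separates the points of a high vertical strip modulo the period. *)
Lemma eta_wrap_inj mu nu : classL mu -> is_wrap nu mu -> exists2 d, 0 < d &
  forall w w', cabs w < d -> cabs w' < d -> eta nu w = eta nu w' -> w = w'.
Proof.
move=> hL hw; have [Y1 Y10 inj] := Ftr_sector_inj mu.
have [|Y2 Y20 as_] := @Ftr_asymp _ mu (1 / 24); first by rewrite divr_gt0.
have p8 := two_pi_lt8; have pi0 := pi_gt0 R.
pose Y := 2 * (Y1 + Y2) + 100.
have [U hU] := cei_lift.
have lift w : w != 0 -> cabs w < expR (- Y) -> exists u,
    [/\ cei u = w, 0 < Im u, 0 <= Re u < 2 * pi, Y < Im u & cabs (Ftr mu u - u) <= Im u / 12].
  move=> w0 wY; have [c1 c2 c3] := hU w w0.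
  have Iu := Im_lift_gt w0 c3 wY; exists (U w); split => //; first by rewrite /Y in Iu; lra.
  have su : sector Y2 (U w).
    by case/andP: c2 => u1 u2; split; rewrite ?ger0_norm //; rewrite /Y in Iu; lra.
  have := as_ _ su; have := cabs_sector su; lra.
have nz w : w != 0 -> cabs w < expR (- Y) -> eta nu w != 0.
  by move=> w0 wY; have [u [<- u0 _ _ _]] := lift w w0 wY; rewrite (eta_wrap hL hw) // cei_neq0.
exists (expR (- Y)); first exact: expR_gt0.
move=> w w' hw1 hw2.
have [->|w0] := eqVneq w 0; have [->|w0'] := eqVneq w' 0 => //.
- by rewrite eta0 => /esym/eqP; rewrite (negbTE (nz _ w0' hw2)).
- by rewrite eta0 => /eqP; rewrite (negbTE (nz _ w0 hw1)).
have [u [<- u0 ru iu du]] := lift w w0 hw1; have [v [<- v0 rv iv dv]] := lift w' w0' hw2.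
rewrite !(eta_wrap hL hw) // => /cei_inj [n Fn].
suff -> : u = v + (2 * pi * n%:~R)%:C by rewrite ceiDz.
rewrite -classL_shift // in Fn; apply: inj => //.
  by case/andP: ru => r1 r2; split; rewrite ?ger0_norm //; rewrite /Y in iu; lra.
have du1 := le_trans (normRe_cabs _) du; have du2 := le_trans (normIm_cabs _) du.
have dv1 := le_trans (normRe_cabs _) dv; have dv2 := le_trans (normIm_cabs _) dv.
rewrite cReB in du1 dv1; rewrite cImB in du2 dv2.
have eR : Re (Ftr mu u) = Re (Ftr mu v) + 2 * pi * n%:~R by rewrite Fn classL_shift // cReD.
have eI : Im (Ftr mu u) = Im (Ftr mu v) by rewrite Fn classL_shift // cImD addr0.
(* Values of $F$ equal up to the period force the heights of [u] and [v] to be comparable, and the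
   real part of the translate of [v] to be within a small fraction of them from that of [u]; the
   translate thus stays in the sector. *)
split; rewrite ?cReD ?cImD /= ?addr0; last by rewrite /Y in iv; lra.
move: du1 du2 dv1 dv2 eR; rewrite eI; set t := 2 * pi * n%:~R.
rewrite !ler_norml => /andP[? ?] /andP[? ?] /andP[? ?] /andP[? ?] ?.
by move: ru rv => /andP[? ?] /andP[? ?]; rewrite /Y in iu iv; lra.
Qed.

(** Both inverses tend to $0$, hence take values where [E] is injective. This compares the inverses
    supplied by two instances of [free_mult]. *)
Lemma disc_inverse_unique (E : R[i] -> R[i]) d r r' g g' : 0 < d ->
  (forall w w', cabs w < d -> cabs w' < d -> E w = E w' -> w = w') ->
  0 < r -> 0 < r' -> disc_inverse E r g -> disc_inverse E r' g' ->
  exists2 s, 0 < s & forall w, cabs w < s -> g w = g' w.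
Proof.
move=> d0 inj r0 r'0 [h1 h2] [h1' h2'].
have [e [e0 he]] := h2 _ d0; have [e' [e'0 he']] := h2' _ d0.
exists (Num.min (Num.min r r') (Num.min e e')); first by rewrite !lt_min r0 r'0 e0 e'0.
move=> w; rewrite !lt_min => /andP[/andP[wr wr'] /andP[we we']].
apply: inj; [exact: he | exact: he' |].
by have [_ ->] := h1 w wr; have [_ ->] := h1' w wr'.
Qed.

(** Near $0$ the factors have unique inverses, so the products of these agree: [eta nu] and
    [eta nu'] coincide at the points [gr z], which are nonzero and accumulate at $0$, and the
    identity theorem applies. *)
Lemma free_mult_unique nu nu' mu1 mu2 nu1 nu2 : classL mu1 -> classL mu2 ->
  is_wrap nu1 mu1 -> is_wrap nu2 mu2 -> free_mult nu nu1 nu2 -> free_mult nu' nu1 nu2 ->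
  forall w, cabs w < 1 -> psi nu w = psi nu' w.
Proof.
move=> L1 L2 w1 w2 [r [r0 [gr [g1 [g2 [hr [h1 [h2 e]]]]]]]] [r' [r'0 [gr' [g1' [g2' [hr' [h1' [h2' e']]]]]]]].
have [d1 d10 i1] := eta_wrap_inj L1 w1; have [d2 d20 i2] := eta_wrap_inj L2 w2.
have [s1 s10 u1] := disc_inverse_unique d10 i1 r0 r'0 h1 h1'.
have [s2 s20 u2] := disc_inverse_unique d20 i2 r0 r'0 h2 h2'.
apply: psi_identity => d d0.
have [t [t0 ht]] := hr.2 d d0.
pose m := Num.min (Num.min (Num.min r r') (Num.min s1 s2)) t.
have m0 : 0 < m by rewrite !lt_min r0 r'0 s10 s20 t0.
pose z : R[i] := (m / 2)%:C.
have zE : cabs z = m / 2 by rewrite cabsR gtr0_norm // divr_gt0.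
have zm : cabs z < m by rewrite zE; lra.
move: (zm); rewrite !lt_min => /andP[/andP[/andP[zr zr'] /andP[zs1 zs2]] zt].
have z0 : 0 < cabs z by rewrite zE divr_gt0.
have zn : z != 0 by rewrite -cabs_gt0.
have grE : gr z = gr' z.
  have h := e z z0 zr; rewrite u1 // u2 // -e' // in h.
  by rewrite -[LHS](divfK zn) h divfK.
have [p1 ep] := hr.1 z zr; have [_ ep'] := hr'.1 z zr'.
exists (gr z); split; last by apply: eta_inj_measure => //; rewrite ep grE ep'.
rewrite ht // andbT cabs_gt0; apply: contraNneq zn => g0.
by rewrite -ep g0 eta0.
Qed.

Lemma monotone_mult_unique nu nu' nu1 nu2 : monotone_mult nu nu1 nu2 ->
  monotone_mult nu' nu1 nu2 -> forall w, cabs w < 1 -> psi nu w = psi nu' w.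
Proof. by move=> h h' w w1; apply: eta_inj_measure => //; rewrite h // h'. Qed.

Lemma boolean_mult_unique nu nu' nu1 nu2 : boolean_mult nu nu1 nu2 ->
  boolean_mult nu' nu1 nu2 -> forall w, cabs w < 1 -> psi nu w = psi nu' w.
Proof.
move=> h h' w w1; have [->|w0] := eqVneq w 0; first by rewrite !psi0.
apply: eta_inj_measure => //; rewrite -[LHS](divfK w0) h ?cabs_gt0 //.
by rewrite -h' ?cabs_gt0 // divfK.
Qed.

Lemma wrap_of_psi tau nu nu' : circ nu -> is_wrap nu' tau ->
  (forall w, cabs w < 1 -> psi nu w = psi nu' w) -> is_wrap nu tau.
Proof.
by move=> cn hw e A mA; rewrite (psi_inj cn (wrap_circ hw) e mA) hw.
Qed.

(** * The fibres of the wrapping map *)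

Lemma Ftr_locally_small mu z e : 0 < Im z -> 0 < e -> exists2 d, 0 < d & forall w,
  cabs w < d -> 0 < Im (z + w) /\ cabs (Ftr mu (z + w) - Ftr mu z) <= e.
Proof.
move=> z0 e0; set G := cauchyG mu z; have Gn : G != 0 := cauchyG_neq0 mu z0.
have cG : 0 < cabs G by rewrite cabs_gt0.
have z2 : 0 < Im z ^+ 2 by rewrite exprn_gt0.
pose d := Num.min (Im z / 2) (Num.min (cabs G / 8) (e * cabs G ^+ 2 / 8) * Im z ^+ 2).
have d0 : 0 < d.
  by rewrite lt_min divr_gt0 //= mulr_gt0 // lt_min !divr_gt0 // mulr_gt0 // exprn_gt0.
exists d => // w; rewrite lt_min => /andP[wz wG].
have Iw : Im z / 2 <= Im (z + w).
  rewrite cImD; have := normIm_cabs w; rewrite ler_norml => /andP[h _]; lra.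
have zw0 : 0 < Im (z + w) by lra.
split => //.
set G' := cauchyG mu (z + w).
have hG : cabs (G' - G) <= 4 * (cabs w / Im z ^+ 2).
  have -> : G' - G = cint mu (fun x => - w * ((z + w - x%:C)^-1 * (z - x%:C)^-1)).
    rewrite -cintB; try exact: cauchy_bcmeas.
    by apply: cint_eq => x; field; rewrite !dist_neq0.
  have -> : 4 * (cabs w / Im z ^+ 2) = 2 * (2 * (cabs w / Im z ^+ 2)) by ring.
  apply: cint_boundK.
    by apply: (bcmeasZ _ (bcmeasM (cauchy_bcmeas zw0) (cauchy_bcmeas z0))).1.
  move=> x; rewrite !cabsM cabsN !cabsV.
  have n1 : Im z / 2 <= cabs (z + w - x%:C) := le_trans Iw (Im_le_dist _ _).
  have n2 := Im_le_dist z x.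
  have -> : 2 * (cabs w / Im z ^+ 2) = cabs w * ((Im z / 2)^-1 * (Im z)^-1).
    by field; rewrite gt_eqF.
  rewrite ler_wpM2l ?cabs_ge0 //; apply: ler_pM; rewrite ?invr_ge0 ?cabs_ge0 //.
    by rewrite lef_pV2 // posrE ?divr_gt0 //; apply: lt_le_trans n1; rewrite divr_gt0.
  by rewrite lef_pV2 // posrE //; exact: lt_le_trans n2.
have small : cabs w / Im z ^+ 2 < Num.min (cabs G / 8) (e * cabs G ^+ 2 / 8).
  by rewrite ltr_pdivrMr.
move: small; rewrite lt_min => /andP[s1 s2].
have G2 : cabs G / 2 <= cabs G'.
  have -> : G' = G - (G - G') by ring.
  by have := cabs_lowerB G (G - G'); rewrite (cabsBC G G'); lra.
have cG' : 0 < cabs G' by lra.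
have Gn' : G' != 0 by rewrite -cabs_gt0.
have -> : Ftr mu (z + w) - Ftr mu z = (G - G') / (G' * G).
  by rewrite /Ftr -/G -/G'; field; rewrite Gn Gn'.
rewrite cabs_div cabsM ler_pdivrMr ?mulr_gt0 // cabsBC.
apply: (@le_trans _ _ (e * (cabs G ^+ 2 / 2))); first by lra.
rewrite ler_pM2l //; have -> : cabs G ^+ 2 / 2 = cabs G / 2 * cabs G by ring.
by rewrite ler_pM2r.
Qed.

(** The inequality $|z-iy|<y$ amounts to $|z|^2<2y\,\mathrm{Im}\,z$: the discs of radius [y] about
    $iy$ exhaust the half-plane. *)
Lemma halfplane_in_disk z : 0 < Im z -> exists2 Y, 0 < Y & forall y, Y <= y ->
  cabs (z - Complex 0 y) < y.
Proof.
move=> z0; pose q := ((Re z) ^+ 2 + (Im z) ^+ 2) / (2 * Im z).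
have q0 : 0 <= q by rewrite divr_ge0 ?addr_ge0 ?sqr_ge0 // mulr_ge0 // ltW.
exists (q + 1) => [|y qy]; first by lra.
have y0 : 0 < y by lra.
rewrite -ltr_sqr ?nnegrE ?cabs_ge0 ?(ltW y0) // sqr_cabs cReB cImB /= subr0.
have : (Re z) ^+ 2 + (Im z) ^+ 2 < 2 * Im z * y.
  by rewrite mulrC -ltr_pdivrMr ?mulr_gt0 // -/q; lra.
by rewrite sqrrB -mulr_natl; lra.
Qed.

(** The integer could vary with the point. Continuity makes it constant near a centre [c], the
    identity theorem extends the equation to the disc of radius $\mathrm{Im}\,c$, and a large disc
    holding both $i$ and [z] carries over the integer found at $i$. *)
Lemma Ftr_shift_const rho tau :
  (forall z, 0 < Im z -> cei (Ftr rho z) = cei (Ftr tau z)) ->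
  exists n : int, forall z, 0 < Im z -> Ftr rho z = Ftr tau z + (2 * pi * n%:~R)%:C.
Proof.
move=> h.
have pi0 := pi_gt0 R; have pi2 := pi_ge2 R.
have ball c (n : int) : 0 < Im c -> Ftr rho c = Ftr tau c + (2 * pi * n%:~R)%:C ->
    forall z, cabs (z - c) < Im c -> 0 < Im z -> Ftr rho z = Ftr tau z + (2 * pi * n%:~R)%:C.
  move=> c0 en z zc z0; set P := (2 * pi * n%:~R)%:C in en *.
  pose f w := cauchyG tau (c + w) - cauchyG rho (c + w) -
    P * (cauchyG tau (c + w) * cauchyG rho (c + w)).
  have pf : has_ps f (Im c).
    by apply: has_psB; [apply: has_psB | apply: has_psZ; apply: has_psM]; exact: cauchyG_ps.
  have fE w : 0 < Im (c + w) -> f w = 0 <-> Ftr rho (c + w) = Ftr tau (c + w) + P.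
    move=> w0; rewrite /f.
    have n1 := cauchyG_neq0 tau w0; have n2 := cauchyG_neq0 rho w0.
    rewrite /Ftr; set A := cauchyG _ _ in n1 *; set B := cauchyG _ _ in n2 *.
    split => e.
      have e' : A = B + P * (A * B).
        by apply/eqP; rewrite -subr_eq0; apply/eqP; rewrite -e; ring.
      have -> : B^-1 = (B^-1 * A^-1) * A by field; rewrite n1.
      by rewrite {2}e'; field; rewrite n1 n2.
    have -> : A - B - P * (A * B) = A * B * (B^-1 - (A^-1 + P)).
      by field; rewrite n1 n2.
    by rewrite e subrr mulr0.
  have cz : c + (z - c) = z by rewrite addrC subrK.
  have := ps_zero c0 pf _ zc; rewrite (fE (z - c)) cz //.
  apply => d d0.
  have [d1 d10 h1] := @Ftr_locally_small rho c 1 c0 ltr01.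
  have [d2 d20 h2] := @Ftr_locally_small tau c 1 c0 ltr01.
  pose t := Num.min d (Num.min d1 d2) / 2.
  have m0 : 0 < Num.min d (Num.min d1 d2) by rewrite !lt_min d0 d10 d20.
  have t0 : 0 < t by rewrite divr_gt0.
  have : t < Num.min d (Num.min d1 d2) by rewrite /t; lra.
  rewrite !lt_min => /and3P[td td1 td2].
  exists t%:C; rewrite cabsR gtr0_norm // t0; split => //.
  have ct : cabs (t%:C : R[i]) = t by rewrite cabsR gtr0_norm.
  have [|k0 k1] := h1 t%:C; first by rewrite ct.
  have [|_ k2] := h2 t%:C; first by rewrite ct.
  apply/fE => //; have [m em] := cei_inj (h _ k0).
  rewrite em; congr (_ + _); congr (_%:C); congr (_ * _); congr (_%:~R).
  (* Each $F$ moves by at most $1$, whereas distinct integers would give a difference of at least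
     $2\pi>2$. *)
  have : cabs ((2 * pi * (m - n)%:~R)%:C : R[i]) <= 2.
    have -> : (2 * pi * (m - n)%:~R)%:C = (Ftr rho (c + t%:C) - Ftr rho c) -
        (Ftr tau (c + t%:C) - Ftr tau c).
      rewrite em en /P rmorphB /= mulrBr rmorphB /=; ring.
    by apply: le_trans (cabsB _ _) _; lra.
  rewrite cabsR normrM (@ger0_norm _ (2 * pi)); last lra.
  have [->//|mn] := eqVneq m n.
  have : 1 <= `|(m - n)%:~R : R|.
    by rewrite -intr_norm ler1z -gtz0_ge1 normr_gt0 subr_eq0.
  move=> g1 g2; have : 4 * 1 <= 2 * pi * `|(m - n)%:~R : R| by apply: ler_pM; lra.
  by move=> g3; exfalso; lra.
have i0 : 0 < Im (Complex 0 (1 : R)) by rewrite /=.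
have [n hn] := cei_inj (h _ i0).
exists n => z z0.
have [Y Y0 hY] := halfplane_in_disk z0; have [Y' Y'0 hY'] := halfplane_in_disk i0.
pose y := Y + Y'; have y0 : 0 < y by rewrite /y; lra.
pose c : R[i] := Complex 0 y; have c0 : 0 < Im c by [].
have [m hm] := cei_inj (h _ c0).
have e1 : cabs (Complex 0 1 - c) < Im c by apply: hY'; rewrite /y; lra.
have e2 : cabs (z - c) < Im c by apply: hY; rewrite /y; lra.
have := ball c m c0 hm _ e1 i0; rewrite hn => /addrI hnm.
by rewrite hnm; exact: (ball c m c0 hm).
Qed.

Lemma wrap_shifted nu rho tau : classL rho -> classL tau ->
  is_wrap nu rho -> is_wrap nu tau -> exists n : int, shifted rho tau n.
Proof.
move=> Lr Lt wr wt.
have [|n hn] := @Ftr_shift_const rho tau.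
  by move=> z z0; rewrite -(eta_wrap Lr wr) // (eta_wrap Lt wt).
(* Adding $2\pi n$ to $F_\tau$ translates the argument of $G_\tau$ by $2\pi n$, that is, moves the
   measure by $-2\pi n$. *)
exists (- n).
have mphi : measurable_fun setT (fun x : R => x + 2 * pi * (- n)%:~R).
  exact: measurable_funD.
have [m hm] := exists_pushforward tau mphi.
move=> A mA; rewrite -[RHS](hm A mA); apply: cauchyG_inj mA => z z0.
rewrite [RHS]cauchyGE (cint_pushforward mphi hm); last exact: cauchy_bcmeas.
rewrite cauchyG_Ftr hn // -cauchyG_shift // cauchyGE; apply: cint_eq => x.
by congr (_^-1); rewrite rmorphD /= mulrNz mulrN rmorphN /=; ring.
Qed.

End Convolutions.

Theorem theorem4p5 (R : realType) :
  (* direct part: for mu1, mu2 in L *)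
  (forall mu1 mu2 : probability R R, classL mu1 -> classL mu2 ->
   forall nu1 nu2 : probability R R, is_wrap nu1 mu1 -> is_wrap nu2 mu2 ->
     (forall rho nu : probability R R,
        monotone_add rho mu1 mu2 -> is_wrap nu rho -> monotone_mult nu nu1 nu2) /\
     (forall rho nu : probability R R,
        boolean_add rho mu1 mu2 -> is_wrap nu rho -> boolean_mult nu nu1 nu2) /\
     (forall rho nu : probability R R,
        free_add rho mu1 mu2 -> is_wrap nu rho -> free_mult nu nu1 nu2) /\
     (forall tau nu : probability R R,
        sub_add tau mu2 mu1 -> is_wrap nu tau -> sub_mult nu nu2 nu1)) /\
  (* converse part: for nu1, nu2 in ID^{x_B}_* *)
  (forall nu1 nu2 : probability R R, IDB_star nu1 -> IDB_star nu2 ->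
   forall mu1 mu2 : probability R R, classL mu1 -> classL mu2 ->
     is_wrap nu1 mu1 -> is_wrap nu2 mu2 ->
     (forall nu3 tau : probability R R, circ nu3 -> monotone_mult nu3 nu1 nu2 ->
        monotone_add tau mu1 mu2 ->
        classL tau /\ is_wrap nu3 tau /\
        forall rho : probability R R, classL rho -> is_wrap nu3 rho ->
          exists n : int, shifted rho tau n) /\
     (forall nu3 tau : probability R R, circ nu3 -> boolean_mult nu3 nu1 nu2 ->
        boolean_add tau mu1 mu2 ->
        classL tau /\ is_wrap nu3 tau /\
        forall rho : probability R R, classL rho -> is_wrap nu3 rho ->
          exists n : int, shifted rho tau n) /\
     (forall nu3 tau : probability R R, circ nu3 -> free_mult nu3 nu1 nu2 ->
        free_add tau mu1 mu2 ->
        classL tau /\ is_wrap nu3 tau /\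
        forall rho : probability R R, classL rho -> is_wrap nu3 rho ->
          exists n : int, shifted rho tau n)).
Proof.
split=> [mu1 mu2 L1 L2 nu1 nu2 w1 w2|nu1 nu2 _ _ mu1 mu2 L1 L2 w1 w2].
  split; first by move=> rho nu; exact: wrap_monotone.
  split; first by move=> rho nu; exact: wrap_boolean.
  split; first by move=> rho nu; exact: wrap_free.
  by move=> tau nu; exact: wrap_sub.
(* In each case [nu'] is the wrapping of [tau], to which the direct part applies; [nu3] satisfies
   the same relation, and equality of [psi] transfers the wrapping to it. *)
have wrapped nu3 nu' tau : circ nu3 -> classL tau -> is_wrap nu' tau ->
    (forall w, cabs w < 1 -> psi nu3 w = psi nu' w) ->
    classL tau /\ is_wrap nu3 tau /\ forall rho : probability R R,
      classL rho -> is_wrap nu3 rho -> exists n : int, shifted rho tau n.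
  move=> c3 Lt wt e; have w3 := wrap_of_psi c3 wt e.
  by split=> //; split=> // rho Lr wr; exact: wrap_shifted w3.
split; [|split] => nu3 tau c3 hm ha; have [nu' wt] := exists_wrap tau.
- apply: (wrapped nu3 nu') => //; first exact: classL_monotone ha.
  by apply: monotone_mult_unique hm _; exact: wrap_monotone ha wt.
- apply: (wrapped nu3 nu') => //; first exact: classL_boolean ha.
  by apply: boolean_mult_unique hm _; exact: wrap_boolean ha wt.
- apply: (wrapped nu3 nu') => //; first exact: classL_free ha.
  by apply: (free_mult_unique L1 L2 w1 w2 hm); exact: wrap_free ha wt.
Qed.
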